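(* Let $\Omega$, $\mathcal{T}_h$, $S_h,V_h,R_h,X_h$, $\Delta t=T/N$, the constants $\nu,\gamma,\lambda,k>0$ and the functions $b,\psi,w$, $j=\psi+w$ be as in the context. Let $\phi_0\in H^1(\Omega)$, $\mathbf{F}_0\in H^1(\Omega;\mathbb{R}^{3\times3})$. Write $J^n=\sqrt{\int_\Omega (j(\phi_h^n,\mathbf{F}_h^n))+k}$. For all $n=0,\dots,N-1$, given $\mathbf{v}_h^n\in V_h$, $\phi_h^n,\mu_h^n\in S_h$, $\mathbf{F}_h^n,\mathbf{M}_h^n\in X_h$, $\beta_h^n\in\mathbb{R}_+$, with $\phi_h^0=P_h^S(\phi_0)$, $\mathbf{F}_h^0=P_h^X(\mathbf{F}_0)$, $\beta_h^0=\sqrt{\int_\Omega (j(\phi_h^0,\mathbf{F}_h^0))+k}$, $\mathbf{v}_h^0=\mathbf{0}$, $\mu_h^0=0$, $\mathbf{M}_h^0=\mathbf{0}$, there exists a unique solution $(\mathbf{v}_h^{n+1},s_h^{n+1},\mathbf{F}_h^{n+1},\mathbf{M}_h^{n+1},\phi_h^{n+1},\mu_h^{n+1},\beta_h^{n+1})\in V_h\times R_h\times X_h\times X_h\times S_h\times S_h\times\mathbb{R}$ of the following system, required to hold for all $(\mathbf{u}_h,p_h,\boldsymbol{\Theta}_h,\boldsymbol{\Pi}_h,\xi_h,\chi_h)\in V_h\times R_h\times X_h\times X_h\times S_h\times S_h$: $$\nu\int_\Omega\nabla\mathbf{v}_h^{n+1}:\nabla\mathbf{u}_h-\int_\Omega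 s_h^{n+1}\operatorname{div}\mathbf{u}_h=\frac{\beta_h^{n+1}}{J^n}\left[\int_\Omega\mu_h^n\nabla\phi_h^n\cdot\mathbf{u}_h-\int_\Omega(\mathbf{M}_h^n(\mathbf{F}_h^n)^T):\nabla\mathbf{u}_h+\int_\Omega(\nabla\mathbf{F}_h^n\odot\mathbf{M}_h^n)\cdot\mathbf{u}_h\right],$$ $$\int_\Omega p_h\operatorname{div}\mathbf{v}_h^{n+1}=0,$$ $$\int_\Omega(\mathbf{F}_h^{n+1}-\mathbf{F}_h^n):\boldsymbol{\Theta}_h+\Delta t\frac{\beta_h^{n+1}}{J^n}\left[\int_\Omega(\mathbf{v}_h^n\cdot\nabla)\mathbf{F}_h^n:\boldsymbol{\Theta}_h-\int_\Omega(\nabla\mathbf{v}_h^n)\mathbf{F}_h^n:\boldsymbol{\Theta}_h\right]+\Delta t\,\gamma\int_\Omega\mathbf{M}_h^{n+1}:\boldsymbol{\Theta}_h=0,$$ $$\int_\Omega\mathbf{M}_h^{n+1}:\boldsymbol{\Pi}_h=\frac{\beta_h^{n+1}}{J^n}\int_\Omega\partial_{\mathbf{F}}w(\phi_h^n,\mathbf{F}_h^n):\boldsymbol{\Pi}_h+\lambda\int_\Omega\sum_{i,j,k=1}^3\partial_k(\mathbf{F}_h^{n+1})_{ij}\,\partial_k(\boldsymbol{\Pi}_h)_{ij},$$ $$\int_\Omega(\phi_h^{n+1}-\phi_h^n)\xi_h+\Delta t\frac{\beta_h^{n+1}}{J^n}\int_\Omega(\mathbf{v}_h^n\cdot\nabla\phi_h^n)\xi_h+\Delta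 t\int_\Omega b(\phi_h^n)\nabla\mu_h^{n+1}\cdot\nabla\xi_h=0,$$ $$\int_\Omega\mu_h^{n+1}\chi_h=\int_\Omega\nabla\phi_h^{n+1}\cdot\nabla\chi_h+\frac{\beta_h^{n+1}}{J^n}\int_\Omega\partial_\phi j(\phi_h^n,\mathbf{F}_h^n)\chi_h,$$ $$\beta_h^{n+1}-\beta_h^n=\frac{1}{2J^n}\Big[\int_\Omega\partial_\phi j(\phi_h^n,\mathbf{F}_h^n)(\phi_h^{n+1}-\phi_h^n)+\int_\Omega\partial_{\mathbf{F}}w(\phi_h^n,\mathbf{F}_h^n):(\mathbf{F}_h^{n+1}-\mathbf{F}_h^n)+\Delta t\int_\Omega(\mathbf{v}_h^n\cdot\nabla)\mathbf{F}_h^n:\mathbf{M}_h^{n+1}$$ $$-\Delta t\int_\Omega(\nabla\mathbf{F}_h^n\odot\mathbf{M}_h^n)\cdot\mathbf{v}_h^{n+1}-\Delta t\int_\Omega(\nabla\mathbf{v}_h^n)\mathbf{F}_h^n:\mathbf{M}_h^{n+1}+\Delta t\int_\Omega(\mathbf{M}_h^n(\mathbf{F}_h^n)^T):\nabla\mathbf{v}_h^{n+1}$$ $$+\Delta t\int_\Omega(\mathbf{v}_h^n\cdot\nabla\phi_h^n)\mu_h^{n+1}-\Delta t\int_\Omega\mu_h^n\nabla\phi_h^n\cdot\mathbf{v}_h^{n+1}\Big].$$ This solution satisfies the stability bound $$\max_{n=0\to N-1}\left(\tfrac12\|\nabla\phi_h^{n+1}\|_{L^2(\Omega;\mathbb{R}^3)}^2+\tfrac\lambda2\|\nabla\mathbf{F}_h^{n+1}\|_{L^2(\Omega;\mathbb{R}^{3\times3\times3})}^2+(\beta_h^{n+1})^2\right)$$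 $$+\frac{(\Delta t)^2}{2}\sum_{n=0}^{N-1}\left\|\frac{\nabla(\phi_h^{n+1}-\phi_h^n)}{(\Delta t)^2}\right\|_{L^2(\Omega;\mathbb{R}^3)}^2+\frac{\lambda(\Delta t)^2}{2}\sum_{n=0}^{N-1}\left\|\frac{\nabla(\mathbf{F}_h^{n+1}-\mathbf{F}_h^n)}{(\Delta t)^2}\right\|_{L^2(\Omega;\mathbb{R}^{3\times3\times3})}^2$$ $$+(\Delta t)^2\sum_{n=0}^{N-1}\left\|\frac{\beta_h^{n+1}-\beta_h^n}{(\Delta t)^2}\right\|_{L^2(\Omega)}^2+\Delta t\,\nu\sum_{n=0}^{N-1}\|\nabla\mathbf{v}_h^{n+1}\|_{L^2(\Omega;\mathbb{R}^{3\times3})}^2+\Delta t\,\gamma\sum_{n=0}^{N-1}\|\mathbf{M}_h^{n+1}\|_{L^2(\Omega;\mathbb{R}^{3\times3})}^2$$ $$+\Delta t\sum_{n=0}^{N-1}\int_\Omega b(\phi_h^n)\nabla\mu_h^{n+1}\cdot\nabla\mu_h^{n+1}\le C(\phi_h^0,\mathbf{F}_h^0,\beta_h^0)+C.$$ Moreover, the function $$(\beta_h^{n+1})^2+\tfrac12\|\nabla\phi_h^{n+1}\|_{L^2(\Omega;\mathbb{R}^3)}^2+\tfrac\lambda2\|\nabla\mathbf{F}_h^{n+1}\|_{L^2(\Omega;\mathbb{R}^{3\times3\times3})}^2$$ is a decreasing (Lyapunov) function for the discrete solution.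
   Context: Notation. $\mathbf{A}:\mathbf{B}=\sum_{i,j}A_{ij}B_{ij}$, $|\mathbf{A}|=(\mathbf{A}:\mathbf{A})^{1/2}$; $(\nabla\mathbf{v})_{ij}=\partial_jv_i$; $(\nabla\mathbf{F})_{ijk}=\partial_kF_{ij}$; $((\mathbf{v}\cdot\nabla)\mathbf{F})_{ij}=\sum_kv_k\partial_kF_{ij}$; $(\nabla\mathbf{F}\odot\mathbf{M})_k=\sum_{i,j}\partial_kF_{ij}M_{ij}$. $\partial_{\mathbf{F}}w$ is the matrix of partial derivatives of $w$ with respect to the entries of its matrix argument; $\partial_\phi$ is the partial derivative with respect to the scalar argument. Discretization. $\Omega\subset\mathbb{R}^3$ is a bounded domain with boundary of class $C^2$, and $\mathcal{T}_h$ is a quasi-uniform conforming decomposition of $\Omega$ into 3-simplices $K$, with $h>0$ the maximal diameter. With $\mathbb{P}_l(K)$ the space of polynomials of total order $l$ in $K$, $S_h=\{s\in C^0(\bar\Omega):s|_K\in\mathbb{P}_1(K)\ \forall K\in\mathcal{T}_h\}$, $V_h=\{\mathbf{v}\in C^0(\bar\Omega;\mathbb{R}^3)\cap H_0^1(\Omega;\mathbb{R}^3):\mathbf{v}|_K\in[\mathbb{P}_2(K)]^3\ \forall K\in\mathcal{T}_h\}$, $X_h=\{\mathbf{A}\in C^0(\bar\Omega;\mathbb{R}^{3\times3}):\mathbf{A}|_K\in[\mathbb{P}_1(K)]^{3\times3}\ \forall K\in\mathcal{T}_h\}$, $R_h=\{q\in S_h:\int_\Omega q=0\}$. The pair $(V_h,R_h)$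 (lowest order Taylor–Hood elements) satisfies the discrete Ladyzhenskaya–Babuška–Brezzi stability condition. $P_h^S$ and $P_h^X$ are the $L^2$-projections onto $S_h$ and $X_h$. $T>0$, $N\in\mathbb{N}$, $\Delta t=T/N$. Assumptions on the functions. - $b\in C^0(\mathbb{R})$ and there are $b_0,b_1>0$ with $b_0\le b(r)\le b_1$ for all $r\in\mathbb{R}$. - $w\in C^1(\mathbb{R}\times\mathbb{R}^{3\times3};\mathbb{R})$ and there are $p\in[0,6)$, $d_1\ge0$, $d_2,d_3,d_4>0$ with $-d_1\le w(r,\mathbf{T})\le d_2(1+|\mathbf{T}|^p)$, $|\partial_{\mathbf{T}}w(r,\mathbf{T})|\le d_3(1+|\mathbf{T}|^{p-1})$, $|\partial_rw(r,\mathbf{T})|\le d_4(1+|\mathbf{T}|^p)$ for all $r\in\mathbb{R}$, $\mathbf{T}\in\mathbb{R}^{3\times3}$. - $\psi\in C^1(\mathbb{R})$ and there are $c_1>0$, $c_2\ge0$ with $|\psi'(r)|\le c_1(|r|^l+1)$, $\psi(r)\ge-c_2$ for all $r\in\mathbb{R}$, where $l\in[0,6+\frac{8}{\max(2,2p-6)})$; moreover $\psi=\psi_++\psi_-$ with $\psi_+$ convex, $\psi_-$ concave and $|\psi_-''(r)|\le c_1(|r|^q+1)$ for all $r\in\mathbb{R}$, $q\in[0,4)$. - $j(\phi,\mathbf{F})=\psi(\phi)+w(\phi,\mathbf{F})$. The scheme is built on the scalar auxiliary variable $\beta=\sqrt{\int_\Omega (j(\phi,\mathbf{F}))+k}$,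 with a constant $k>c_2+d_1$, chosen so that $\beta>0$; $\beta_h^n$ is its discrete counterpart. Constants. $C$ denotes a generic positive constant independent of the unknown variables and of the discretization and regularization parameters; $C(a,b,\dots)$ denotes a constant depending on $a,b,\dots$.
   Formalization: Increments are divided by Δt, not (Δt)^2, in the uniform bound, which is false as printed; the printed bound is shown with constants depending on Δt. Simplices at the C^2 boundary may be curved; k makes the radicand of β positive for all continuous φ, F. *)

(* Defs.v *)
From HB Require Import structures.
From mathcomp Require Import all_boot all_order all_algebra.
From mathcomp Require Import all_classical all_reals all_analysis.

Set Implicit Arguments.
Unset Strict Implicit.
Unset Printing Implicit Defensive.

Import Order.TTheory GRing.Theory Num.Theory.
Import numFieldNormedType.Exports.

Local Open Scope classical_set_scope.
Local Open Scope ring_scope.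

(** * Integration over subsets of R^3

   Points of R^3 are row vectors, which carry the normed-space structure. The
   library has Lebesgue measure on R and binary products of measures, so the
   integral is taken in the coordinates (x, y, z) of R * R * R. *)

Definition pt {R : realType} (p : R * R * R) : 'rV[R]_3 :=
  \row_(i < 3) [:: p.1.1; p.1.2; p.2]`_i.

Definition leb3 (R : realType) :=
  [the {measure set (measurableTypeR R * measurableTypeR R * measurableTypeR R)
          -> \bar R}
   of ((@lebesgue_measure R \x @lebesgue_measure R) \x @lebesgue_measure R)%E].

Definition intO {R : realType} (Om : set 'rV[R]_3) (f : 'rV[R]_3 -> R) : R :=
  \int[@leb3 R]_(p in pt @^-1` Om) f (pt p).

Definition L2 {R : realType} (Om : set 'rV[R]_3) (f : 'rV[R]_3 -> R) : Prop :=
  measurable_fun (pt @^-1` Om) (f \o pt) /\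
  (@leb3 R).-integrable (pt @^-1` Om) (fun p => (f (pt p) ^+ 2)%:E).

(** * Vector calculus *)

Definition dot {R : realType} (u v : 'rV[R]_3) : R :=
  \sum_(k < 3) u 0 k * v 0 k.

Definition frob {R : realType} (A B : 'M[R]_3) : R :=
  \sum_(i < 3) \sum_(j < 3) A i j * B i j.

Definition fnorm {R : realType} (A : 'M[R]_3) : R := Num.sqrt (frob A A).

Definition pd {R : realType} (k : 'I_3) (f : 'rV[R]_3 -> R) (x : 'rV[R]_3) : R :=
  'D_(delta_mx 0 k) f x.

Definition grad {R : realType} (f : 'rV[R]_3 -> R) (x : 'rV[R]_3) : 'rV[R]_3 :=
  \row_(k < 3) pd k f x.

Definition vgrad {R : realType} (v : 'rV[R]_3 -> 'rV[R]_3) (x : 'rV[R]_3) :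
    'M[R]_3 :=
  \matrix_(i < 3, j < 3) pd j (fun y => v y 0 i) x.

Definition div {R : realType} (v : 'rV[R]_3 -> 'rV[R]_3) (x : 'rV[R]_3) : R :=
  \sum_(i < 3) pd i (fun y => v y 0 i) x.

(* [mpd k F x] is the matrix of the k-th partial derivatives of F, that is
   the slice (nabla F)_{ijk} with k fixed. *)
Definition mpd {R : realType} (k : 'I_3) (F : 'rV[R]_3 -> 'M[R]_3)
    (x : 'rV[R]_3) : 'M[R]_3 :=
  \matrix_(i < 3, j < 3) pd k (fun y => F y i j) x.

Definition mgrad_dot {R : realType} (F G : 'rV[R]_3 -> 'M[R]_3)
    (x : 'rV[R]_3) : R :=
  \sum_(k < 3) frob (mpd k F x) (mpd k G x).

Definition convect {R : realType} (v : 'rV[R]_3 -> 'rV[R]_3)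
    (F : 'rV[R]_3 -> 'M[R]_3) (x : 'rV[R]_3) : 'M[R]_3 :=
  \sum_(k < 3) v x 0 k *: mpd k F x.

Definition odot {R : realType} (F M : 'rV[R]_3 -> 'M[R]_3) (x : 'rV[R]_3) :
    'rV[R]_3 :=
  \row_(k < 3) frob (mpd k F x) (M x).

Definition C1 {R : realType} {V W : normedModType R} (f : V -> W) : Prop :=
  (forall x, differentiable f x) /\ (forall v, continuous (fun x => 'D_v f x)).

Definition C2 {R : realType} {V W : normedModType R} (f : V -> W) : Prop :=
  C1 f /\ (forall v, C1 (fun x => 'D_v f x)).

(** * Sobolev spaces *)

Definition smooth {R : realType} (f : 'rV[R]_3 -> R) : Prop :=
  forall s : seq 'I_3, let g := foldr pd f s in
  continuous g /\ (forall k x, derivable g x (delta_mx 0 k)).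

Definition test_fun {R : realType} (Om : set 'rV[R]_3) (f : 'rV[R]_3 -> R) :
    Prop :=
  smooth f /\
  exists K, [/\ compact K, K `<=` Om & forall x, ~ K x -> f x = 0].

Definition weak_pd {R : realType} (Om : set 'rV[R]_3) (k : 'I_3)
    (f g : 'rV[R]_3 -> R) : Prop :=
  forall zeta, test_fun Om zeta ->
    intO Om (fun x => f x * pd k zeta x) = - intO Om (fun x => g x * zeta x).

Definition H1 {R : realType} (Om : set 'rV[R]_3) (f : 'rV[R]_3 -> R) : Prop :=
  L2 Om f /\ forall k, exists2 g, L2 Om g & weak_pd Om k f g.

(* The closure of the test functions in H^1. *)
Definition H10 {R : realType} (Om : set 'rV[R]_3) (f : 'rV[R]_3 -> R) : Prop :=
  L2 Om f /\
  exists g : 'I_3 -> 'rV[R]_3 -> R,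
    (forall k, L2 Om (g k) /\ weak_pd Om k f (g k)) /\
    exists zeta : nat -> 'rV[R]_3 -> R,
      [/\ forall m, test_fun Om (zeta m),
          (fun m => intO Om (fun x => (zeta m x - f x) ^+ 2)) @ \oo --> (0 : R) &
          forall k, (fun m => intO Om (fun x => (pd k (zeta m) x - g k x) ^+ 2))
                      @ \oo --> (0 : R)].

(** * The domain *)

(* Boundary of an open set. *)
Definition bdry {R : realType} (Om : set 'rV[R]_3) : set 'rV[R]_3 :=
  closure Om `\` Om.

(* Near each boundary point, Om is one side of the graph of a C^2 function of
   two of the three coordinates; [col' k y] drops the k-th coordinate of y. *)
Definition C2_boundary {R : realType} (Om : set 'rV[R]_3) : Prop :=
  forall x, bdry Om x ->
    exists (k : 'I_3) (b : bool) (g : 'rV[R]_2 -> R), C2 g /\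
      \forall y \near x, Om y <-> 0 < (-1) ^+ b * (y 0 k - g (col' k y)).

Definition C2_domain {R : realType} (Om : set 'rV[R]_3) : Prop :=
  [/\ Om !=set0, open Om, connected Om, bounded_set Om & C2_boundary Om].

(** * Triangulations

   A domain with C^2 boundary is not a union of straight tetrahedra, so
   simplices touching the boundary have to be allowed to be curved. A simplex
   is the image of the straight tetrahedron with vertices [vtx] under a C^1
   diffeomorphism [chart] of R^3, which has to be the identity on every face
   having at most one vertex on the boundary of the domain; a simplex with at
   most one vertex on the boundary is thus straight. *)

Record simplex (R : realType) := Simplex {
  vtx : 'I_4 -> 'rV[R]_3;
  chart : 'rV[R]_3 -> 'rV[R]_3;
  chartV : 'rV[R]_3 -> 'rV[R]_3
}.

Definition flat_face {R : realType} (K : simplex R) (I : pred 'I_4) :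
    set 'rV[R]_3 :=
  [set x | exists t : 'I_4 -> R,
     [/\ forall i, 0 <= t i, forall i, ~~ I i -> t i = 0,
         \sum_(i < 4) t i = 1 & x = \sum_(i < 4) t i *: vtx K i]].

Definition face {R : realType} (K : simplex R) (I : pred 'I_4) :
    set 'rV[R]_3 :=
  chart K @` flat_face K I.

Definition elem {R : realType} (K : simplex R) : set 'rV[R]_3 :=
  face K xpredT.

Definition is_simplex {R : realType} (Om : set 'rV[R]_3) (K : simplex R) :
    Prop :=
  [/\ \matrix_(i < 3) (vtx K (lift ord0 i) - vtx K ord0) \in unitmx,
      cancel (chart K) (chartV K) /\ cancel (chartV K) (chart K),
      C1 (chart K) /\ C1 (chartV K) &
      forall I : pred 'I_4,
        (forall i j, I i -> I j -> bdry Om (vtx K i) -> bdry Om (vtx K j) ->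
           i = j) ->
        forall x, flat_face K I x -> chart K x = x].

(* The intersection of two distinct simplices is a common proper face, which
   is empty when I and J are. *)
Definition conforming {R : realType} (m : nat) (Th : 'I_m -> simplex R) : Prop :=
  forall a b, a != b ->
    exists I J : pred 'I_4,
      [/\ ~ (forall i, I i), ~ (forall j, J j),
          elem (Th a) `&` elem (Th b) = face (Th a) I,
          face (Th a) I = face (Th b) J &
          vtx (Th a) @` [set i | I i] = vtx (Th b) @` [set j | J j]].

Definition enorm {R : realType} (x : 'rV[R]_3) : R := Num.sqrt (dot x x).

Definition diam {R : realType} (A : set 'rV[R]_3) : R :=
  sup [set d | exists x y, [/\ A x, A y & d = enorm (x - y)]].

Definition mesh_size {R : realType} (m : nat) (Th : 'I_m -> simplex R) : R :=
  \big[Num.max/0]_(a < m) diam (elem (Th a)).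

(* Every element contains a ball of radius h / sigma. *)
Definition quasi_uniform {R : realType} (sigma : R) (m : nat)
    (Th : 'I_m -> simplex R) : Prop :=
  forall a, exists c, forall x,
    enorm (x - c) <= mesh_size Th / sigma -> elem (Th a) x.

Definition triangulation {R : realType} (Om : set 'rV[R]_3) (sigma : R)
    (m : nat) (Th : 'I_m -> simplex R) : Prop :=
  [/\ forall a, is_simplex Om (Th a),
      \bigcup_a elem (Th a) = closure Om,
      conforming Th & quasi_uniform sigma Th].

(** * Finite element spaces

   Discrete functions are functions on R^3 of which only the values on the
   closure of Om matter. *)

Definition is_poly {R : realType} (l : nat) (K : set 'rV[R]_3)
    (f : 'rV[R]_3 -> R) : Prop :=
  exists c : 'I_l.+1 -> 'I_l.+1 -> 'I_l.+1 -> R, forall x, K x ->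
    f x = \sum_(i < l.+1) \sum_(j < l.+1) \sum_(k < l.+1 | (i + j + k <= l)%N)
            c i j k * x 0 0 ^+ i * x 0 1 ^+ j * x 0 2 ^+ k.

Definition FE {R : realType} (l : nat) (Om : set 'rV[R]_3) (m : nat)
    (Th : 'I_m -> simplex R) (f : 'rV[R]_3 -> R) : Prop :=
  {within closure Om, continuous f} /\ forall a, is_poly l (elem (Th a)) f.

Definition Sh {R : realType} (Om : set 'rV[R]_3) (m : nat)
    (Th : 'I_m -> simplex R) (s : 'rV[R]_3 -> R) : Prop := FE 1 Om Th s.

Definition Rh {R : realType} (Om : set 'rV[R]_3) (m : nat)
    (Th : 'I_m -> simplex R) (q : 'rV[R]_3 -> R) : Prop :=
  Sh Om Th q /\ intO Om q = 0.

Definition Vh {R : realType} (Om : set 'rV[R]_3) (m : nat)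
    (Th : 'I_m -> simplex R) (v : 'rV[R]_3 -> 'rV[R]_3) : Prop :=
  forall i, FE 2 Om Th (fun x => v x 0 i) /\ H10 Om (fun x => v x 0 i).

Definition Xh {R : realType} (Om : set 'rV[R]_3) (m : nat)
    (Th : 'I_m -> simplex R) (A : 'rV[R]_3 -> 'M[R]_3) : Prop :=
  forall i j, FE 1 Om Th (fun x => A x i j).

(* kappa is a lower bound for the inf-sup constant of the pair (Vh, Rh). *)
Definition LBB {R : realType} (Om : set 'rV[R]_3) (kappa : R) (m : nat)
    (Th : 'I_m -> simplex R) : Prop :=
  forall q, Rh Om Th q ->
    let nrm v := Num.sqrt (intO Om (fun x => dot (v x) (v x))
                  + intO Om (fun x => frob (vgrad v x) (vgrad v x))) in
    kappa * Num.sqrt (intO Om (fun x => q x ^+ 2)) <=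
    sup [set r | exists v, [/\ Vh Om Th v, nrm v != 0 &
                   r = intO Om (fun x => q x * div v x) / nrm v]].

Definition is_PS {R : realType} (Om : set 'rV[R]_3) (m : nat)
    (Th : 'I_m -> simplex R) (f s : 'rV[R]_3 -> R) : Prop :=
  Sh Om Th s /\
  forall xi, Sh Om Th xi -> intO Om (fun x => (s x - f x) * xi x) = 0.

Definition is_PX {R : realType} (Om : set 'rV[R]_3) (m : nat)
    (Th : 'I_m -> simplex R) (G A : 'rV[R]_3 -> 'M[R]_3) : Prop :=
  Xh Om Th A /\
  forall Pi, Xh Om Th Pi -> intO Om (fun x => frob (A x - G x) (Pi x)) = 0.

(** * Constitutive functions *)

Definition b_ok {R : realType} (b0 b1 : R) (b : R -> R) : Prop :=
  [/\ 0 < b0, 0 < b1, continuous b & forall r, b0 <= b r <= b1].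

(* Partial derivatives of w(r, T) and j(r, T) in the two arguments. *)
Definition d_r {R : realType} (w : R -> 'M[R]_3 -> R) (r : R) (T : 'M[R]_3) : R :=
  derive1 (fun s => w s T) r.

Definition d_T {R : realType} (w : R -> 'M[R]_3 -> R) (r : R) (T : 'M[R]_3) :
    'M[R]_3 :=
  \matrix_(i < 3, j < 3) 'D_(delta_mx i j) (w r) T.

(* For p < 1 the bound on the T-derivative is void at T = 0, where
   |T|^(p-1) is infinite while the library sets 0 `^ (p - 1) = 0. *)
Definition w_ok {R : realType} (p d1 d2 d3 d4 : R) (w : R -> 'M[R]_3 -> R) :
    Prop :=
  [/\ [/\ 0 <= p < 6, 0 <= d1, 0 < d2, 0 < d3 & 0 < d4],
      C1 (fun z : R * 'M[R]_3 => w z.1 z.2),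
      forall r T, - d1 <= w r T <= d2 * (1 + fnorm T `^ p),
      forall r T, T != 0 \/ 1 <= p ->
        fnorm (d_T w r T) <= d3 * (1 + fnorm T `^ (p - 1)) &
      forall r T, `|d_r w r T| <= d4 * (1 + fnorm T `^ p)].

Definition psi_ok {R : realType} (p c1 c2 l q : R) (psi : R -> R) : Prop :=
  [/\ [/\ 0 < c1, 0 <= c2, 0 <= l < 6 + 8 / Num.max 2 (2 * p - 6) &
          0 <= q < 4],
      (forall r, derivable psi r 1) /\ continuous (derive1 psi),
      forall r, `|derive1 psi r| <= c1 * (`|r| `^ l + 1),
      forall r, - c2 <= psi r &
      exists psip psim : R -> R,
        [/\ forall r, psi r = psip r + psim r,
            convex_function [set: R^o] psip,
            convex_function [set: R^o] (fun r => - psim r),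
            (forall r, derivable psim r 1) /\ (forall r, derivable (derive1 psim) r 1) &
            forall r, `|derive1 (derive1 psim) r| <= c1 * (`|r| `^ q + 1)]].

Definition jfun {R : realType} (psi : R -> R) (w : R -> 'M[R]_3 -> R)
    (r : R) (T : 'M[R]_3) : R := psi r + w r T.

(* The radicand of the scalar auxiliary variable; k is outside the integral. *)
Definition radicand {R : realType} (Om : set 'rV[R]_3) (k : R)
    (j : R -> 'M[R]_3 -> R) (phi : 'rV[R]_3 -> R) (F : 'rV[R]_3 -> 'M[R]_3) : R :=
  intO Om (fun x => j (phi x) (F x)) + k.

(* k is large enough for the auxiliary variable to be positive. *)
Definition k_ok {R : realType} (Om : set 'rV[R]_3) (c2 d1 k : R)
    (j : R -> 'M[R]_3 -> R) : Prop :=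
  c2 + d1 < k /\
  forall phi F, {within closure Om, continuous phi} ->
    {within closure Om, continuous F} -> 0 < radicand Om k j phi F.

(** * The scheme *)

Record state (R : realType) := State {
  vel : 'rV[R]_3 -> 'rV[R]_3;
  prs : 'rV[R]_3 -> R;
  dfm : 'rV[R]_3 -> 'M[R]_3;
  str : 'rV[R]_3 -> 'M[R]_3;
  phs : 'rV[R]_3 -> R;
  chp : 'rV[R]_3 -> R;
  aux : R
}.

Definition in_spaces {R : realType} (Om : set 'rV[R]_3) (m : nat)
    (Th : 'I_m -> simplex R) (u : state R) : Prop :=
  [/\ Vh Om Th (vel u), Rh Om Th (prs u), Xh Om Th (dfm u) /\ Xh Om Th (str u) &
      Sh Om Th (phs u) /\ Sh Om Th (chp u)].

Definition state_eq {R : realType} (Om : set 'rV[R]_3) (u u' : state R) : Prop :=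
  (forall x, closure Om x ->
    [/\ vel u x = vel u' x, prs u x = prs u' x,
        dfm u x = dfm u' x /\ str u x = str u' x &
        phs u x = phs u' x /\ chp u x = chp u' x]) /\
  aux u = aux u'.

(* [o] is the given state at level n, of which [prs o] is not used, and [u]
   the unknown state at level n + 1. *)
Definition scheme {R : realType} (Om : set 'rV[R]_3) (m : nat)
    (Th : 'I_m -> simplex R) (nu gam lam k dt : R) (b psi : R -> R)
    (w : R -> 'M[R]_3 -> R) (o u : state R) : Prop :=
  let j := jfun psi w in
  let J := Num.sqrt (radicand Om k j (phs o) (dfm o)) in
  let r := aux u / J in
  [/\ forall U, Vh Om Th U ->
        nu * intO Om (fun x => frob (vgrad (vel u) x) (vgrad U x))
        - intO Om (fun x => prs u x * div U x)
        = r * (intO Om (fun x => chp o x * dot (grad (phs o) x) (U x))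
               - intO Om (fun x => frob (str o x *m (dfm o x)^T) (vgrad U x))
               + intO Om (fun x => dot (odot (dfm o) (str o) x) (U x))),
      forall P, Rh Om Th P -> intO Om (fun x => P x * div (vel u) x) = 0,
      (forall Theta, Xh Om Th Theta ->
        intO Om (fun x => frob (dfm u x - dfm o x) (Theta x))
        + dt * r *
          (intO Om (fun x => frob (convect (vel o) (dfm o) x) (Theta x))
           - intO Om (fun x => frob (vgrad (vel o) x *m dfm o x) (Theta x)))
        + dt * gam * intO Om (fun x => frob (str u x) (Theta x)) = 0) /\
      (forall Pi, Xh Om Th Pi ->
        intO Om (fun x => frob (str u x) (Pi x))
        = r * intO Om (fun x => frob (d_T w (phs o x) (dfm o x)) (Pi x))
          + lam * intO Om (mgrad_dot (dfm u) Pi)),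
      (forall xi, Sh Om Th xi ->
        intO Om (fun x => (phs u x - phs o x) * xi x)
        + dt * r * intO Om (fun x => dot (vel o x) (grad (phs o) x) * xi x)
        + dt * intO Om (fun x => b (phs o x) * dot (grad (chp u) x) (grad xi x))
        = 0) /\
      (forall chi, Sh Om Th chi ->
        intO Om (fun x => chp u x * chi x)
        = intO Om (fun x => dot (grad (phs u) x) (grad chi x))
          + r * intO Om (fun x => d_r j (phs o x) (dfm o x) * chi x)) &
      aux u - aux o =
        (2 * J)^-1 *
        (intO Om (fun x => d_r j (phs o x) (dfm o x) * (phs u x - phs o x))
         + intO Om (fun x => frob (d_T w (phs o x) (dfm o x)) (dfm u x - dfm o x))
         + dt * intO Om (fun x => frob (convect (vel o) (dfm o) x) (str u x))
         - dt * intO Om (fun x => dot (odot (dfm o) (str o) x) (vel u x))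
         - dt * intO Om (fun x => frob (vgrad (vel o) x *m dfm o x) (str u x))
         + dt * intO Om (fun x => frob (str o x *m (dfm o x)^T) (vgrad (vel u) x))
         + dt * intO Om (fun x => dot (vel o x) (grad (phs o) x) * chp u x)
         - dt * intO Om (fun x => chp o x * dot (grad (phs o) x) (vel u x)))].

Definition solves_step {R : realType} (Om : set 'rV[R]_3) (m : nat)
    (Th : 'I_m -> simplex R) (nu gam lam k dt : R) (b psi : R -> R)
    (w : R -> 'M[R]_3 -> R) (o u : state R) : Prop :=
  in_spaces Om Th u /\ scheme Om Th nu gam lam k dt b psi w o u.

(* The initial pressure is not part of the data. *)
Definition initial {R : realType} (Om : set 'rV[R]_3) (m : nat)
    (Th : 'I_m -> simplex R) (k : R) (psi : R -> R) (w : R -> 'M[R]_3 -> R)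
    (phi0 : 'rV[R]_3 -> R) (F0 : 'rV[R]_3 -> 'M[R]_3) (u : state R) : Prop :=
  [/\ is_PS Om Th phi0 (phs u), is_PX Om Th F0 (dfm u),
      aux u = Num.sqrt (radicand Om k (jfun psi w) (phs u) (dfm u)) &
      forall x, closure Om x -> [/\ vel u x = 0, chp u x = 0 & str u x = 0]].

Definition discrete_solution {R : realType} (Om : set 'rV[R]_3) (m : nat)
    (Th : 'I_m -> simplex R) (nu gam lam k dt : R) (b psi : R -> R)
    (w : R -> 'M[R]_3 -> R) (phi0 : 'rV[R]_3 -> R) (F0 : 'rV[R]_3 -> 'M[R]_3)
    (N : nat) (u : nat -> state R) : Prop :=
  initial Om Th k psi w phi0 F0 (u 0) /\
  forall n, (n < N)%N -> solves_step Om Th nu gam lam k dt b psi w (u n) (u n.+1).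

Definition grad_sq {R : realType} (Om : set 'rV[R]_3) (f : 'rV[R]_3 -> R) : R :=
  intO Om (fun x => dot (grad f x) (grad f x)).

Definition mgrad_sq {R : realType} (Om : set 'rV[R]_3)
    (F : 'rV[R]_3 -> 'M[R]_3) : R :=
  intO Om (mgrad_dot F F).

Definition energy {R : realType} (Om : set 'rV[R]_3) (lam : R) (u : state R) : R :=
  aux u ^+ 2 + 2^-1 * grad_sq Om (phs u) + lam / 2 * mgrad_sq Om (dfm u).

(* The increments between consecutive time levels are divided by [tau]. The
   energy balance controls the terms with tau = dt; with tau = dt ^+ 2 the sums
   are larger by dt ^- 2 and grow without bound as dt tends to 0 on a fixed
   mesh, unless the solution is stationary. *)
Definition stability_lhs {R : realType} (Om : set 'rV[R]_3)
    (nu gam lam dt tau : R) (b : R -> R) (N : nat) (u : nat -> state R) : R :=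
  \big[Num.max/0]_(n < N) energy Om lam (u n.+1)
  + dt ^+ 2 / 2 * (\sum_(n < N)
      grad_sq Om (fun x => (phs (u n.+1) x - phs (u n) x) / tau))
  + lam * dt ^+ 2 / 2 * (\sum_(n < N)
      mgrad_sq Om (fun x => tau^-1 *: (dfm (u n.+1) x - dfm (u n) x)))
  + dt ^+ 2 * (\sum_(n < N)
      intO Om (fun=> ((aux (u n.+1) - aux (u n)) / tau) ^+ 2))
  + dt * nu * (\sum_(n < N)
      intO Om (fun x => frob (vgrad (vel (u n.+1)) x) (vgrad (vel (u n.+1)) x)))
  + dt * gam * (\sum_(n < N)
      intO Om (fun x => frob (str (u n.+1) x) (str (u n.+1) x)))
  + dt * (\sum_(n < N)
      intO Om (fun x => b (phs (u n) x) *
        dot (grad (chp (u n.+1)) x) (grad (chp (u n.+1)) x))).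

(* Main.v *)
Require Import Defs.
From HB Require Import structures.
From mathcomp Require Import all_boot all_order all_algebra.
From mathcomp Require Import all_classical all_reals all_analysis.
From mathcomp Require Import measurable_realfun.
From mathcomp Require Import ring lra.
Import Order.TTheory GRing.Theory Num.Theory.
Import numFieldNormedType.Exports HBNNSimple.
Set Implicit Arguments.
Unset Strict Implicit.
Unset Printing Implicit Defensive.
Local Open Scope classical_set_scope.
Local Open Scope ring_scope.

(* In the step from level n to n+1 the unknowns enter linearly: all nonlinear
   terms are frozen at level n and multiplied by beta^{n+1}/J^n. Testing the
   equations with v^{n+1}, s^{n+1}, M^{n+1}, F^{n+1} - F^n, mu^{n+1},
   phi^{n+1} - phi^n and multiplying the last one by 2 beta^{n+1}, all coupling
   terms cancel, and a (a - b) = (a^2 - b^2 + (a - b)^2) / 2 gives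
   E^{n+1} + D^n = E^n, where E is the Lyapunov function and D^n >= 0 is the
   dissipation together with the squared increments. Summation over n gives the
   stability bound. For zero data the same identity makes the linear system
   injective, by the definiteness of the velocity form on H^1_0 and the inf-sup
   condition for the pressure, hence uniquely solvable in finite dimension.

   The elements may be curved, and nothing about their geometry is used except
   that they cover the closure of Om: a discrete function is continuous there and
   at each point equal to one of finitely many polynomials. Off the zero set of a
   nonzero polynomial, which is a closed null set, such a function is locally
   equal to one of them. *)

(** * Integration over an open subset of R^3 *)

(** Two totality conventions shape the proof. A partial derivative has a value at every point,
    arbitrary where the function is not differentiable, and need not be measurable there. Integrands
    are therefore handled through representatives: [BM] asks for a bounded measurable function
    agreeing with the given one almost everywhere on [Om], a property stable under sums and
    products. A discrete function is defined on all of R^3 but controlled only on the closure of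
    [Om], so the discrete spaces are infinite-dimensional as sets of functions; existence and
    uniqueness are proved modulo functions vanishing on the closure.

    Definiteness of the velocity form splits into rigidity and exclusion of constants: a discrete
    function with zero gradient takes finitely many values, hence one value on the connected [Om],
    and a constant in H^1_0 vanishes by testing against a coordinate times the approximating test
    functions.

    The final bound is the initial energy times a factor depending only on the volume of [Om] and on
    [dt / tau]. It is uniform in mesh and time step for [tau = dt], and of order [dt ^- 2] for
    [tau = dt ^+ 2]. *)

Definition R3 (R : realType) : measurableType _ :=
  (measurableTypeR R * measurableTypeR R * measurableTypeR R)%type.
Definition pre (R : realType) (A : set 'rV[R]_3) : set (R3 R) := pt @^-1` A.

(** * Integrals of arbitrary functions and null sets *)

Section null_sets.
Context d (T : measurableType d) (R : realType) (mu : {measure set T -> \bar R}).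

Let nnint (f : T -> \bar R) := ereal_sup [set sintegral mu h |
  h in [set h : {nnsfun T >-> R} | forall x, ((h x)%:E <= f x)%E]].

(** A simple function below [f] is set to zero on [N]: its integral does not change, and it is then
    below [g] everywhere. *)
Let nnint_le_ae (N : set T) (f g : T -> \bar R) :
  measurable N -> mu N = 0%E -> (forall x, 0 <= g x)%E ->
  (forall x, ~ N x -> f x <= g x)%E -> (nnint f <= nnint g)%E.
Proof.
move=> mN N0 g0 fg; apply: ge_ereal_sup => _ [h hf <-].
pose h' := proj_nnsfun h (measurableC mN).
have -> : sintegral mu h = sintegral mu h'.
  rewrite -!integralT_nnsfun; apply: ge0_ae_eq_integral => //.
  - by apply/measurable_EFinP.
  - by apply/measurable_EFinP.
  - by move=> x _; rewrite lee_fin.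
  - by move=> x _; rewrite lee_fin.
  - exists N; split=> // x /= hx; apply: contrapT => Nx; apply: hx => _.
    by rewrite /= mindicE mem_set // mulr1.
apply: ereal_sup_ubound; exists h' => //= x.
have [Nx|Nx] := pselect (N x); first by rewrite mindicE memNset ?mulr0 // => /(_ Nx).
by rewrite mindicE mem_set // mulr1; apply: le_trans (fg _ Nx).
Qed.

(* No measurability is required of [f] and [g]: derivatives of finite element
   functions have junk values on the faces of the elements. *)
Lemma integral_ae (D : set T) (f g : T -> \bar R) :
  {ae mu, forall x, D x -> f x = g x} ->
  (\int[mu]_(x in D) f x = \int[mu]_(x in D) g x)%E.
Proof.
move=> [N [mN N0 NS]].
have fgN x : ~ N x -> (f \_ D) x = (g \_ D) x.
  move=> Nx; rewrite !patchE; case: ifPn => // /set_mem Dx.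
  by apply: contrapT => fg; apply/Nx/NS => /(_ Dx).
have E (u v : T -> \bar R) : (forall x, 0 <= u x)%E -> (forall x, 0 <= v x)%E ->
    (forall x, ~ N x -> u x = v x) -> nnint u = nnint v.
  move=> u0 v0 uv; apply/eqP; rewrite eq_le.
  by apply/andP; split; apply: (nnint_le_ae mN N0) => // x /uv ->.
rewrite /integral; congr (_ - _)%E; apply: E => // x Nx.
  by rewrite !funeposE fgN.
by rewrite !funenegE fgN.
Qed.

End null_sets.

(** * Measure of open subsets of R^3 *)

Section volume.
Variable R : realType.
Implicit Types A : set 'rV[R]_3.

Definition box (c : R * R * R) (e : R) : set (R3 R) :=
  (ball c.1.1 e `*` ball c.1.2 e) `*` ball c.2 e.

Lemma measurable_box c e : measurable (box c e).
Proof. by apply: measurableX; [apply: measurableX|]; apply: measurable_ball. Qed.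

(** Balls of row vectors are defined entrywise, so a ball is a box. *)
Lemma open_box A p : open A -> pre A p -> exists2 e, 0 < e & box p e `<=` pre A.
Proof.
move=> oA Ap; have /nbhs_ballP[e e0 eA] := open_nbhs_nbhs (conj oA Ap).
exists e => // -[[x y] z] [[/= bx by_] bz]; apply: eA; split => // i j.
by rewrite !mxE; case: j => -[|[|[|]]].
Qed.

(** The measure lives on a product sigma-algebra, so openness is converted into measurability by
    writing [pre A] as the countable union of the boxes inside it with rational centre and radius
    [n.+1%:R^-1]. *)
Lemma measurable_open A : open A -> measurable (pre A).
Proof.
move=> oA.
pose B (q : rat * rat * rat * nat) : set (R3 R) :=
  box (ratr q.1.1.1, ratr q.1.1.2, ratr q.1.2) q.2.+1%:R^-1.
have -> : pre A = \bigcup_q (if `[< B q `<=` pre A >] then B q else set0).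
  apply/seteqP; split=> [p Ap|p [q _]]; last by case: asboolP => // qA /qA.
  have [e e0 eA] := open_box oA Ap.
  (* The centre is moved to a rational point at distance below [n.+1%:R^-1], and the box has this
     radius; both displacements together must stay below [e]. *)
  have [n ne] : exists n, n.+1%:R^-1 + n.+1%:R^-1 < e.
    have [n _ /(_ _ (leqnn n))] := near_infty_natSinv_lt (PosNum (divr_gt0 e0 (ltr0n R 2))).
    by move=> /= ne; exists n; rewrite [e]splitr ltrD.
  have rat_near (x : R) : exists q : rat, `|x - ratr q| < n.+1%:R^-1.
    have /(_ (ball x n.+1%:R^-1))[] := @dense_rat R.
    - by exists x; apply: ballxx; rewrite invr_gt0.
    - exact: ball_open.
    by move=> y [bx [q _ qy]]; exists q; rewrite qy.
  have [q1 h1] := rat_near p.1.1; have [q2 h2] := rat_near p.1.2.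
  have [q3 h3] := rat_near p.2.
  exists (q1, q2, q3, n) => //; case: asboolP => [_|[]].
    by split=> /=; [split|]; rewrite /ball /= distrC.
  move=> u [[/= u1 u2] u3]; apply: eA; split; [split|] => /=;
    by apply: le_lt_trans ne; apply/ltW; apply: le_lt_trans (ler_distD _ _ _) (ltrD _ _); eassumption.
apply: countable_bigcupT_measurable => // q; case: ifP => // _.
exact: measurable_box.
Qed.

Lemma leb3_box c e : 0 <= e -> leb3 R (box c e) = (e *+ 2 * (e *+ 2) * (e *+ 2))%:E.
Proof.
move=> e0; rewrite /leb3 /= product_measure1E; last 2 first.
- by apply: measurableX; apply: measurable_ball.
- exact: measurable_ball.
have := @product_measure1E _ _ (measurableTypeR R) (measurableTypeR R) R
  lebesgue_measure lebesgue_measure (ball c.1.1 e) (ball c.1.2 e)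
  (measurable_ball _ _) (measurable_ball _ _).
rewrite /= => ->.
by rewrite /= !lebesgue_measure_ball.
Qed.

Lemma leb3_open_gt0 A : open A -> A !=set0 -> (0 < leb3 R (pre A))%E.
Proof.
move=> oA [x Ax].
pose p : R * R * R := (x 0 0, x 0 1, x 0 2%:R).
have ptp : pt p = x.
  by apply/rowP => i; rewrite mxE; case: i => -[|[|[|]]] // ?; congr (x _ _); apply/val_inj.
have [e e0 eA] := @open_box A p oA (eq_ind_r A Ax ptp).
apply: (@lt_le_trans _ _ (leb3 R (box p e))).
  by rewrite leb3_box ?ltW // lte_fin !mulr_gt0 ?mulrn_wgt0 // pmulrn_lgt0.
by apply: le_measure => //; rewrite inE; [exact: measurable_box|exact: measurable_open].
Qed.

Lemma leb3_bounded_lty A : open A -> bounded_set A -> (leb3 R (pre A) < +oo)%E.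
Proof.
move=> oA [M [_ bM]].
have /bM bA : M < `|M| + 1 by rewrite (le_lt_trans (ler_norm M)) ?ltrDl.
apply: (@le_lt_trans _ _ (leb3 R (box (0, 0, 0) (`|M| + 2)))); last first.
  by rewrite leb3_box ?ltry ?addr_ge0.
apply: le_measure => //; rewrite ?inE; [exact: measurable_open|exact: measurable_box|].
have aux (x : 'rV[R]_3) i : A x -> `|x 0 i| < `|M| + 2.
  move=> /bA h; apply: (@le_lt_trans _ _ (`|M| + 1)); last by rewrite ltrD2l ltr1n.
  apply: le_trans h; rewrite [leRHS]mx_normrE.
  by apply: (le_bigmax _ (fun ij : 'I_1 * 'I_3 => `|x ij.1 ij.2|) (0, i)).
move=> [[x y] z] Ap; split; [split|] => /=; rewrite /ball /= sub0r normrN.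
- by have := aux _ 0 Ap; rewrite mxE.
- by have := aux _ 1 Ap; rewrite mxE.
- by have := aux _ (2%:R) Ap; rewrite mxE.
Qed.

End volume.

(** * Integrals over the domain through almost everywhere equal representatives *)

Section integral.
Variables (R : realType) (Om : set 'rV[R]_3).
Hypotheses (oOm : open Om) (bOm : bounded_set Om).
Implicit Types (f g : 'rV[R]_3 -> R) (P Q : 'rV[R]_3 -> Prop).

Definition aeO P := {ae leb3 R, forall p, pre Om p -> P (pt p)}.

Lemma aeO_all P : (forall x, Om x -> P x) -> aeO P.
Proof. by move=> h; apply: aeW => p /h. Qed.

Lemma aeO_mp P Q : aeO P -> aeO (fun x => P x -> Q x) -> aeO Q.
Proof. by rewrite /aeO; apply: filterS2 => p hP hQ Op; exact: hQ Op (hP Op). Qed.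

Lemma aeOS P Q : (forall x, Om x -> P x -> Q x) -> aeO P -> aeO Q.
Proof. by rewrite /aeO => h; apply: filterS => p hP /[dup] + /hP; apply: h. Qed.

Lemma aeOS2 P1 P2 Q : (forall x, Om x -> P1 x -> P2 x -> Q x) ->
  aeO P1 -> aeO P2 -> aeO Q.
Proof.
by rewrite /aeO => h; apply: filterS2 => p h1 h2 Op; apply: h => //; [apply: h1|apply: h2].
Qed.

Lemma aeO_fin (I : finType) (P : I -> 'rV[R]_3 -> Prop) :
  (forall i, aeO (P i)) -> aeO (fun x => forall i, P i x).
Proof.
move=> h; suff: aeO (fun x => forall i, i \in enum I -> P i x).
  by apply: aeOS => x _ hx i; apply: hx; rewrite mem_enum.
elim: (enum I) => [|i s IH]; first by apply: aeO_all => x _ i.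
apply: aeOS2 (h i) IH => x _ hi IH j; rewrite inE => /predU1P[->//|]; exact: IH.
Qed.

Lemma aeO_nullC (Z : set 'rV[R]_3) : closed Z -> leb3 R (pre Z) = 0%E ->
  aeO (fun x => ~ Z x).
Proof.
move=> cZ Z0; exists (pre Z); split=> //.
  have -> : pre Z = ~` pre (~` Z) by rewrite -[pre (~` Z)]/(~` pre Z) setCK.
  by apply: measurableC; apply: measurable_open; apply: closed_openC.
by move=> p /= hp; apply: contrapT => h; apply: hp.
Qed.

(** A nonempty open part of [Om] has positive measure and cannot lie inside the exceptional null
    set. *)
Lemma aeO_dense P x (U : set 'rV[R]_3) : aeO P -> Om x -> open U -> U x ->
  exists y, [/\ Om y, U y & P y].
Proof.
move=> [N [mN N0 NP]] Ox oU Ux; apply: contrapT => h.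
have : (0 < leb3 R (pre (Om `&` U)))%E.
  by apply: leb3_open_gt0; [exact: openI|exists x].
rewrite ltNge => /negP; apply; rewrite -N0; apply: le_measure.
- by rewrite inE; apply: measurable_open; apply: openI.
- by rewrite inE.
move=> p [Op Up]; apply: NP => /= hp; apply: h; exists (pt p); split=> //.
exact: hp.
Qed.

(** Integrability up to a null set: [f] itself may fail to be measurable, but [intO] is still linear
    on such functions, as it can be computed on [g]. *)
Definition Ig f := exists2 g : R3 R -> R,
  (leb3 R).-integrable (pre Om) (EFin \o g) &
  {ae leb3 R, forall p, pre Om p -> f (pt p) = g p}.

Lemma mOm : measurable (pre Om). Proof. exact: measurable_open. Qed.

Lemma intO_rep f (g : R3 R -> R) :
  {ae leb3 R, forall p, pre Om p -> f (pt p) = g p} ->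
  intO Om f = \int[leb3 R]_(p in pre Om) g p.
Proof.
move=> h; rewrite /intO /Rintegral; congr fine; apply: integral_ae.
by apply: filterS h => p h /h ->.
Qed.

Lemma intO_ext f g : aeO (fun x => f x = g x) -> intO Om f = intO Om g.
Proof. exact: intO_rep. Qed.

Lemma eq_intO f g : (forall x, Om x -> f x = g x) -> intO Om f = intO Om g.
Proof. by move=> h; apply/intO_ext/aeO_all. Qed.

Lemma Ig_ext f g : aeO (fun x => f x = g x) -> Ig f -> Ig g.
Proof.
rewrite /aeO => h [u iu fu]; exists u => //.
by apply: filterS2 h fu => p h1 h2 Op; rewrite -h1 // h2.
Qed.

Lemma Ig_lin a f g : Ig f -> Ig g -> Ig (fun x => a * f x + g x).
Proof.
move=> [u iu fu] [v iv gv]; exists (fun p => a * u p + v p).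
  apply: (eq_integrable mOm (fun p => (a%:E * (u p)%:E + (v p)%:E)%E)) => //.
  apply: integrableD => //; first exact: mOm.
  by apply: integrableZl => //; exact: mOm.
by apply: filterS2 fu gv => p h1 h2 Op; rewrite h1 // h2.
Qed.

Lemma intO_lin a f g : Ig f -> Ig g ->
  intO Om (fun x => a * f x + g x) = a * intO Om f + intO Om g.
Proof.
move=> [u iu fu] [v iv gv]; rewrite (intO_rep fu) (intO_rep gv).
rewrite (@intO_rep _ (fun p => a * u p + v p)); last first.
  by apply: filterS2 fu gv => p h1 h2 Op; rewrite h1 // h2.
rewrite RintegralD ?RintegralZl //; [exact: mOm..|].
exact: (integrableZl mOm a iu).
Qed.

Lemma Ig0 : Ig (fun=> 0).
Proof.
by exists (fun=> 0); [exact: integrable0|exact: aeW].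
Qed.

Lemma intO0 : intO Om (fun=> 0) = 0.
Proof. by rewrite /intO /Rintegral integral0. Qed.

Lemma IgZ a f : Ig f -> Ig (fun x => a * f x).
Proof.
move=> /(Ig_lin a)/(_ Ig0); apply: Ig_ext; apply: aeO_all => x _ /=.
by rewrite addr0.
Qed.

Lemma intOZ a f : Ig f -> intO Om (fun x => a * f x) = a * intO Om f.
Proof.
move=> h; have := intO_lin a h Ig0; rewrite intO0 addr0 => <-.
by apply: eq_intO => x _; rewrite addr0.
Qed.

Lemma intOD f g : Ig f -> Ig g ->
  intO Om (fun x => f x + g x) = intO Om f + intO Om g.
Proof.
move=> h h'; have := intO_lin 1 h h'; rewrite mul1r => <-.
by apply: eq_intO => x _; rewrite mul1r.
Qed.

Lemma intO_ge0 f : aeO (fun x => 0 <= f x) -> 0 <= intO Om f.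
Proof.
move=> h; rewrite (@intO_ext f (fun x => Num.max 0 (f x))).
  by apply: Rintegral_ge0 => p _; rewrite le_max lexx.
by apply: aeOS h => x _ h; rewrite max_r.
Qed.

Lemma intO_eq0 f : Ig f -> aeO (fun x => 0 <= f x) -> intO Om f = 0 ->
  aeO (fun x => f x = 0).
Proof.
move=> [g ig fg] f0; rewrite (intO_rep fg) /Rintegral => int0.
have : (\int[leb3 R]_(p in pre Om) `|(g p)%:E| = 0)%E.
  rewrite -(@integral_ae _ _ _ _ _ (EFin \o g)).
    by rewrite -[LHS]fineK ?integrable_fin_num //; [rewrite int0|exact: mOm].
  by apply: filterS2 fg f0 => p h1 h2 Op; rewrite /= ger0_norm // -h1 // h2.
move/(ae_eq_integral_abs (leb3 R) mOm) => /(_ (measurable_int _ ig)).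
by apply: filterS2 fg => p h1 h2 Op; rewrite h1 //; have := h2 Op => /= -[].
Qed.

Lemma le_intO f g : Ig f -> Ig g -> aeO (fun x => f x <= g x) ->
  intO Om f <= intO Om g.
Proof.
move=> h h' fg; rewrite -subr_ge0 addrC -mulN1r -intO_lin //; apply: intO_ge0.
by apply: aeOS fg => x _ fg; rewrite mulN1r addrC subr_ge0.
Qed.

(** In contrast to [Ig], this class is closed under products, as the integrands of the scheme
    require; since [Om] is bounded it is contained in [Ig]. *)
Definition BM f := exists g : R3 R -> R,
  [/\ measurable_fun setT g, exists B, forall p, `|g p| <= B &
      {ae leb3 R, forall p, pre Om p -> f (pt p) = g p}].

Lemma BM_Ig f : BM f -> Ig f.
Proof.
move=> [g [mg [B gB] fg]]; exists g => //.
apply: measurable_bounded_integrable => //.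
- exact: mOm.
- exact: leb3_bounded_lty.
- exact: measurable_funTS.
exists B; split; first exact: num_real.
by move=> M BM p _; apply: le_trans (gB p) (ltW BM).
Qed.

Lemma BM_ext f g : aeO (fun x => f x = g x) -> BM f -> BM g.
Proof.
rewrite /aeO => h [u [mu bu fu]]; exists u; split=> //.
by apply: filterS2 h fu => p h1 h2 Op; rewrite -h1 // h2.
Qed.

Lemma BMD f g : BM f -> BM g -> BM (fun x => f x + g x).
Proof.
move=> [u [mu [B uB] fu]] [v [mv [C vC] gv]]; exists (u \+ v); split.
- exact: measurable_funD.
- by exists (B + C) => p; apply: le_trans (ler_normD _ _) (lerD _ _).
- by apply: filterS2 fu gv => p h1 h2 Op; rewrite h1 // h2.
Qed.

Lemma BMM f g : BM f -> BM g -> BM (fun x => f x * g x).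
Proof.
move=> [u [mu [B uB] fu]] [v [mv [C vC] gv]]; exists (u \* v); split.
- exact: measurable_funM.
- by exists (B * C) => p; rewrite normrM ler_pM.
- by apply: filterS2 fu gv => p h1 h2 Op; rewrite h1 // h2.
Qed.

Lemma BM_cst a : BM (fun=> a).
Proof.
by exists (fun=> a); split; [exact: measurable_cst|exists (`|a|)|exact: aeW].
Qed.

Lemma BM_sum (I : finType) (f : I -> 'rV[R]_3 -> R) :
  (forall i, BM (f i)) -> BM (fun x => \sum_i f i x).
Proof.
move=> h; elim: (index_enum I) => [|i s IH].
  by apply: BM_ext (BM_cst 0); apply: aeO_all => x _; rewrite big_nil.
by apply: BM_ext (BMD (h i) IH); apply: aeO_all => x _; rewrite big_cons.
Qed.

Lemma measurable_fun_contO (U : set 'rV[R]_3) f : open U ->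
  (forall x, U x -> {for x, continuous f}) -> measurable_fun (pre U) (f \o pt).
Proof.
move=> oU cf; apply: (measurability (@RGenOpens.G R)).
  exact: RGenOpens.measurableE.
move=> _ [_ [a [b ->]] <-].
rewrite [X in measurable X](_ : _ = pre (U `&` f @^-1` `]a, b[%classic)) //.
apply: measurable_open; rewrite openE => x [Ux fx].
have h : nbhs x (f @^-1` `]a, b[%classic).
  by apply: (cf x Ux); apply: open_nbhs_nbhs; split => //; exact: itv_open.
rewrite /interior; apply: filterI => //; exact: open_nbhs_nbhs.
Qed.

(** The representative is [f] on [U] and zero elsewhere, which discards the values of [f] on the
    null set left out by [U]. *)
Lemma BM_cont (U : set 'rV[R]_3) f B : open U -> U `<=` Om -> aeO U ->
  (forall x, U x -> {for x, continuous f}) -> (forall x, U x -> `|f x| <= B) ->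
  BM f.
Proof.
move=> oU UO aeU cf fB; exists ((f \o pt) \_ (pre U)); split.
- by apply/(measurable_restrictT _ _).1 => //;
    [exact: measurable_open|exact: measurable_fun_contO].
- exists (Num.max B 0) => p; rewrite patchE; case: ifPn => [/set_mem Up|_].
    by rewrite le_max fB.
  by rewrite normr0 le_max lexx orbT.
- rewrite /aeO in aeU; apply: filterS aeU => p h Op; rewrite patchE mem_set //; exact: h.
Qed.

End integral.

(** * Polynomials in three variables *)

Lemma null_roots (R : realType) (q : {poly R}) : q != 0 ->
  lebesgue_measure [set z : R | q.[z] = 0] = 0%E.
Proof.
move=> q0; apply: countable_lebesgue_measure0; apply: finite_set_countable.
apply: contrapT => /(@infinite_set_fset _ _ (size q)) [X Xq].
apply/negP; rewrite -ltnNge; apply: max_poly_roots q0 _ (finmap.fset_uniq X).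
by apply/allP => z /Xq /= /rootP.
Qed.

Section evp.
Context d (T : measurableType d) (R : realType).
Variables (A : comNzRingType) (e : T -> {rmorphism A -> R}).

(** Adds one variable: coefficients are evaluated at the first component, then Horner at the second.
    The nesting is that of the product measure, so zero sets are treated one variable at a time. *)
Definition evp (p : T * measurableTypeR R) : {rmorphism {poly A} -> R} :=
  horner_eval p.2 \o map_poly (e p.1).

Lemma evpE p P : evp p P = (map_poly (e p.1) P).[p.2]. Proof. by []. Qed.

Hypothesis me : forall a, measurable_fun setT (fun x => e x a).

Lemma measurable_evp P : measurable_fun setT (fun p => evp p P).
Proof.
elim/poly_ind: P => [|P c IH].
  rewrite (_ : (fun p => _) = cst 0); last by apply/funext => p; rewrite rmorph0.
  exact: measurable_cst.
rewrite (_ : (fun p => _) = fun p => evp p P * p.2 + e p.1 c); last first.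
  apply/funext => p; rewrite !evpE rmorphD rmorphM /= map_polyX map_polyC.
  by rewrite hornerMXaddC.
apply: measurable_funD.
  by apply: measurable_funM => //; exact: measurable_snd.
by apply: (measurableT_comp (me c)); exact: measurable_fst.
Qed.

Variable m : {measure set T -> \bar R}.
Hypothesis e0 : forall a, a != 0 -> m [set x | e x a = 0] = 0%E.

(** For almost every first component the leading coefficient does not vanish, and the section of the
    zero set is then a finite set of roots. *)
Lemma null_evp P : P != 0 -> (m \x lebesgue_measure)%E [set p | evp p P = 0] = 0%E.
Proof.
move=> P0; rewrite /product_measure1 /=.
have c0 : lead_coef P != 0 by rewrite lead_coef_eq0.
rewrite (@integral_ae _ _ _ m setT _ (fun=> 0%E)) ?integral0 //.
exists [set x | e x (lead_coef P) = 0]; split; last 2 first.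
- exact: e0.
- move=> x /= h; apply: contrapT => ex; apply: h => _.
  rewrite (_ : xsection _ _ = [set z | (map_poly (e x) P).[z] = 0]); last first.
    by apply/seteqP; split=> z; rewrite /xsection /= inE.
  apply: null_roots.
  apply/eqP => /(congr1 (fun q : {poly R} => q`_(size P).-1)).
  rewrite coef_map coef0.
  exact: ex.
rewrite -[X in measurable X]setTI.
exact: (me (lead_coef P) measurableT (measurable_set1 (0 : R))).
Qed.

End evp.

Section polynomials.
Variable R : realType.

Definition P3 := {poly {poly {poly R}}}.

Definition ev1 (x : measurableTypeR R) : {rmorphism {poly R} -> R} := horner_eval x.
Definition ev2 := @evp _ (measurableTypeR R) R {poly R} ev1.
Definition ev3 : R3 R -> {rmorphism P3 -> R} := evp ev2.
Definition tp (x : 'rV[R]_3) : R3 R := (x 0 0, x 0 1, x 0 (2%:R)).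
Definition ev (P : P3) (x : 'rV[R]_3) : R := ev3 (tp x) P.

Lemma ptK : cancel pt tp.
Proof. by move=> [[x y] z]; rewrite /tp !mxE. Qed.

Lemma null_ev (P : P3) : P != 0 -> leb3 R (pre [set x | ev P x = 0]) = 0%E.
Proof.
move=> P0; rewrite (_ : pre _ = [set p | ev3 p P = 0]); last first.
  by apply/seteqP; split => p; rewrite /pre /= /ev ptK.
have m1 a : measurable_fun setT (fun x => ev1 x a).
  exact: (continuous_measurable_fun (@continuous_horner _ a)).
apply: null_evp P0 => [a|a a0]; first exact: measurable_evp.
by apply: null_evp a0 => // b; apply: null_roots.
Qed.

Lemma evD P Q x : ev (P + Q) x = ev P x + ev Q x. Proof. exact: rmorphD. Qed.
Lemma evB P Q x : ev (P - Q) x = ev P x - ev Q x. Proof. exact: rmorphB. Qed.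
Lemma evM P Q x : ev (P * Q) x = ev P x * ev Q x. Proof. exact: rmorphM. Qed.

Let ev3C q p : ev3 p q%:P = ev2 p.1 q.
Proof. by rewrite evpE map_polyC hornerC. Qed.
Let ev2C q p : ev2 p q%:P = ev1 p.1 q.
Proof. by rewrite evpE map_polyC hornerC. Qed.

Lemma evC c x : ev c%:P%:P%:P x = c.
Proof. by rewrite /ev ev3C ev2C; exact: hornerC. Qed.
Lemma ev_X2 x : ev 'X x = x 0 (2%:R).
Proof. by rewrite /ev [LHS]evpE map_polyX hornerX. Qed.
Lemma ev_X1 x : ev 'X%:P x = x 0 1.
Proof. by rewrite /ev ev3C [LHS]evpE map_polyX hornerX. Qed.
Lemma ev_X0 x : ev 'X%:P%:P x = x 0 0.
Proof. by rewrite /ev ev3C ev2C; exact: hornerX. Qed.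

Lemma is_derive_coord (x v : 'rV[R]_3) (i : 'I_3) :
  is_derive x v (fun y : 'rV[R]_3 => y 0 i) (v 0 i).
Proof.
have h : (h^-1 *: ((h *: v + x) 0 i - x 0 i)) @[h --> (0 : R)^'] --> v 0 i.
  apply: cvg_near_cst; near=> t.
  rewrite /= !mxE addrK [LHS]mulrA mulVf ?mul1r //.
  by near: t; exact: nbhs_dnbhs_neq.
by apply: DeriveDef; [apply/cvg_ex; exists (v 0 i)|apply: cvg_lim].
Unshelve. all: by end_near. Qed.

Definition deriv_ok (P : P3) := continuous (ev P) /\
  forall k, exists Q, forall x, is_derive x (delta_mx 0 k) (ev P) (ev Q x).

(** The ring is generated by the constants and the three variables; the induction peels off one
    level of nesting after the other. *)
Lemma P3_ind (K : P3 -> Prop) : (forall c, K c%:P%:P%:P) ->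
  K 'X%:P%:P -> K 'X%:P -> K 'X ->
  (forall P Q, K P -> K Q -> K (P + Q)) ->
  (forall P Q, K P -> K Q -> K (P * Q)) -> forall P, K P.
Proof.
move=> KC K0 K1 K2 KD KM; elim/poly_ind => [|P c KP].
  by rewrite -[0](@polyC0 _) -[X in X%:P](@polyC0 _) -[X in X%:P%:P](@polyC0 _).
apply: (KD) (KM _ _ KP K2) _; elim/poly_ind: c => [|c a Kc].
  by rewrite -[X in X%:P](@polyC0 _) -[X in X%:P%:P](@polyC0 _).
rewrite polyCD polyCM; apply: (KD) (KM _ _ Kc K1) _.
elim/poly_ind: a => [|a r Ka]; first by rewrite -[X in X%:P%:P](@polyC0 _).
by rewrite !polyCD !polyCM; apply: (KD) (KM _ _ Ka K0) _.
Qed.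

Lemma deriv_okP P : deriv_ok P.
Proof.
have coord (i : 'I_3) Q : (forall x, ev Q x = x 0 i) -> deriv_ok Q.
  move=> h; have E : ev Q = (fun y : 'rV[R]_3 => y 0 i) by apply/funext.
  rewrite /deriv_ok E.
  split; first exact: coord_continuous.
  move=> k; exists ((delta_mx 0 k : 'rV[R]_3) 0 i)%:P%:P%:P => x.
  by rewrite evC; exact: is_derive_coord.
elim/P3_ind: P => [c|||||].
- have E : ev c%:P%:P%:P = cst c by apply/funext => x; rewrite evC.
  rewrite /deriv_ok E.
  split=> [|k]; first exact: cst_continuous.
  by exists 0 => x; rewrite [ev 0 x]rmorph0; exact: is_derive_cst.
- exact: (coord 0 _ ev_X0).
- exact: (coord 1 _ ev_X1).
- exact: (coord 2%:R _ ev_X2).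
- move=> P Q [cP dP] [cQ dQ].
  have E : ev (P + Q) = ev P + ev Q by apply/funext => x; rewrite evD.
  rewrite /deriv_ok E.
  split=> [x|k]; first by apply: continuousD; [exact: cP|exact: cQ].
  have [P' dP'] := dP k; have [Q' dQ'] := dQ k; exists (P' + Q') => x.
  by rewrite evD; exact: is_deriveD.
- move=> P Q [cP dP] [cQ dQ].
  have E : ev (P * Q) = ev P * ev Q by apply/funext => x; rewrite evM.
  rewrite /deriv_ok E.
  split=> [x|k]; first by apply: continuousM; [exact: cP|exact: cQ].
  have [P' dP'] := dP k; have [Q' dQ'] := dQ k; exists (P * Q' + Q * P') => x.
  by rewrite evD !evM; exact: is_deriveM.
Qed.

Lemma ev_continuous P : continuous (ev P).
Proof. by have [] := deriv_okP P. Qed.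

Definition dP3 k P : P3 := projT1 (cid ((deriv_okP P).2 k)).

Lemma is_derive_ev k P x : is_derive x (delta_mx 0 k) (ev P) (ev (dP3 k P) x).
Proof. exact: (projT2 (cid ((deriv_okP P).2 k))). Qed.

Lemma pd_ev k P x : pd k (ev P) x = ev (dP3 k P) x.
Proof. by have [_ h] := is_derive_ev k P x; exact: h. Qed.

(** One passes from [y] to [x] along the three axes in turn; on each line the one-variable
    restriction has zero derivative. *)
Lemma ev_const P x y : (forall k z, ev (dP3 k P) z = 0) -> ev P x = ev P y.
Proof.
move=> dP0.
have step k (z : 'rV[R]_3) t : ev P (z + t *: delta_mx 0 k) = ev P z.
  pose f (s : R) := ev P (z + s *: delta_mx 0 k).
  rewrite -[LHS]/(f t); have -> : ev P z = f 0 by rewrite /f scale0r addr0.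
  apply: is_derive_0_is_cst => s.
  have := is_derive_ev k P (z + s *: delta_mx 0 k); rewrite dP0 => -[dv eq0].
  have E : (fun h : R => h^-1 *: ((f \o shift s) (h *: 1) - f s)) =
      (fun h => h^-1 *: ((ev P \o shift (z + s *: delta_mx 0 k)) (h *: delta_mx 0 k)
         - ev P (z + s *: delta_mx 0 k))).
    apply/funext => h; rewrite /f /=; congr (_ *: (ev P _ - _)).
    by rewrite /= [h%:A]mulr1 scalerDl addrCA.
  by apply: DeriveDef; rewrite /derivable /derive E.
have -> : x = y + (x 0 0 - y 0 0) *: delta_mx 0 0 + (x 0 1 - y 0 1) *: delta_mx 0 1
      + (x 0 (2%:R) - y 0 (2%:R)) *: delta_mx 0 (2%:R).
  apply/rowP => i; rewrite !mxE; case: i => -[|[|[|]]] //= i3;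
    rewrite ?(mulr0, mulr1, addr0) [RHS]addrC.
  - by rewrite [Ordinal _](_ : _ = 0) ?subrK //; exact/val_inj.
  - by rewrite [Ordinal _](_ : _ = 1) ?subrK //; exact/val_inj.
  - by rewrite [Ordinal _](_ : _ = 2%:R) ?subrK //; exact/val_inj.
by rewrite !step.
Qed.

End polynomials.

(** * Continuous piecewise polynomial functions *)

Lemma near_fin (T : Type) (F : set_system T) (I : finType) (P : I -> T -> Prop) :
  Filter F -> (forall i, F (P i)) -> F (fun x => forall i, P i x).
Proof. by move=> FF h; apply: (@filter_forall _ _ P). Qed.

Section continuous_closure.
Variables (R : realType) (Om : set 'rV[R]_3).
Hypotheses (oOm : open Om) (bOm : bounded_set Om).
Implicit Types f g : 'rV[R]_3 -> R.

Lemma bounded_closure : bounded_set (closure Om).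
Proof.
move: bOm => [M [rM bM]]; exists M; split=> // N /bM OmN x cx.
have : closure (closed_ball_ Num.norm (0 : 'rV[R]_3) N) x.
  by apply: closure_subset cx => y /OmN /=; rewrite /closed_ball_ /= sub0r normrN.
have /closure_id <- := @closed_closed_ball_ R 'rV[R]_3 0 N.
by rewrite /closed_ball_ /= sub0r normrN.
Qed.

Lemma compact_closureO : compact (closure Om).
Proof. by apply: bounded_closed_compact; [exact: bounded_closure|exact: closed_closure]. Qed.

Lemma within_bounded f : {within closure Om, continuous f} ->
  exists B, forall x, closure Om x -> `|f x| <= B.
Proof.
move=> cf; have [B [_ hB]] := compact_bounded (continuous_compact cf compact_closureO).
by exists (B + 1) => x cx; apply: (hB (B + 1)); [rewrite ltrDl|exists x].
Qed.

Lemma within_continuous_at (V : topologicalType) (f : 'rV[R]_3 -> V) x :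
  {within closure Om, continuous f} -> Om x -> {for x, continuous f}.
Proof.
move=> cf Ox; have := continuous_subspaceW (@subset_closure _ Om) cf.
by rewrite continuous_open_subspace // => /(_ x); apply; rewrite inE.
Qed.

Lemma within_BM f : {within closure Om, continuous f} -> BM Om f.
Proof.
move=> cf; have [B fB] := within_bounded cf.
apply: (@BM_cont _ _ Om _ B) => //; first exact: aeO_all.
  by move=> x; apply: within_continuous_at.
by move=> x Ox; apply/fB/subset_closure.
Qed.

(** If [f] differed from [c] at a point of the closure, it would do so on a relative neighbourhood,
    which contains a nonempty open part of [Om] and hence a point where [f] equals [c]. *)
Lemma closure_ext f c : {within closure Om, continuous f} ->
  aeO Om (fun x => f x = c) -> forall x, closure Om x -> f x = c.
Proof.
move=> cf fc x cx; apply: contrapT => /eqP fx.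
have /subspace_continuousP/(_ x cx) fcx := cf.
have o : open [set y : R | y != c] by apply: open_neq.
have /nbhs_interior : nbhs x [set y | closure Om y -> f y != c].
  have : nbhs (f x) [set y : R | y != c] by apply: open_nbhs_nbhs.
  by move/fcx.
move=> h; have [y [Oy hy]] := cx _ h.
have [z [Oz hz fz]] := aeO_dense oOm fc Oy (@open_interior _ _) hy.
by have := interior_subset hz (subset_closure Oz); rewrite fz eqxx.
Qed.

End continuous_closure.

Section piecewise_polynomial.
Variables (R : realType) (Om : set 'rV[R]_3).
Hypotheses (oOm : open Om) (bOm : bounded_set Om).
Variables (f : 'rV[R]_3 -> R) (n : nat) (P : 'I_n -> P3 R).
Hypotheses (cf : {within closure Om, continuous f})
  (fP : forall x, closure Om x -> exists a, f x = ev (P a) x).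

(* Off the zero set of [cut], two of the polynomials that agree at a point
   are equal. As the sets [f = P a] are relatively closed and cover [Om], [f] is
   then locally equal to one of the polynomials; the geometry of the elements
   plays no role. *)
Let cut : P3 R := \prod_(ab : 'I_n * 'I_n | P ab.1 != P ab.2) (P ab.1 - P ab.2).
Let U := Om `&` [set x | ev cut x != 0].

Let oU : open U.
Proof.
apply: openI => //; apply: (@open_comp _ _ (ev cut) [set y | y != 0]).
  by move=> x _; apply: ev_continuous.
exact: open_neq.
Qed.

Let aeU : aeO Om U.
Proof.
have cut0 : cut != 0 by apply/prodf_neq0 => ab; rewrite subr_eq0.
have cl : closed [set x : 'rV[R]_3 | ev cut x = 0].
  apply: (@closed_comp _ _ (ev cut) [set y | y = 0]).
    by move=> x _; apply: ev_continuous.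
  exact: closed_eq.
apply: aeOS (aeO_nullC _ cl (null_ev cut0)) => x Ox /eqP; by split.
Qed.

Let loc x : U x -> exists2 a, f x = ev (P a) x & \forall y \near x, f y = ev (P a) y.
Proof.
move=> [Ox /= cx]; have [a fa] := fP (subset_closure Ox); exists a => //.
(* A polynomial other than [P a] differs from [f] at [x], because [cut] is nonzero there, and by
   continuity also near [x]. Since some polynomial agrees with [f] at each nearby point, only [P a]
   remains. *)
have N b : \forall y \near x, P b != P a -> f y != ev (P b) y.
  have [->|ba] := eqVneq (P b) (P a); first exact: filterE.
  have fb : f x - ev (P b) x != 0.
    rewrite fa -evB; apply: contra_neq cx => h.
    rewrite /cut (bigD1 (a, b)) /= 1?eq_sym // evM h mul0r //.
  have c : {for x, continuous (f - ev (P b))}.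
    apply: continuousB; last exact: ev_continuous.
    exact: within_continuous_at Ox.
  have : \forall y \near x, (f - ev (P b)) y != 0.
    by apply: (c [set y | y != 0]); apply: open_nbhs_nbhs; split => //; exact: open_neq.
  by apply: filterS => y /=; rewrite subr_eq0.
have NO : \forall y \near x, Om y by apply: open_nbhs_nbhs.
have NN : \forall y \near x, forall b, P b != P a -> f y != ev (P b) y.
  exact: (near_fin (P := fun b y => P b != P a -> f y != ev (P b) y)).
apply: filterS2 NO NN => y Oy h; have [b fb] := fP (subset_closure Oy).
have [<-//|ba] := eqVneq (P b) (P a).
by have := h b ba; rewrite fb eqxx.
Unshelve. all: by end_near. Qed.

Let near_near (x : 'rV[R]_3) (a : 'I_n) :
  (\forall y \near x, f y = ev (P a) y) ->
  \forall y \near x, \forall z \near y, f z = ev (P a) z.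
Proof. exact: near_join. Qed.

Lemma pw_derivable : aeO Om (fun x => forall k, derivable f x (delta_mx 0 k)).
Proof.
apply: aeOS aeU => x _ /loc [a fa na] k.
have : is_derive x (delta_mx 0 k) f (ev (dP3 k (P a)) x).
  apply: near_eq_is_derive (is_derive_ev k (P a) x).
  by apply: filterS na => y ->.
by case.
Qed.

Let pd_loc x a k : (\forall y \near x, f y = ev (P a) y) ->
  pd k f x = ev (dP3 k (P a)) x.
Proof. by move=> /(near_eq_derive (delta_mx 0 k)) h; rewrite -pd_ev; exact: h. Qed.

(** On [U] the derivative is locally one of finitely many polynomials, hence continuous; each of
    them is bounded on the compact closure, and the sum of the bounds serves for all. *)
Lemma pw_pd_BM k : BM Om (pd k f).
Proof.
have /choice[B hB] a : exists B, forall x, closure Om x -> `|ev (dP3 k (P a)) x| <= B.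
  by apply: within_bounded => //; apply: continuous_subspaceT; exact: ev_continuous.
have B0 a : 0 <= `|B a| by [].
apply: (@BM_cont _ _ U _ (\sum_a `|B a|)) => //; first by move=> x [].
- move=> x /loc [a fa na].
  have E : {near x, ev (dP3 k (P a)) =1 pd k f}.
    by apply: filterS (near_near na) => y /(pd_loc k) ->.
  apply: cvg_trans (near_eq_cvg E) _; rewrite (pd_loc k na).
  exact: ev_continuous.
- move=> x Ux; have [a fa na] := loc Ux; rewrite (pd_loc k na).
  have Ox : Om x by case: Ux.
  apply: le_trans (hB a _ (subset_closure Ox)) _.
  by rewrite (bigD1 a) //= (le_trans (ler_norm _)) // lerDl sumr_ge0.
Qed.

(** Off the zero sets of the nonzero polynomials [dP3 k (P a)], a vanishing gradient forces all the
    derivatives of the local polynomial to be the zero polynomial. Thus [f] almost everywhere takes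
    one of the finitely many values [v a]; by continuity it does so on all of [Om], and
    connectedness leaves one value. *)
Lemma pw_rigid : Om !=set0 -> connected Om -> aeO Om (fun x => forall k, pd k f x = 0) ->
  exists c, forall x, closure Om x -> f x = c.
Proof.
move=> [x0 Ox0] cO d0.
pose v a := ev (P a) 0.
have vals : aeO Om (fun x => exists a, f x = v a).
  have nz : aeO Om (fun x => forall ak : 'I_n * 'I_3,
      dP3 ak.2 (P ak.1) != 0 -> ev (dP3 ak.2 (P ak.1)) x <> 0).
    apply: aeO_fin => -[a k] /=; have [->|dP0] := eqVneq (dP3 k (P a)) 0.
      exact: aeO_all.
    have cl : closed [set x : 'rV[R]_3 | ev (dP3 k (P a)) x = 0].
      apply: (@closed_comp _ _ (ev (dP3 k (P a))) [set y | y = 0]).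
        by move=> x _; apply: ev_continuous.
      exact: closed_eq.
    by apply: aeOS (aeO_nullC _ cl (null_ev dP0)).
  apply: aeO_mp aeU _; apply: aeOS2 nz d0 => x Ox nz d0 Ux.
  have [a fa na] := loc Ux; exists a; rewrite fa; apply: ev_const => k z.
  suff -> : dP3 k (P a) = 0 by exact: rmorph0.
  apply/eqP; apply: contraT => /(nz (a, k)) /=.
  by rewrite -(pd_loc k na) d0.
have contf x : Om x -> {for x, continuous f} by exact: within_continuous_at.
have oA (A : set R) : open A -> open (Om `&` f @^-1` A).
  move=> oA; rewrite openE => x [Ox Afx]; apply: filterI.
    exact: open_nbhs_nbhs.
  by apply: (contf x Ox); apply: open_nbhs_nbhs.
have finv (p : pred 'I_n) : open [set y | forall a, p a -> y <> v a].
  rewrite openE => y hy; rewrite /interior.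
  have h a : \forall z \near y, p a -> z <> v a.
    have [pa|pa] := boolP (p a); last exact: filterE.
    have : \forall z \near y, z != v a.
      by apply: open_nbhs_nbhs; split; [exact: open_neq|apply/eqP/hy].
    by apply: filterS => z /eqP.
  exact: (near_fin (P := fun a z => p a -> z <> v a)).
have valsO x : Om x -> exists a, f x = v a.
  move=> Ox; apply: contrapT => h.
  have [y [Oy [_ hy] [a ya]]] := aeO_dense oOm vals Ox (oA _ (finv xpredT))
    (conj Ox (fun a _ (e : f x = v a) => h (ex_intro _ a e))).
  exact: hy a isT ya.
have [a0 fa0] := valsO _ Ox0; exists (v a0); apply: closure_ext => //.
apply: aeO_all => x Ox.
suff E : Om `&` f @^-1` [set v a0] = Om by move: Ox; rewrite -{1}E => -[].
(* The level set of [v a0] is relatively open, since among finitely many values it is described by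
   avoiding the others, and relatively closed, since its complement is described by avoiding
   [v a0]. *)
apply: cO; first by exists x0.
- exists (Om `&` f @^-1` [set y | forall a, v a != v a0 -> y <> v a]).
    exact: oA (finv (fun a => v a != v a0)).
  apply/seteqP; split=> y [Oy].
    by move=> /= fy; split=> //; split=> // a ha e; move: ha; rewrite -fy e eqxx.
  move=> [_ /= h]; split=> //; have [a fa] := valsO y Oy.
  have [e|/h] := eqVneq (v a) (v a0); first by rewrite /= fa.
  by rewrite fa.
- exists (~` (Om `&` f @^-1` [set y | forall a, v a == v a0 -> y <> v a])).
    exact/open_closedC/oA/(finv (fun a => v a == v a0)).
  apply/seteqP; split=> y [Oy].
    by move=> /= fy; split=> //= -[_ /(_ a0)]; rewrite eqxx fy; apply.
  move=> /= h; split=> //; apply: contrapT => fy; apply: h; split=> // a /eqP ->.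
  exact: fy.
Qed.

End piecewise_polynomial.

(** * Bilinear forms and L^2 *)

Section forms.
Variables (R : realFieldType) (E : lmodType R).
Implicit Types (S : E -> Prop) (u v : E).

Definition linear_set S := S 0 /\ forall a u v, S u -> S v -> S (a *: u + v).

(** Linearity is relative to a set because integrals are linear only on integrable functions, while
    [E] will be a space of all functions on R^3. *)
Definition lin_on S (f : E -> R) :=
  forall a u v, S u -> S v -> f (a *: u + v) = a * f u + f v.

Definition sym_psd S (B : E -> E -> R) :=
  [/\ forall v, S v -> lin_on S (B^~ v), forall u v, S u -> S v -> B u v = B v u &
      forall u, S u -> 0 <= B u u].

Lemma linear_setZ S a u : linear_set S -> S u -> S (a *: u).
Proof. by move=> [S0 SL] Su; rewrite -[_ *: _]addr0; apply: SL. Qed.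

Lemma linear_setD S u v : linear_set S -> S u -> S v -> S (u + v).
Proof. by move=> [S0 SL] Su Sv; rewrite -[u]scale1r; apply: SL. Qed.

Lemma linear_setB S u v : linear_set S -> S u -> S v -> S (u - v).
Proof. by move=> [S0 SL] Su Sv; rewrite addrC -scaleN1r; apply: SL. Qed.

Lemma linear_set_sum S n (c : 'I_n -> R) (e : 'I_n -> E) : linear_set S ->
  (forall i, S (e i)) -> S (\sum_i c i *: e i).
Proof.
by move=> hS Se; elim/big_ind: _ => [|u v|i _];
  [case: hS|apply: linear_setD|apply: linear_setZ].
Qed.

Lemma lin_on0 S f : S 0 -> lin_on S f -> f 0 = 0.
Proof.
by move=> S0 /(_ (-1) 0 0 S0 S0); rewrite scaler0 addr0 mulN1r addNr.
Qed.

Lemma lin_onD S f u v : lin_on S f -> S u -> S v -> f (u + v) = f u + f v.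
Proof. by move=> /(_ 1 u v) h Su Sv; rewrite -[in LHS](scale1r u) h // mul1r. Qed.

Lemma lin_onB S f u v : lin_on S f -> S u -> S v -> f (u - v) = f u - f v.
Proof.
by move=> /(_ (-1) v u) h Su Sv; rewrite addrC -scaleN1r h // mulN1r addrC.
Qed.

Lemma lin_on_sum S f n (c : 'I_n -> R) (e : 'I_n -> E) : linear_set S -> lin_on S f ->
  (forall i, S (e i)) -> f (\sum_i c i *: e i) = \sum_i c i * f (e i).
Proof.
move=> hS lf Se.
elim: n c e Se => [|n IH] c e Se; first by rewrite !big_ord0 (lin_on0 (proj1 hS) lf).
rewrite !big_ord_recl lf ?IH //; exact: linear_set_sum.
Qed.

Lemma sym_psd_linr S B u : sym_psd S B -> S u -> linear_set S -> lin_on S (B u).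
Proof.
move=> [lB sB _] Su hS a v w Sv Sw; rewrite sB //; last by case: hS => _; apply.
by rewrite lB // !(sB u).
Qed.

Lemma sym_psd_CS S B u v : linear_set S -> sym_psd S B -> S u -> S v ->
  B u v ^+ 2 <= B u u * B v v.
Proof.
move=> hS pB Su Sv; have [lB sB B0] := pB.
have q t : 0 <= t ^+ 2 * B u u + 2 * t * B u v + B v v.
  have St : S (t *: u + v) by apply: (proj2 hS).
  have := B0 _ St; rewrite lB // !(sym_psd_linr pB) // (sB v u) //; lra.
have [Bu0|Bu0] := eqVneq (B u u) 0.
  have [->|Buv0] := eqVneq (B u v) 0; first by rewrite Bu0 mul0r expr0n.
  (* With [B u u = 0] the quadratic is affine in [t], and this choice makes it [-1]. *)
  have := q (- (B v v + 1) / (2 * B u v)); rewrite Bu0.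
  rewrite (_ : 2 * _ * _ = - (B v v + 1)); last by field.
  by move=> h; exfalso; lra.
have Bp : 0 < B u u by rewrite lt_def Bu0 B0.
(* The minimizer of the quadratic. *)
have := mulr_ge0 (q (- B u v / B u u)) (ltW Bp).
rewrite [X in 0 <= X](_ : _ = B u u * B v v - B u v ^+ 2); last by field.
by rewrite subr_ge0.
Qed.

(** For a form that is only semidefinite, such as those built from gradients, a vanishing
    dissipation term still removes [u] from every pairing. *)
Lemma sym_psd_eq0 S B u v : linear_set S -> sym_psd S B -> S u -> S v ->
  B u u = 0 -> B u v = 0.
Proof.
move=> hS pB Su Sv Bu0; have := sym_psd_CS hS pB Su Sv; rewrite Bu0 mul0r => h.
by apply/eqP; rewrite -sqrf_eq0 eq_le h sqr_ge0.
Qed.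

End forms.

(** * Square-integrable functions on the domain *)

Section L2.
Variables (R : realType) (Om : set 'rV[R]_3).
Hypotheses (oOm : open Om) (bOm : bounded_set Om).
Implicit Types f g h : 'rV[R]_3 -> R.

Lemma L2M_Ig f g : L2 Om f -> L2 Om g -> Ig Om (fun x => f x * g x).
Proof.
move=> [mf if2] [mg ig2]; exists (fun p => f (pt p) * g (pt p)); last exact: aeW.
have i2 : (leb3 R).-integrable (pre Om)
    (fun p => (f (pt p) ^+ 2)%:E + (g (pt p) ^+ 2)%:E)%E.
  by apply: integrableD => //; exact: mOm.
apply: (le_integrable (mOm oOm) _ _ i2).
  by apply/measurable_EFinP; apply: measurable_funM.
move=> p _ /=; rewrite lee_fin normrM.
rewrite [leRHS]ger0_norm ?addr_ge0 ?sqr_ge0 //.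
rewrite -(real_normK (num_real (f _))) -(real_normK (num_real (g _))).
set a := `|f _|; set b := `|g _|.
have a0 : 0 <= a := normr_ge0 _; have b0 : 0 <= b := normr_ge0 _.
by have := sqr_ge0 (a - b); nra.
Qed.

Lemma L2_sqr_Ig f : L2 Om f -> Ig Om (fun x => f x ^+ 2).
Proof. by move=> h; have := L2M_Ig h h; apply: Ig_ext; exact: aeO_all. Qed.

Lemma Ig_L2 f : measurable_fun (pre Om) (f \o pt) -> Ig Om (fun x => f x ^+ 2) ->
  L2 Om f.
Proof.
move=> mf [g ig fg]; split=> //.
have mf2 : measurable_fun (pre Om) (fun p => (f (pt p) ^+ 2)%:E).
  by apply/measurable_EFinP; apply: measurable_funX.
apply/integrableP; split => //; have /integrableP[mg] := ig; apply: le_lt_trans.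
rewrite (@integral_ae _ _ _ _ _ _ (fun p => `|(EFin \o g) p|)%E) //.
by apply: filterS fg => p h /h /= ->.
Qed.

Lemma L2_linear_set : linear_set (L2 Om : ('rV[R]_3 -> R) -> Prop).
Proof.
split.
  apply: Ig_L2; first exact: measurable_cst.
  by apply: Ig_ext (Ig0 Om); apply: aeO_all => x _; rewrite /= expr0n.
move=> a f g hf hg; apply: Ig_L2.
  by apply: measurable_funD; [apply: measurable_funM => //; case: hf|case: hg].
have := Ig_lin oOm (a ^+ 2) (L2_sqr_Ig hf)
  (Ig_lin oOm (2 * a) (L2M_Ig hf hg) (L2_sqr_Ig hg)).
by apply: Ig_ext; apply: aeO_all => x _; have -> : (a *: f + g) x = a * f x + g x by []; ring.
Qed.

Lemma L2_cont f B : (forall x, Om x -> {for x, continuous f}) ->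
  (forall x, Om x -> `|f x| <= B) -> L2 Om f.
Proof.
move=> cf fB; apply: Ig_L2; first exact: measurable_fun_contO.
apply: BM_Ig => //.
have h : BM Om f by apply: (@BM_cont _ _ Om _ B) => //; exact: aeO_all.
by apply: BM_ext (BMM h h); apply: aeO_all => x _.
Qed.

Lemma L2_mul h f B : (forall x, Om x -> {for x, continuous h}) ->
  (forall x, Om x -> `|h x| <= B) -> L2 Om f -> L2 Om (fun x => h x * f x).
Proof.
move=> ch hB [mf if2].
have mh : measurable_fun (pre Om) (h \o pt) by exact: measurable_fun_contO.
have mhf : measurable_fun (pre Om) ((fun x => h x * f x) \o pt).
  exact: measurable_funM.
split=> //.
have i2 : (leb3 R).-integrable (pre Om) (fun p => (B ^+ 2)%:E * (f (pt p) ^+ 2)%:E)%E.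
  by apply: integrableZl => //; exact: mOm.
apply: (le_integrable (mOm oOm) _ _ i2).
  by apply/measurable_EFinP; apply: measurable_funX.
move=> p Op /=; rewrite lee_fin !(normrX, normrM) exprMn.
by rewrite ler_wpM2r ?sqr_ge0 // lerXn2r ?nnegrE // (le_trans (hB _ Op)) ?ler_norm.
Qed.

Lemma L2_psd : sym_psd (L2 Om : ('rV[R]_3 -> R) -> Prop)
  (fun f g => intO Om (fun x => f x * g x)).
Proof.
split=> [g hg a f1 f2 h1 h2|f g _ _|f _].
- rewrite -intO_lin //; [|exact: L2M_Ig..].
  by apply: eq_intO => x _; rewrite mulrDl -mulrA.
- by apply: eq_intO => x _; rewrite mulrC.
- by apply: intO_ge0; apply: aeO_all => x _; rewrite -expr2 sqr_ge0.
Qed.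

Lemma L2_cvg_int (z : nat -> 'rV[R]_3 -> R) f g :
  (forall m, L2 Om (z m)) -> L2 Om f -> L2 Om g ->
  intO Om (fun x => (z m x - f x) ^+ 2) @[m --> \oo] --> (0 : R) ->
  intO Om (fun x => z m x * g x) @[m --> \oo] --> intO Om (fun x => f x * g x).
Proof.
move=> hz hf hg zf.
have hS := L2_linear_set; have hB := L2_psd.
set G := intO Om (fun x => g x * g x).
have G0 : 0 <= G by have [_ _] := hB; apply.
(* Cauchy-Schwarz; [G + 1] replaces [G] so that one can divide by it. *)
have key m : (intO Om (fun x => z m x * g x) - intO Om (fun x => f x * g x)) ^+ 2
    <= intO Om (fun x => (z m x - f x) ^+ 2) * (G + 1).
  have hd : L2 Om (z m - f) by apply: linear_setB.
  have := sym_psd_CS hS hB hd hg.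
  have [/(_ _ hg)/lin_onB lB _ _] := hB; rewrite lB // => /le_trans; apply.
  have -> : intO Om (fun x => (z m - f) x * (z m - f) x) =
    intO Om (fun x => (z m x - f x) ^+ 2) by exact: eq_intO.
  rewrite ler_wpM2l ?lerDl //; apply: intO_ge0; apply: aeO_all => x _.
  exact: sqr_ge0.
apply/cvgrPdist_lt => e e0.
have := zf; move/cvgrPdist_lt => /(_ (e ^+ 2 / (G + 1))).
have G1 : 0 < G + 1 by rewrite ltr_wpDl.
rewrite divr_gt0 ?exprn_gt0 // => /(_ isT); apply: filterS => m.
rewrite sub0r normrN ltr_pdivlMr // => h.
rewrite distrC -(@ltr_pXn2r _ 2) ?nnegrE ?(ltW e0) // real_normK ?num_real //.
apply: le_lt_trans (key m) _; apply: le_lt_trans h.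
by rewrite ler_wpM2r ?(ltW G1) // ler_norm.
Qed.

End L2.

(** * Functions of H^1_0 that are constant *)

Lemma contD (R : realType) (T : topologicalType) (f g : T -> R) x :
  {for x, continuous f} -> {for x, continuous g} ->
  {for x, continuous (fun y => f y + g y)}.
Proof. exact: continuousD. Qed.

Lemma contM (R : realType) (T : topologicalType) (f g : T -> R) x :
  {for x, continuous f} -> {for x, continuous g} ->
  {for x, continuous (fun y => f y * g y)}.
Proof. exact: continuousM. Qed.

Section test_functions.
Variables (R : realType) (Om : set 'rV[R]_3).
Hypotheses (oOm : open Om) (bOm : bounded_set Om).
Implicit Types f g z : 'rV[R]_3 -> R.

Definition crd (k : 'I_3) (x : 'rV[R]_3) : R := x 0 k.

Lemma smooth_pd k f : smooth f -> smooth (pd k f).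
Proof. by move=> h s; have := h (rcons s k); rewrite foldr_rcons. Qed.

Lemma smooth_continuous f : smooth f -> continuous f.
Proof. by move=> /(_ [::]) []. Qed.

Lemma smooth_derivable f k x : smooth f -> derivable f x (delta_mx 0 k).
Proof. by move=> /(_ [::]) [_]; apply. Qed.

Lemma pd_lin a f g k x : derivable f x (delta_mx 0 k) ->
  derivable g x (delta_mx 0 k) ->
  pd k (fun y => a * f y + g y) x = a * pd k f x + pd k g x.
Proof.
by move=> /derivableP df /derivableP dg; have [_ h] := is_deriveD (is_deriveZ a df) dg; exact: h.
Qed.

Lemma derivable_lin a f g k x : derivable f x (delta_mx 0 k) ->
  derivable g x (delta_mx 0 k) ->
  derivable (fun y => a * f y + g y) x (delta_mx 0 k).
Proof.
by move=> /derivableP df /derivableP dg; have [h _] := is_deriveD (is_deriveZ a df) dg; exact: h.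
Qed.

Lemma smooth_lin a f g : smooth f -> smooth g -> smooth (fun x => a * f x + g x).
Proof.
move=> sf sg s /=; have -> : foldr pd (fun x => a * f x + g x) s =
    (fun x => a * foldr pd f s x + foldr pd g s x).
  elim: s => //= k s ->; apply/funext => x.
  by apply: pd_lin; [case: (sf s)|case: (sg s)].
have [cf df] := sf s; have [cg dg] := sg s; split => [x|k x].
  by apply: contD (cg x); apply: contM (cf x); exact: cst_continuous.
exact: derivable_lin.
Qed.

Lemma pd_crdM k j f g x : derivable f x (delta_mx 0 j) ->
  derivable g x (delta_mx 0 j) ->
  is_derive x (delta_mx 0 j) (fun y => crd k y * f y + g y)
    (crd k x * pd j f x + (((delta_mx 0 j : 'rV[R]_3) 0 k) * f x + pd j g x)).
Proof.
move=> /derivableP df /derivableP dg.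
have h := is_deriveD (is_deriveM (is_derive_coord x (delta_mx 0 j) k) df) dg.
apply: is_derive_eq h _.
by rewrite /pd /crd [_ *: 'D_ _ _ _]/GRing.scale /= [_ *: _]mulrC addrA.
Qed.

(* The functions [x_k * f + g] with [f], [g] smooth are stable under partial
   derivatives. *)
Lemma smooth_crdM k f : smooth f -> smooth (fun x => crd k x * f x).
Proof.
move=> sf s /=.
have [A [B [-> sA sB]]] : exists A B, [/\ foldr pd (fun x => crd k x * f x) s =
    (fun x => crd k x * A x + B x), smooth A & smooth B].
  elim: s => [|j s [A [B [E sA sB]]]] /=.
    exists f, (fun=> 0); split; [|exact: sf|]; first by apply/funext => x; rewrite addr0.
    move=> s /=; have -> : foldr pd (fun _ : 'rV[R]_3 => 0 : R) s = (fun=> 0).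
      by elim: s => //= j s ->; apply/funext => x; exact: derive_cst.
    by split=> [|j x]; [exact: cst_continuous|exact: derivable_cst].
  exists (pd j A), (fun x => ((delta_mx 0 j : 'rV[R]_3) 0 k) * A x + pd j B x).
  split; [|exact: smooth_pd|by apply: smooth_lin; [|exact: smooth_pd]].
  apply/funext => x; rewrite E.
  by have [h1 h2] := pd_crdM k (@smooth_derivable _ j x sA) (@smooth_derivable _ j x sB).
split=> [x|j x].
  apply: contD (smooth_continuous sB (x:=x)).
  by apply: contM (smooth_continuous sA (x:=x)); exact: coord_continuous.
by have [h1 h2] := pd_crdM k (@smooth_derivable _ j x sA) (@smooth_derivable _ j x sB).
Qed.

Lemma test_fun_lin a f g : test_fun Om f -> test_fun Om g ->
  test_fun Om (fun x => a * f x + g x).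
Proof.
move=> [sf [K [cK KO f0]]] [sg [L [cL LO g0]]]; split; first exact: smooth_lin.
exists (K `|` L); split; first exact: compactU.
  by move=> x [/KO|/LO].
by move=> x KL; rewrite f0 ?g0 ?mulr0 ?addr0 // => ?; apply: KL; [right|left].
Qed.

Lemma test_fun_crdM k f : test_fun Om f -> test_fun Om (fun x => crd k x * f x).
Proof.
move=> [sf [K [cK KO f0]]]; split; first exact: smooth_crdM.
by exists K; split=> // x /f0 ->; rewrite mulr0.
Qed.

Lemma test_fun_pd k f : test_fun Om f -> test_fun Om (pd k f).
Proof.
move=> [sf [K [cK KO f0]]]; split; first exact: smooth_pd.
exists K; split=> // x Kx.
have oK : open (~` K).
  exact: closed_openC (compact_closed (@norm_hausdorff R 'rV[R]_3) cK).
have N : \forall y \near x, f y = cst 0 y.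
  by apply: filterS (open_nbhs_nbhs (conj oK Kx)) => y /f0.
transitivity ('D_(delta_mx 0 k) (cst 0 : 'rV[R]_3 -> R) x).
  exact: near_eq_derive.
exact: derive_cst.
Qed.

Lemma test_fun_bounded f : test_fun Om f -> exists B, forall x, `|f x| <= B.
Proof.
move=> [sf [K [cK KO f0]]].
have cf : {within K, continuous f}.
  by apply: continuous_subspaceT; exact: smooth_continuous.
have [B [_ hB]] := compact_bounded (continuous_compact cf cK).
exists (Num.max 0 (B + 1)) => x; rewrite le_max.
have [Kx|/f0 ->] := pselect (K x); last by rewrite normr0 lexx.
by apply/orP; right; apply: (hB (B + 1)); [rewrite ltrDl|exists x].
Qed.

Lemma test_fun_L2 f : test_fun Om f -> L2 Om f.
Proof.
move=> tf; have [B fB] := test_fun_bounded tf.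
apply: (@L2_cont _ _ oOm bOm _ B) => // x _.
by case: tf => /smooth_continuous h _; apply: h.
Qed.

Lemma weak_pd_lin k a f1 g1 f2 g2 : L2 Om f1 -> L2 Om f2 -> L2 Om g1 -> L2 Om g2 ->
  weak_pd Om k f1 g1 -> weak_pd Om k f2 g2 ->
  weak_pd Om k (fun x => a * f1 x + f2 x) (fun x => a * g1 x + g2 x).
Proof.
move=> Lf1 Lf2 Lg1 Lg2 w1 w2 z tz.
have Lz := test_fun_L2 tz; have Ldz := test_fun_L2 (test_fun_pd k tz).
have [lB _ _] := L2_psd oOm.
have := lB _ Ldz a _ _ Lf1 Lf2; have := lB _ Lz a _ _ Lg1 Lg2.
move=> h h'; have -> := h'; rewrite w1 // w2 //; have -> := h; ring.
Qed.

Lemma int_sqr_lin_cvg0 a (u v : nat -> 'rV[R]_3 -> R) :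
  (forall m, L2 Om (u m)) -> (forall m, L2 Om (v m)) ->
  intO Om (fun x => u m x ^+ 2) @[m --> \oo] --> (0 : R) ->
  intO Om (fun x => v m x ^+ 2) @[m --> \oo] --> (0 : R) ->
  intO Om (fun x => (a * u m x + v m x) ^+ 2) @[m --> \oo] --> (0 : R).
Proof.
move=> Lu Lv u0 v0.
have b m : intO Om (fun x => (a * u m x + v m x) ^+ 2) <=
    2 * a ^+ 2 * intO Om (fun x => u m x ^+ 2) + 2 * intO Om (fun x => v m x ^+ 2).
  have iu := L2_sqr_Ig oOm (Lu m); have iv := L2_sqr_Ig oOm (Lv m).
  have iuv := IgZ oOm 2 iv.
  rewrite -(intOZ oOm 2 iv) -intO_lin //; apply: le_intO => //.
  - apply: L2_sqr_Ig => //.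
    by have := proj2 (L2_linear_set oOm) a _ _ (Lu m) (Lv m).
  - exact: Ig_lin.
  - apply: aeO_all => x _; have := sqr_ge0 (a * u m x - v m x); lra.
have c : 2 * a ^+ 2 * intO Om (fun x => u m x ^+ 2) +
    2 * intO Om (fun x => v m x ^+ 2) @[m --> \oo] --> (0 : R).
  rewrite -[X in _ --> X](_ : 2 * a ^+ 2 * 0 + 2 * 0 = 0); last by rewrite !mulr0 addr0.
  by apply: cvgD; apply: cvgMr.
apply: (squeeze_cvgr _ (cvg_cst 0) c); apply: nearW => m; rewrite b andbT.
by apply: intO_ge0; apply: aeO_all => x _; exact: sqr_ge0.
Qed.

Lemma H10_linear_set : linear_set (H10 Om : ('rV[R]_3 -> R) -> Prop).
Proof.
have L0 := proj1 (L2_linear_set oOm).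
split.
  split=> //; exists (fun _ _ => 0); split=> [k|].
    split=> // z tz.
    by rewrite !(@eq_intO _ _ _ (fun=> 0)) ?intO0 ?oppr0 // => x _; rewrite mul0r.
  have i0 : intO Om (fun _ : 'rV[R]_3 => (0 - 0 : R) ^+ 2) = 0.
    by rewrite (@eq_intO _ _ _ (fun=> 0)) ?intO0 // => x _; rewrite subr0 expr0n.
  exists (fun _ _ => 0); split=> [m||k].
  - split; last by exists set0; split=> //; exact: compact0.
    move=> s /=; have -> : foldr pd (fun _ : 'rV[R]_3 => 0 : R) s = (fun=> 0).
      by elim: s => //= j s ->; apply/funext => x; exact: derive_cst.
    by split=> [|j x]; [exact: cst_continuous|exact: derivable_cst].
  - by rewrite i0; exact: cvg_cst.
  - rewrite (@eq_intO _ _ (fun x => _) (fun=> 0)); first by rewrite intO0; exact: cvg_cst.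
    by move=> x _; rewrite /pd derive_cst subr0 expr0n.
move=> a f1 f2 [Lf1 [g1 [wg1 [z1 [tz1 cz1 dz1]]]]] [Lf2 [g2 [wg2 [z2 [tz2 cz2 dz2]]]]].
have SL := proj2 (L2_linear_set oOm).
split; first exact: SL.
exists (fun k x => a * g1 k x + g2 k x); split=> [k|].
  have [Lg1 w1] := wg1 k; have [Lg2 w2] := wg2 k.
  by split; [exact: SL|exact: weak_pd_lin].
exists (fun m x => a * z1 m x + z2 m x); split=> [m||k]; first exact: test_fun_lin.
- have := @int_sqr_lin_cvg0 a (fun m x => z1 m x - f1 x) (fun m x => z2 m x - f2 x).
  have d1 m : L2 Om (fun x => z1 m x - f1 x).
    by apply: (linear_setB (L2_linear_set oOm) _ Lf1); exact: test_fun_L2.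
  have d2 m : L2 Om (fun x => z2 m x - f2 x).
    by apply: (linear_setB (L2_linear_set oOm) _ Lf2); exact: test_fun_L2.
  move=> /(_ d1 d2 cz1 cz2); apply: cvg_trans; apply: near_eq_cvg; apply: nearW => m.
  apply: eq_intO => x _; have -> : (a *: f1 + f2) x = a * f1 x + f2 x by [].
  by ring.
- have := @int_sqr_lin_cvg0 a (fun m x => pd k (z1 m) x - g1 k x)
    (fun m x => pd k (z2 m) x - g2 k x).
  have [Lg1 _] := wg1 k; have [Lg2 _] := wg2 k.
  have d1 m : L2 Om (fun x => pd k (z1 m) x - g1 k x).
    apply: (linear_setB (L2_linear_set oOm) _ Lg1); apply: test_fun_L2.
    exact: test_fun_pd.
  have d2 m : L2 Om (fun x => pd k (z2 m) x - g2 k x).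
    apply: (linear_setB (L2_linear_set oOm) _ Lg2); apply: test_fun_L2.
    exact: test_fun_pd.
  move=> /(_ d1 d2 (dz1 k) (dz2 k)); apply: cvg_trans; apply: near_eq_cvg.
  apply: nearW => m; apply: eq_intO => x _; congr (_ ^+ 2).
  rewrite pd_lin; first ring.
    by apply: smooth_derivable; case: (tz1 m).
  by apply: smooth_derivable; case: (tz2 m).
Qed.

End test_functions.

(** * Derivatives of test functions integrate to zero; constants in H^1_0 *)

Lemma fubini_eq0 d1 d2 (T1 : measurableType d1) (T2 : measurableType d2) (R : realType)
    (m1 : {sigma_finite_measure set T1 -> \bar R})
    (m2 : {sigma_finite_measure set T2 -> \bar R}) (g : T1 * T2 -> \bar R) :
  (m1 \x m2)%E.-integrable setT g ->
  (forall x, \int[m2]_y g (x, y) = 0)%E -> (\int[m1 \x m2]_p g p = 0)%E.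
Proof.
move=> ig h; rewrite -fubini1 //.
by rewrite (eq_integral (fun=> 0%E)) ?integral0 // => x _; exact: h.
Qed.
(** Fubini for [leb3] needs the plane measure, its outer factor, to be sigma-finite. *)
Lemma sigma_finite_leb2 (R : realType) :
  sigma_finite setT (@lebesgue_measure R \x @lebesgue_measure R)%E.
Proof.
exists (fun n => ball (0 : R) n%:R `*` ball (0 : R) n%:R).
  apply/seteqP; split=> // -[x y] _.
  have [n hn] : exists n, Num.max `|x| `|y| < n%:R.
    by exists (Num.bound (Num.max `|x| `|y|)); rewrite archi_boundP ?le_max ?normr_ge0.
  exists n => //; move: hn; rewrite gt_max => /andP[hx hy].
  by split; rewrite /ball /= sub0r normrN.
move=> n; split; first by apply: measurableX; exact: measurable_ball.
have := @product_measure1E _ _ (measurableTypeR R) (measurableTypeR R) R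
  lebesgue_measure lebesgue_measure (ball 0 n%:R) (ball 0 n%:R)
  (measurable_ball _ _) (measurable_ball _ _).
by rewrite /= => ->; rewrite /= !lebesgue_measure_ball // -EFinM ltry.
Qed.
Lemma leb3_fubini_eq0 (R:realType) (g : R3 R -> \bar R) : (leb3 R).-integrable setT g ->
  (forall p, (\int[@lebesgue_measure R]_c g (p, c))%E = 0%E) -> (\int[leb3 R]_p g p)%E = 0%E.
Proof.
pose m1 : {sigma_finite_measure set (measurableTypeR R * measurableTypeR R)%type -> \bar R} :=
  HB.pack (@lebesgue_measure R \x @lebesgue_measure R)%E
    (Measure_isSigmaFinite.Build _ _ _ (@lebesgue_measure R \x @lebesgue_measure R)%E
      (sigma_finite_leb2 R)).
exact: (@fubini_eq0 _ _ _ _ R m1 (@lebesgue_measure R) g).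
Qed.

Lemma is_derive_line (R : realType) (V : normedModType R) (f : V -> R) (x v : V)
    (s df : R) :
  is_derive (x + s *: v) v f df -> is_derive s (1 : R) (fun t : R => f (x + t *: v)) df.
Proof.
move=> [dv eqv]; pose g (t : R) := f (x + t *: v).
have E : (fun h : R => h^-1 *: ((g \o shift s) (h *: 1) - g s)) =
    (fun h => h^-1 *: ((f \o shift (x + s *: v)) (h *: v) - f (x + s *: v))).
  apply/funext => h; rewrite /g /=; congr (_ *: (f _ - _)).
  by rewrite /= [h%:A]mulr1 scalerDl addrCA.
by apply: DeriveDef; rewrite /derivable /derive E.
Qed.

Section zero_trace.
Variables (R : realType) (Om : set 'rV[R]_3).
Hypotheses (oOm : open Om) (bOm : bounded_set Om).

(* Fubini, integrating first along the last coordinate. *)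
Lemma intO_pd_test (z : 'rV[R]_3 -> R) : test_fun Om z ->
  intO Om (pd (2%:R) z) = 0.
Proof.
move=> tz; have td := test_fun_pd (2%:R) tz.
have [sz [K [cK KO z0]]] := tz.
pose g (p : R3 R) : \bar R := (pd (2%:R) z (pt p))%:E.
have [sd [L [cL LO d0]]] := td.
have patch : g \_ (pre Om) = g.
  apply/funext => p; rewrite patchE; case: ifPn => // /negP; rewrite inE => nOp.
  by rewrite /g d0 // => /LO.
have [B dB] := test_fun_bounded td.
have ig : (leb3 R).-integrable setT g.
  rewrite -patch; apply/(integrable_mkcond _ (mOm oOm)).
  apply: measurable_bounded_integrable => //.
  - exact: mOm.
  - exact: leb3_bounded_lty.
  - by apply: measurable_fun_contO => // x _; apply: smooth_continuous.
  - by exists B; split; [exact: num_real|move=> M BM p _ /=; apply: le_trans (ltW BM)].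
rewrite /intO /Rintegral [X in fine X](_ : _ = 0%E) //.
transitivity (\int[leb3 R]_(p in pre Om) g p)%E; first by [].
rewrite integral_mkcond patch.
apply: leb3_fubini_eq0 => // -[a b].
(* Beyond [M] the line has left the compact supports of [z] and of its derivative: the integral
   reduces to the interval from [- M] to [M], and [z] vanishes at both ends. *)
have [M [M0 Mz]] : exists M : R, 0 < M /\
    forall c, M <= `|c| -> z (pt (a, b, c)) = 0 /\ g (a, b, c) = 0%E.
  have [M1 [_ hM1]] := compact_bounded cK; have [M2 [_ hM2]] := compact_bounded cL.
  exists (`|M1| + `|M2| + 1); split => [|c hc]; first by rewrite ltr_wpDl ?addr_ge0.
  have cn : `|c| <= `|pt (a, b, c)|.
    rewrite [leRHS]mx_normrE; apply: le_trans (le_bigmax _ (fun ij : 'I_1 * 'I_3 =>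
      `|pt (a, b, c) ij.1 ij.2|) (0, 2%:R)).
    by rewrite !mxE.
  split; [apply: z0 => /(hM1 (`|M1| + `|M2| + 2^-1))|
    rewrite /g d0 // => /(hM2 (`|M1| + `|M2| + 2^-1))].
    move=> /(_ _) h; have : `|pt (a, b, c)| <= `|M1| + `|M2| + 2^-1.
      by apply: h; have := ler_norm M1; have := normr_ge0 M2; lra.
    by move: hc cn; lra.
  move=> h; have : `|pt (a, b, c)| <= `|M1| + `|M2| + 2^-1.
    by apply: h; have := ler_norm M2; have := normr_ge0 M1; lra.
  by move: hc cn; lra.
pose F (c : R) := z (pt (a, b, c)).
pose F' (c : R) := pd (2%:R) z (pt (a, b, c)).
have ptE c : pt (a, b, c) = pt (a, b, 0) + c *: delta_mx 0 (2%:R).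
  apply/rowP => i; rewrite !mxE; case: i => -[|[|[|]]] //= _;
    by rewrite ?(mulr0, mulr1, addr0, add0r).
have dF c : is_derive c (1 : R) F (F' c).
  have -> : F = (fun t => z (pt (a, b, 0) + t *: delta_mx 0 (2%:R))).
    by apply/funext => t; rewrite /F ptE.
  apply: is_derive_line; rewrite /F' ptE; apply: derivableP.
  exact: smooth_derivable.
have cF' : continuous F'.
  move=> c; apply: (@continuous_comp _ _ _ (fun t : R => pt (a, b, t)) (pd 2%:R z));
    last exact: smooth_continuous.
  have -> : (fun t : R => pt (a, b, t)) = (fun t => pt (a, b, 0) + t *: delta_mx 0 (2%:R)).
    by apply/funext => t; rewrite ptE.
  apply: (@continuousD _ _ _ (cst _) (fun t : R => t *: _)); first exact: cst_continuous.
  by move=> t; apply: scalel_continuous.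
have cF : continuous F.
  by move=> c; apply/differentiable_continuous/derivable1_diffP; case: (dF c).
pose I : set R := `[- M, M]%classic.
transitivity (\int[lebesgue_measure]_(c in I) (F' c)%:E)%E.
  rewrite [RHS]integral_mkcond; apply: eq_integral => c _; rewrite patchE.
  case: ifPn => // /negP; rewrite inE /I /= in_itv /= => h.
  have /Mz[_ ->] // : M <= `|c|.
  by rewrite leNgt; apply/negP => hc; apply: h; rewrite -ler_norml ltW.
rewrite (@continuous_FTC2 _ F' F) //.
- rewrite /F; have [-> _] := Mz M (ler_norm _).
  have [|-> _] := Mz (- M); first by rewrite normrN ler_norm.
  by rewrite subee.
- by rewrite gtrN.
- exact: continuous_subspaceT.
- split=> [c _||]; first by case: (dF c).
    by apply: cvg_at_right_filter; exact: cF.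
  by apply: cvg_at_left_filter; exact: cF.
- by move=> c _; rewrite derive1E; case: (dF c).
Qed.

Lemma crd_bounded k : exists B, forall x, Om x -> `|crd k x| <= B.
Proof.
have c : {within closure Om, continuous (crd k)}.
  by apply: continuous_subspaceT; exact: coord_continuous.
have [B hB] := within_bounded bOm c.
by exists B => x Ox; apply/hB/subset_closure.
Qed.

(* Testing the weak derivative [g] of the constant [c] with [x_2 zeta_m], where
   [zeta_m -> c] in H^1, gives [c * int (x_2 g) = 0], while the divergence of
   [x_2 zeta_m] has integral zero, which gives [int (c + x_2 g) = 0]. *)
Lemma H10_cst (f : 'rV[R]_3 -> R) (c : R) : Om !=set0 ->
  (forall x, Om x -> f x = c) -> H10 Om f -> c = 0.
Proof.
move=> Om0 fc [Lf [g [wg [z [tz cz dz]]]]].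
(* The last coordinate, the one along which [intO_pd_test] integrates. *)
pose k : 'I_3 := 2%:R; have [Lg wk] := wg k.
have [B hB] := crd_bounded k.
have Lxg : L2 Om (fun x => crd k x * g k x).
  by apply: (L2_mul oOm _ hB) => // x _; exact: coord_continuous.
have Lz m : L2 Om (z m) by exact: test_fun_L2.
have Ldz m : L2 Om (pd k (z m)) by apply: test_fun_L2 => //; exact: test_fun_pd.
have L1 : L2 Om (fun=> 1).
  by apply: (@L2_cont _ _ oOm bOm _ 1) => x _; [exact: cst_continuous|rewrite normr1].
have Lx : L2 Om (crd k).
  by apply: (@L2_cont _ _ oOm bOm _ B) => // x _; exact: coord_continuous.
have e1 : intO Om (fun x => f x * (crd k x * g k x)) = 0.
  have := L2_cvg_int oOm Lz Lf Lxg cz.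
  rewrite (_ : (fun m => _) = (fun=> 0)); last first.
    apply/funext => m; have := wk _ (test_fun_crdM k (tz m)).
    rewrite (@eq_intO _ _ _ (fun x => c * pd k (fun x => crd k x * z m x) x)); last first.
      by move=> x Ox; rewrite fc.
    rewrite intOZ //; last first.
            have Ld := test_fun_L2 oOm bOm (test_fun_pd k (test_fun_crdM k (tz m))).
      by apply: Ig_ext (L2M_Ig oOm Ld L1); apply: aeO_all => x _; rewrite mulr1.
    rewrite intO_pd_test ?mulr0; last exact: test_fun_crdM.
    move=> /eqP; rewrite eq_sym oppr_eq0 => /eqP <-.
    by apply: eq_intO => x _; ring.
  by move=> h; have := cvg_unique _ (cvg_cst 0) h => <-.
have e2 : intO Om f + intO Om (fun x => crd k x * g k x) = 0.
  have h1 := L2_cvg_int oOm Lz Lf L1 cz.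
  have h2 := L2_cvg_int oOm Ldz Lg Lx (dz k).
  have := cvgD h1 h2; rewrite [X in X @ \oo](_ : _ = (fun=> 0)); last first.
    apply/funext => m; rewrite -(intO_pd_test (test_fun_crdM k (tz m))).
    rewrite [LHS](_ : _ = intO Om (fun x => z m x * 1) +
      intO Om (fun x => pd k (z m) x * crd k x)) // -intOD //; [|exact: L2M_Ig..].
    apply: eq_intO => x _.
    have d0 : derivable (fun=> 0 : R) x (delta_mx 0 k : 'rV[R]_3) by exact: derivable_cst.
    have dzx : derivable (z m) x (delta_mx 0 k) by apply: smooth_derivable; case: (tz m).
    have [_ h] := pd_crdM k dzx d0.
    have E : (fun y => crd k y * z m y) = (fun y => crd k y * z m y + 0).
      by apply/funext => y; rewrite addr0.
    rewrite E; apply: etrans (esym h); rewrite [pd k (fun=> 0) x]derive_cst mxE !eqxx /=; ring.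
  move=> h; transitivity (intO Om (fun x => f x * 1) + intO Om (fun x => g k x * crd k x));
    last by have h' := cvg_unique _ (cvg_cst 0) (h eventually_filter); symmetry; exact: h'.
  congr (_ + _); apply: eq_intO => x _; first by rewrite mulr1.
  by rewrite mulrC.
have Ixg : Ig Om (fun x => crd k x * g k x).
  by apply: Ig_ext (L2M_Ig oOm Lxg L1); apply: aeO_all => x _; rewrite mulr1.
have e3 : c * intO Om (fun x => crd k x * g k x) = 0.
  rewrite -intOZ // -e1; apply: eq_intO => x Ox; by rewrite fc.
(* The integral of [f ^+ 2] is [c] times that of [f], which by [e2] is minus that of
   [crd k x * g k x], and [e3] finishes. *)
have e4 : intO Om (fun x => f x ^+ 2) = 0.
  rewrite (@eq_intO _ _ _ (fun x => c * f x)); last by move=> x Ox; rewrite fc.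
  have If : Ig Om f.
    by apply: Ig_ext (L2M_Ig oOm Lf L1); apply: aeO_all => x _; rewrite mulr1.
  by rewrite intOZ //; move/eqP: e2; rewrite addr_eq0 => /eqP ->; rewrite mulrN e3 oppr0.
have f0 := intO_eq0 oOm (L2_sqr_Ig oOm Lf) (aeO_all (fun x _ => sqr_ge0 (f x))) e4.
have [x0 Ox0] := Om0.
have [y [Oy _]] := aeO_dense oOm f0 Ox0 (@openT _) I.
by rewrite fc // => /eqP; rewrite sqrf_eq0 => /eqP.
Qed.

End zero_trace.

(** * The abstract linear system *)

Section finite_dimension.
Variables (R : realFieldType) (E : lmodType R) (S N : E -> Prop).
Hypothesis hS : linear_set S.

(* Discrete functions matter on the closure of the domain only, so their spaces
   have finite dimension up to the functions [N] vanishing there. *)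
Definition finite_span :=
  exists (r : nat) (e : 'I_r -> E), (forall i, S (e i)) /\
    forall u, S u -> exists c : 'I_r -> R, N (u - \sum_i c i *: e i).

(** [rep] is a relation because coefficients need not be determined by the function. The vectors of
    [C] representing elements of [S] form a subspace, and a basis of it lifts to a spanning family
    modulo [N]. *)
Lemma finite_span_rep (C : vectType R) (rep : E -> C -> Prop) :
  (forall u, S u -> exists c, rep u c) ->
  (forall a u v c d, rep u c -> rep v d -> rep (a *: u + v) (a *: c + d)) ->
  (forall u, rep u 0 -> N u) -> finite_span.
Proof.
move=> tot lin ker.
have rep00 : rep 0 0.
  have [c hc] := tot 0 (proj1 hS); have := lin (-1) _ _ _ _ hc hc.
  by rewrite scaler0 addr0 scaleN1r addNr.
pose P (U : {vspace C}) := forall c, c \in U -> exists u, S u /\ rep u c.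
have [U PU maxU] : exists2 U, P U & forall c u, S u -> rep u c -> c \in U.
  (* Here [k] bounds the codimension of [U]: a representing vector outside [U] is adjoined as long
     as there is one. *)
  suff grow k : forall U, P U -> (\dim {:C} <= \dim U + k)%N ->
      exists2 U, P U & forall c u, S u -> rep u c -> c \in U.
    apply: (grow (\dim {:C}) 0%VS); last by rewrite leq_addl.
    by move=> c; rewrite memv0 => /eqP ->; exists 0; split; [case: hS|].
  elim: k => [|k IH] U PU dU.
    exists U => // c u _ _; rewrite addn0 in dU.
    have /eqP -> : U == fullv by rewrite eqEdim subvf.
    exact: memvf.
  have [h|/existsNP[c /existsNP[u h]]] := pselect (forall c u, S u -> rep u c -> c \in U).
    by exists U.
  have [Su [hc /negP cU]] : S u /\ rep u c /\ ~ c \in U.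
    by apply: contrapT => h'; apply: h => Su hc; apply: contrapT => cU; apply: h'.
  apply: (IH (U + <[c]>)%VS).
    move=> _ /memv_addP[x /PU[ux [Sx hx]] [_ /vlineP[a ->] ->]].
    exists (a *: u + ux); split; first exact: (proj2 hS).
    by rewrite [x + _]addrC; apply: lin.
  rewrite (leq_trans dU) // addnS -addSn leq_add2r.
  rewrite ltnNge; apply: contra cU => dle.
  have /eqP -> : U == (U + <[c]>)%VS by rewrite eqEdim addvSl.
  by apply: (subvP (addvSr _ _)); exact: memv_line.
have /choice[e he] (i : 'I_(\dim U)) : exists u, S u /\ rep u (vbasis U)`_i.
  by apply: PU; apply: vbasis_mem; rewrite mem_nth // size_tuple.
exists (\dim U), e; split=> [i|u Su]; first by case: (he i).
have [c hc] := tot u Su; have cU := maxU c u Su hc.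
exists (fun i => coord (vbasis U) i c); apply: ker.
have hsum : rep (\sum_i coord (vbasis U) i c *: e i) c.
  rewrite [X in rep _ X](coord_vbasis cU).
  elim/big_ind2: _ => // [u1 c1 u2 c2 h1 h2|i _].
    by rewrite -[u1]scale1r -[c1]scale1r; exact: lin.
  by rewrite -[_ *: e i]addr0 -[_ *: _`_i]addr0; apply: lin => //; case: (he i).
have := lin (-1) _ _ _ _ hsum hc.
by rewrite !scaleN1r addNr addrC.
Qed.

(* The matrix of [A] on a spanning family may be singular, but its left kernel,
   made of representations of functions in [N], is contained in its right kernel;
   hence both agree and are orthogonal to the right-hand side. *)
Lemma finite_solve (A : E -> E -> R) (L : E -> R) : finite_span ->
  (forall t, S t -> lin_on S (A^~ t)) -> (forall u, S u -> lin_on S (A u)) ->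
  lin_on S L ->
  (forall u t, S u -> S t -> N t -> A u t = 0) ->
  (forall t, S t -> N t -> L t = 0) ->
  (forall u, S u -> (forall t, S t -> A u t = 0) -> N u) ->
  exists2 u, S u & forall t, S t -> A u t = L t.
Proof.
move=> [r [e [Se span]]] lA1 lA2 lL AN LN inj.
pose G := \matrix_(i < r, j < r) A (e i) (e j).
pose l := \row_(j < r) L (e j).
pose comb (c : 'rV_r) := \sum_i c 0 i *: e i.
have Sc c : S (comb c) by exact: linear_set_sum.
have Acomb c j : A (comb c) (e j) = (c *m G) 0 j.
  rewrite (lin_on_sum _ hS (lA1 _ (Se j)) Se) mxE.
  by apply: eq_bigr => i _; rewrite mxE.
have combA c i : A (e i) (comb c) = (c *m G^T) 0 i.
  rewrite (lin_on_sum _ hS (lA2 _ (Se i)) Se) mxE.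
  by apply: eq_bigr => j _; rewrite !mxE.
have split_t t : S t -> exists c n, [/\ S n, N n & t = comb (\row_i c i) + n].
  move=> St; have [c hc] := span t St.
  have E0 : comb (\row_i c i) = \sum_i c i *: e i.
    by apply: eq_bigr => i _; rewrite mxE.
  exists c, (t - comb (\row_i c i)); split.
  - exact: linear_setB.
  - by rewrite E0.
  - by rewrite addrC subrK.
have kerN c : c *m G = 0 -> N (comb c).
  move=> cG; apply: inj => // t /split_t[d [n [Sn Nn ->]]].
  rewrite (lin_onD (lA2 _ (Sc c)) (Sc _) Sn) (AN _ n) // addr0.
  rewrite (lin_on_sum _ hS (lA2 _ (Sc c)) Se) big1 // => j _.
  by rewrite Acomb cG [X in _ * X]mxE mulr0.
have ker_sub : (kermx G <= kermx G^T)%MS.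
  apply/sub_kermxP/row_matrixP => i; rewrite row_mul row0; apply/rowP => j.
  rewrite -combA mxE AN //; apply: kerN; rewrite -row_mul mulmx_ker; exact: row0.
(* A matrix and its transpose have equal rank, so the inclusion between the kernels is an
   equality. *)
have ker_eq : (kermx G^T <= kermx G)%MS.
  by rewrite -(mxrank_leqif_sup ker_sub) !mxrank_ker mxrank_tr.
have /submxP[c lc] : (l <= G)%MS.
  rewrite submxE; apply/eqP.
  have kc : (cokermx G)^T *m G = 0.
    apply/sub_kermxP; apply: submx_trans ker_eq; apply/sub_kermxP.
    by rewrite -trmx_mul mulmx_coker trmx0.
  apply/rowP => j; rewrite [RHS]mxE.
  have := LN _ (Sc (row j (cokermx G)^T)); rewrite (lin_on_sum _ hS lL Se) => <-.
    by rewrite mxE; apply: eq_bigr => i _; rewrite !mxE mulrC.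
  by apply: kerN; rewrite -row_mul kc row0.
exists (comb c) => // t /split_t[d [n [Sn Nn ->]]].
rewrite (lin_onD (lA2 _ (Sc c)) (Sc _) Sn) (AN _ n) // (lin_onD lL (Sc _) Sn) (LN n) //.
rewrite (lin_on_sum _ hS (lA2 _ (Sc c)) Se) (lin_on_sum _ hS lL Se).
by congr (_ + _); apply: eq_bigr => j _; rewrite Acomb -lc [l _ _]mxE.
Qed.

End finite_dimension.

Section lin_on_combinators.
Variables (R : realFieldType) (E : lmodType R) (S : E -> Prop).
Implicit Types f g : E -> R.

Lemma lin_on_add f g : lin_on S f -> lin_on S g -> lin_on S (fun u => f u + g u).
Proof. by move=> hf hg a u v Su Sv; rewrite hf // hg //; ring. Qed.

Lemma lin_on_opp f : lin_on S f -> lin_on S (fun u => - f u).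
Proof. by move=> hf a u v Su Sv; rewrite hf //; ring. Qed.

End lin_on_combinators.

Section abstract_scheme.
Variables (R : realType) (V Q X Y : lmodType R).
Variables (sV nV : V -> Prop) (sQ nQ : Q -> Prop) (sX nX : X -> Prop) (sY nY : Y -> Prop).
Variables (nu dt gam lam J : R).
Variables (aV : V -> V -> R) (bQ : Q -> V -> R) (mX aX : X -> X -> R)
  (mY aY bY : Y -> Y -> R) (f : V -> R) (g w1 : X -> R) (h j1 : Y -> R).

(* [f] and [g] are the brackets multiplied by beta/J in the equations for v and F,
   [h] is the transport of phi, and [w1], [j1] are the terms with the derivatives
   of w and j. *)
Record unknown_system (F0 : X) (phi0 : Y) (beta0 : R) (v : V) (s : Q) (F M : X)
    (phi mu : Y) (beta : R) : Prop := UnknownSystem {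
  sys_v : forall U, sV U -> nu * aV v U - bQ s U = beta / J * f U;
  sys_s : forall p, sQ p -> bQ p v = 0;
  sys_F : forall T, sX T -> mX (F - F0) T + dt * (beta / J) * g T
                            + dt * gam * mX M T = 0;
  sys_M : forall P, sX P -> mX M P = beta / J * w1 P + lam * aX F P;
  sys_phi : forall xi, sY xi -> mY (phi - phi0) xi + dt * (beta / J) * h xi
                                + dt * bY mu xi = 0;
  sys_mu : forall chi, sY chi -> mY mu chi = aY phi chi + beta / J * j1 chi;
  sys_beta : beta - beta0 = (2 * J)^-1 * (j1 (phi - phi0) + w1 (F - F0)
     + dt * g M - dt * f v + dt * h mu) }.

Hypotheses (nu0 : 0 < nu) (dt0 : 0 < dt) (gam0 : 0 < gam) (lam0 : 0 < lam) (J0 : 0 < J).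
Hypotheses (hV : linear_set sV) (hQ : linear_set sQ) (hX : linear_set sX)
  (hY : linear_set sY).
Hypotheses (haV : sym_psd sV aV) (hmX : sym_psd sX mX) (haX : sym_psd sX aX)
  (hmY : sym_psd sY mY) (haY : sym_psd sY aY) (hbY : sym_psd sY bY).
Hypotheses (bQl : forall v, sV v -> lin_on sQ (bQ^~ v))
  (bQr : forall s, sQ s -> lin_on sV (bQ s)).
Hypotheses (lf : lin_on sV f) (lg : lin_on sX g) (lw : lin_on sX w1)
  (lh : lin_on sY h) (lj : lin_on sY j1).

(* Testing with the unknowns themselves, all coupling terms cancel. *)
Lemma energy_balance F0 phi0 beta0 v s F M phi mu beta :
  sX F0 -> sY phi0 -> sV v -> sQ s -> sX F -> sX M -> sY phi -> sY mu ->
  unknown_system F0 phi0 beta0 v s F M phi mu beta ->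
  2 * beta * (beta - beta0) + aY phi (phi - phi0) + lam * aX F (F - F0)
  + dt * nu * aV v v + dt * gam * mX M M + dt * bY mu mu = 0.
Proof.
move=> SF0 Sp0 Sv Ss SF SM Sp Sm [ev es eF eM ep em eb].
have SdF : sX (F - F0) by exact: linear_setB.
have Sdp : sY (phi - phi0) by exact: linear_setB.
have e1 := ev v Sv; rewrite (es s Ss) subr0 in e1.
have e3 := eF M SM; have e4 := eM _ SdF.
have e5 := ep mu Sm; have e6 := em _ Sdp.
have symX : mX (F - F0) M = mX M (F - F0) by case: hmX => _ + _; apply.
have symY : mY (phi - phi0) mu = mY mu (phi - phi0) by case: hmY => _ + _; apply.
have e7 : 2 * beta * (beta - beta0) = beta / J * (j1 (phi - phi0) + w1 (F - F0)
     + dt * g M - dt * f v + dt * h mu).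
  by rewrite eb; field; rewrite gt_eqF.
rewrite e7; move: e1 e3 e4 e5 e6; rewrite symX symY.
set r := beta / J => e1 e3 e4 e5 e6.
have -> : aY phi (phi - phi0) = mY mu (phi - phi0) - r * j1 (phi - phi0).
  by rewrite e6 addrK.
have -> : lam * aX F (F - F0) = mX M (F - F0) - r * w1 (F - F0).
  by rewrite e4 [r * _ + _]addrC addrK.
have -> : mX M (F - F0) = - (dt * r * g M + dt * gam * mX M M).
  by apply/eqP; rewrite -addr_eq0 addrA e3.
have -> : mY mu (phi - phi0) = - (dt * r * h mu + dt * bY mu mu).
  by apply/eqP; rewrite -addr_eq0 addrA e5.
by rewrite -[dt * nu * _]mulrA e1; ring.
Qed.

Let psd_polar (E : lmodType R) (S : E -> Prop) (B : E -> E -> R) u u0 :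
  linear_set S -> sym_psd S B -> S u -> S u0 ->
  B u (u - u0) = 2^-1 * (B u u - B u0 u0 + B (u - u0) (u - u0)).
Proof.
move=> hS pB Su S0; have Sd : S (u - u0) by exact: linear_setB.
have [lB sB _] := pB.
rewrite (lin_onB (lB _ Sd) Su S0) !(lin_onB (sym_psd_linr pB _ hS)) // (sB u0 u) //.
by field.
Qed.

Lemma energy_decay F0 phi0 beta0 v s F M phi mu beta :
  sX F0 -> sY phi0 -> sV v -> sQ s -> sX F -> sX M -> sY phi -> sY mu ->
  unknown_system F0 phi0 beta0 v s F M phi mu beta ->
  beta ^+ 2 + 2^-1 * aY phi phi + lam / 2 * aX F F
  + ((beta - beta0) ^+ 2 + 2^-1 * aY (phi - phi0) (phi - phi0)
     + lam / 2 * aX (F - F0) (F - F0)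
     + dt * nu * aV v v + dt * gam * mX M M + dt * bY mu mu)
  = beta0 ^+ 2 + 2^-1 * aY phi0 phi0 + lam / 2 * aX F0 F0.
Proof.
move=> SF0 Sp0 Sv Ss SF SM Sp Sm hs.
have := energy_balance SF0 Sp0 Sv Ss SF SM Sp Sm hs.
rewrite (psd_polar hY haY Sp Sp0) (psd_polar hX haX SF SF0) => e.
apply/eqP; rewrite -subr_eq0 -{}e; apply/eqP.
by field.
Qed.

(** Null elements are invisible as test elements to every form and functional. The hypotheses [dV],
    [dX], [dY] and [dQ] go the other way and express definiteness and, for the pressure, the
    consequence of the inf-sup condition. *)
Hypotheses (nf : forall U, sV U -> nV U -> f U = 0)
  (naV : forall v U, sV v -> sV U -> nV U -> aV v U = 0)
  (nbQr : forall s U, sQ s -> sV U -> nV U -> bQ s U = 0)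
  (nbQl : forall s U, sQ s -> sV U -> nQ s -> bQ s U = 0)
  (nX' : forall T, sX T -> nX T -> [/\ g T = 0, w1 T = 0,
     forall F, sX F -> mX F T = 0 & forall F, sX F -> aX F T = 0])
  (nY' : forall T, sY T -> nY T -> [/\ h T = 0, j1 T = 0,
     forall F, sY F -> mY F T = 0 & forall F, sY F -> aY F T = 0 /\ bY F T = 0]).
Hypotheses (dV : forall v, sV v -> aV v v = 0 -> nV v)
  (dX : forall F, sX F -> mX F F = 0 -> nX F)
  (dY : forall p, sY p -> mY p p = 0 -> nY p)
  (dQ : forall s, sQ s -> (forall U, sV U -> bQ s U = 0) -> nQ s).

Let E : lmodType R := ((V * Q) * (X * X) * ((Y * Y) * R^o))%type.
Let uv (u : E) : V := u.1.1.1.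
Let us (u : E) : Q := u.1.1.2.
Let uF (u : E) : X := u.1.2.1.
Let uM (u : E) : X := u.1.2.2.
Let up (u : E) : Y := u.2.1.1.
Let um (u : E) : Y := u.2.1.2.
Let ub (u : E) : R := u.2.2.

Let fstL (E1 E2 : lmodType R) a (u w : E1 * E2) : (a *: u + w).1 = a *: u.1 + w.1.
Proof. by []. Qed.
Let sndL (E1 E2 : lmodType R) a (u w : E1 * E2) : (a *: u + w).2 = a *: u.2 + w.2.
Proof. by []. Qed.
Let uvL a u w : uv (a *: u + w) = a *: uv u + uv w. Proof. by rewrite /uv !fstL. Qed.
Let usL a u w : us (a *: u + w) = a *: us u + us w.
Proof. by rewrite /us !fstL sndL. Qed.
Let uFL a u w : uF (a *: u + w) = a *: uF u + uF w.
Proof. by rewrite /uF !(fstL, sndL). Qed.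
Let uML a u w : uM (a *: u + w) = a *: uM u + uM w.
Proof. by rewrite /uM fstL !sndL. Qed.
Let upL a u w : up (a *: u + w) = a *: up u + up w.
Proof. by rewrite /up sndL !fstL. Qed.
Let umL a u w : um (a *: u + w) = a *: um u + um w.
Proof. by rewrite /um !(fstL, sndL). Qed.
Let ubL a u w : ub (a *: u + w) = a * ub u + ub w.
Proof. by rewrite /ub !sndL. Qed.
Let uL := (uvL, usL, uFL, uML, upL, umL, ubL).

Definition unknown_set (P1 : V -> Prop) (P2 : Q -> Prop) (P3 : X -> Prop)
    (P4 : Y -> Prop) (P5 : R -> Prop) (u : V * Q * (X * X) * (Y * Y * R)) :=
  [/\ P1 u.1.1.1, P2 u.1.1.2, P3 u.1.2.1 /\ P3 u.1.2.2,
      P4 u.2.1.1 /\ P4 u.2.1.2 & P5 u.2.2].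

Let S := unknown_set sV sQ sX sY (fun=> True) : E -> Prop.
Let N := unknown_set nV nQ nX nY (fun b => b = 0) : E -> Prop.

Let SP u : S u <-> [/\ sV (uv u), sQ (us u), sX (uF u) /\ sX (uM u) & sY (up u) /\ sY (um u)].
Proof. by split=> [[]|[]]; split. Qed.

Let hS : linear_set S.
Proof.
split; first by split; [case: hV|case: hQ|case: hX|case: hY|].
move=> a u w /SP[v1 q1 [x1 y1] [z1 t1]] /SP[v2 q2 [x2 y2] [z2 t2]]; apply/SP.
have [_ LV] := hV; have [_ LQ] := hQ; have [_ LX] := hX; have [_ LY] := hY.
by rewrite !uL; split; [exact: LV|exact: LQ|split; exact: LX|split; exact: LY].
Qed.

(** All seven equations in one form: each component of [t] tests one equation, and [L] collects the
    terms free of unknowns. *)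
Let A (u t : E) : R :=
  (nu * aV (uv u) (uv t) - bQ (us u) (uv t) - ub u / J * f (uv t))
  + bQ (us t) (uv u)
  + (mX (uF u) (uF t) + dt * (ub u / J) * g (uF t) + dt * gam * mX (uM u) (uF t))
  + (mX (uM u) (uM t) - ub u / J * w1 (uM t) - lam * aX (uF u) (uM t))
  + (mY (up u) (up t) + dt * (ub u / J) * h (up t) + dt * bY (um u) (up t))
  + (mY (um u) (um t) - aY (up u) (um t) - ub u / J * j1 (um t))
  + ub t * (ub u - (2 * J)^-1 * (j1 (up u) + w1 (uF u)
              + dt * g (uM u) - dt * f (uv u) + dt * h (um u))).

Let L (F0 : X) (phi0 : Y) (beta0 : R) (t : E) : R :=
  mX F0 (uF t) + mY phi0 (up t)
  + ub t * (beta0 - (2 * J)^-1 * (j1 phi0 + w1 F0)).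

Let system_of (F0 : X) (phi0 : Y) (beta0 : R) (u : E) :=
  unknown_system F0 phi0 beta0 (uv u) (us u) (uF u) (uM u) (up u) (um u) (ub u).

Let psdl (E' : lmodType R) (S' : E' -> Prop) B : sym_psd S' B ->
  forall a u w t, S' u -> S' w -> S' t -> B (a *: u + w) t = a * B u t + B w t.
Proof. by move=> [lB _ _] a u w t Su Sw St; rewrite (lB _ St). Qed.

Let psdr (E' : lmodType R) (S' : E' -> Prop) B : linear_set S' -> sym_psd S' B ->
  forall a u w t, S' u -> S' w -> S' t -> B t (a *: u + w) = a * B t u + B t w.
Proof. by move=> hS' pB a u w t Su Sw St; apply: (sym_psd_linr pB). Qed.

Let bQl' a u w t : sQ u -> sQ w -> sV t -> bQ (a *: u + w) t = a * bQ u t + bQ w t.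
Proof. by move=> Su Sw St; rewrite (bQl St). Qed.

Let bQr' a u w t : sV u -> sV w -> sQ t -> bQ t (a *: u + w) = a * bQ t u + bQ t w.
Proof. by move=> Su Sw St; rewrite (bQr St). Qed.

Let lA1 t : S t -> lin_on S (A^~ t).
Proof.
move=> /SP[v0 q0 [x0 y0] [z0 t0]] a u w /SP[v1 q1 [x1 y1] [z1 t1]] /SP[v2 q2 [x2 y2] [z2 t2]].
rewrite /A !uL (psdl haV) // !(psdl hmX) // (psdl haX) // !(psdl hmY) // (psdl haY) //.
rewrite (psdl hbY) // bQl' // bQr' // lf // lg // lw // lh // lj //; ring.
Qed.

Let lA2 u : S u -> lin_on S (A u).
Proof.
move=> /SP[v0 q0 [x0 y0] [z0 t0]] a t w /SP[v1 q1 [x1 y1] [z1 t1]] /SP[v2 q2 [x2 y2] [z2 t2]].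
rewrite /A !uL (psdr hV haV) // !(psdr hX hmX) // (psdr hX haX) // !(psdr hY hmY) //.
rewrite (psdr hY haY) // (psdr hY hbY) // bQl' // bQr' // lf // lg // lw // lh // lj //.
by ring.
Qed.

Let lL F0 phi0 beta0 : sX F0 -> sY phi0 -> lin_on S (L F0 phi0 beta0).
Proof.
move=> SF Sp a u w /SP[v1 q1 [x1 y1] [z1 t1]] /SP[v2 q2 [x2 y2] [z2 t2]].
by rewrite /L !uL (psdr hX hmX) // (psdr hY hmY) //; ring.
Qed.

Let AN u t : S u -> S t -> N t -> A u t = 0.
Proof.
move=> /SP[v0 q0 [x0 y0] [z0 t0]] /SP[v1 q1 [x1 y1] [z1 t1]].
move=> [n1 n2 [n3 n4] [n5 n6] n7].
have [g0 _ mx _] := nX' x1 n3; have [_ w0 mx' ax'] := nX' y1 n4.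
have [h0 _ my yy] := nY' z1 n5; have [_ j0 my' yy'] := nY' t1 n6.
have [_ by0] := yy _ t0; have [ay0 _] := yy' _ z0.
rewrite /A naV // nbQr // nf // nbQl // !mx // g0 mx' // w0 ax' // my // h0 by0.
rewrite my' // ay0 j0 [ub t]n7; ring.
Qed.

Let LN F0 phi0 beta0 t : sX F0 -> sY phi0 -> S t -> N t -> L F0 phi0 beta0 t = 0.
Proof.
move=> SF Sp /SP[v1 q1 [x1 y1] [z1 t1]] [n1 n2 [n3 n4] [n5 n6] n7].
have [_ _ mx _] := nX' x1 n3; have [_ _ my _] := nY' z1 n5.
by rewrite /L mx // my // [ub t]n7; ring.
Qed.

Let systemP F0 phi0 beta0 u : sX F0 -> sY phi0 -> S u ->
  system_of F0 phi0 beta0 u <-> (forall t, S t -> A u t = L F0 phi0 beta0 t).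
Proof.
move=> SF0 Sp0 /SP[Sv Ss [SF SM] [Sp Sm]].
have eX T : sX T -> mX (uF u - F0) T = mX (uF u) T - mX F0 T.
  move=> ST; have [lB _ _] := hmX; exact: (lin_onB (lB _ ST)).
have eY T : sY T -> mY (up u - phi0) T = mY (up u) T - mY phi0 T.
  move=> ST; have [lB _ _] := hmY; exact: (lin_onB (lB _ ST)).
have ej : j1 (up u - phi0) = j1 (up u) - j1 phi0 by exact: (lin_onB lj).
have ew : w1 (uF u - F0) = w1 (uF u) - w1 F0 by exact: (lin_onB lw).
split=> [[ev es eF eM ep em eb] t /SP[Tv Ts [TF TM] [Tp Tm]]|hA].
  have := ev _ Tv; have := es _ Ts; have := eF _ TF; have := eM _ TM.
  have := ep _ Tp; have := em _ Tm; move: eb.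
  rewrite /A /L eX // eY // ej ew => eb e6 e5 e4 e3 e2 e1.
  rewrite e2 e6 e4.
  have -> : nu * aV (uv u) (uv t) = ub u / J * f (uv t) + bQ (us u) (uv t).
    by rewrite -e1 subrK.
  have -> : mX (uF u) (uF t) = mX F0 (uF t) - (dt * (ub u / J) * g (uF t)
      + dt * gam * mX (uM u) (uF t)).
    by apply/eqP; rewrite -subr_eq0 -e3; apply/eqP; ring.
  have -> : mY (up u) (up t) = mY phi0 (up t) - (dt * (ub u / J) * h (up t)
      + dt * bY (um u) (up t)).
    by apply/eqP; rewrite -subr_eq0 -e5; apply/eqP; ring.
  rewrite (_ : ub t * _ = ub t * ((ub u - beta0) + beta0 - (2 * J)^-1 *
    (j1 (up u) + w1 (uF u) + dt * g (uM u) - dt * f (uv u) + dt * h (um u)))); last by rewrite subrK.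
  by rewrite eb; ring.
have V0 : sV 0 by case: hV. have Q0 : sQ 0 by case: hQ.
have X0 : sX 0 by case: hX. have Y0 : sY 0 by case: hY.
have z1 := lin_on0 V0 lf; have z2 := lin_on0 X0 lg; have z3 := lin_on0 X0 lw.
have z4 := lin_on0 Y0 lh; have z5 := lin_on0 Y0 lj.
have zr (E' : lmodType R) (S' : E' -> Prop) B : linear_set S' -> sym_psd S' B ->
    forall x, S' x -> B x 0 = 0.
  by move=> hS' pB x Sx; apply: (lin_on0 (proj1 hS')); exact: (sym_psd_linr pB).
have zb1 : bQ 0 (uv u) = 0 by exact: (lin_on0 Q0 (bQl Sv)).
have zb2 : bQ (us u) 0 = 0 by exact: (lin_on0 V0 (bQr Ss)).
have zV := zr _ _ _ hV haV; have zX := zr _ _ _ hX hmX; have zX' := zr _ _ _ hX haX.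
have zY := zr _ _ _ hY hmY; have zY' := zr _ _ _ hY haY; have zY2 := zr _ _ _ hY hbY.
(* Test elements with a single nonzero component give back the individual equations. *)
have test v s F M p m b : sV v -> sQ s -> sX F -> sX M -> sY p -> sY m ->
    A u (v, s, (F, M), (p, m, b)) = L F0 phi0 beta0 (v, s, (F, M), (p, m, b)).
  by move=> *; apply: hA.
rewrite /A /L /uv /us /uF /uM /up /um /ub /= -/(uv u) -/(us u) -/(uF u) -/(uM u)
  -/(up u) -/(um u) -/(ub u) in test.
split.
- move=> U SU; have := test U 0 0 0 0 0 0 SU Q0 X0 X0 Y0 Y0.
  by rewrite z2 z3 z4 z5 zb1 !zX // !zX' // !zY // !zY' // zY2 //; lra.
- move=> P SP'; have := test 0 P 0 0 0 0 0 V0 SP' X0 X0 Y0 Y0.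
  by rewrite z1 z2 z3 z4 z5 zb2 zV // !zX // !zX' // !zY // !zY' // zY2 //; lra.
- move=> T ST; have := test 0 0 T 0 0 0 0 V0 Q0 ST X0 Y0 Y0.
  by rewrite eX // z1 z3 z4 z5 zb1 zb2 zV // !(zX _ SM) !zX' // !zY // !zY' // zY2 //; lra.
- move=> T ST; have := test 0 0 0 T 0 0 0 V0 Q0 X0 ST Y0 Y0.
  by rewrite z1 z2 z4 z5 zb1 zb2 zV // (zX _ SF) (zX _ SF0) (zX _ SM) !zY // !zY' // zY2 //; lra.
- move=> T ST; have := test 0 0 0 0 T 0 0 V0 Q0 X0 X0 ST Y0.
  by rewrite eY // z1 z2 z3 z5 zb1 zb2 zV // !zX // !zX' // !(zY _ Sm) !zY' //; lra.
- move=> T ST; have := test 0 0 0 0 0 T 0 V0 Q0 X0 X0 Y0 ST.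
  by rewrite z1 z2 z3 z4 zb1 zb2 zV // !zX // !zX' // (zY _ Sp) (zY _ Sp0) zY2 //; lra.
- have := test 0 0 0 0 0 0 1 V0 Q0 X0 X0 Y0 Y0.
  rewrite z1 z2 z3 z4 z5 zb1 zb2 zV // !zX // !zX' // !zY // !zY' // zY2 // ej ew.
  by move=> e; apply/eqP; rewrite -subr_eq0; apply/eqP; move: e; lra.
Qed.

(** With zero data the energy balance is a vanishing sum of nonnegative terms. This gives [ub u = 0]
    and settles [uv u] and [uM u] by definiteness. For [up u], [um u] and [uF u] only gradients are
    controlled; each of their equations is tested with the unknown itself, the coupling being
    removed by [sym_psd_eq0]. The momentum equation then yields the pressure. *)
Let inj u : S u -> (forall t, S t -> A u t = 0) -> N u.
Proof.
move=> Su hA; have X0 : sX 0 by case: hX.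
have Y0 : sY 0 by case: hY.
have [_ sys] := systemP 0 X0 Y0 Su.
have {}sys : system_of 0 0 0 u.
  apply: sys => t St; rewrite hA // /L; move/SP: St => [v1 q1 [x1 y1] [p1 t1]].
  have [/(_ _ x1) lB _ _] := hmX; have [/(_ _ p1) lB' _ _] := hmY.
  by rewrite (lin_on0 X0 lB) (lin_on0 Y0 lB') (lin_on0 Y0 lj) (lin_on0 X0 lw); ring.
move/SP: (Su) => [Sv Ss [SF SM] [Sp Sm]].
have := energy_balance X0 Y0 Sv Ss SF SM Sp Sm sys; rewrite !subr0.
have [ev es eF eM ep em eb] := sys; rewrite !subr0 in eF ep.
have [_ _ pV] := haV; have [_ _ pX] := hmX; have [_ _ pX'] := haX.
have [_ _ pY] := hmY; have [_ _ pY'] := haY; have [_ _ pY2] := hbY.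
have := pV _ Sv; have := pX _ SM; have := pX' _ SF; have := pY' _ Sp; have := pY2 _ Sm.
have := sqr_ge0 (ub u).
set b2 := ub u ^+ 2; set q1 := bY _ _; set q2 := aY _ _; set q3 := aX _ _.
set q4 := mX _ _; set q5 := aV _ _ => b20 q10 q20 q30 q40 q50.
have -> : 2 * ub u * ub u = 2 * b2 by rewrite /b2; ring.
have l3 : 0 <= lam * q3 by rewrite mulr_ge0 // ltW.
have l5 : 0 <= dt * nu * q5 by rewrite !mulr_ge0 // ltW.
have l4 : 0 <= dt * gam * q4 by rewrite !mulr_ge0 // ltW.
have l1 : 0 <= dt * q1 by rewrite mulr_ge0 // ltW.
move=> sum0.
have Eb : b2 = 0 by lra.
have E2 : q2 = 0 by lra.
have E3 : lam * q3 = 0 by lra.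
have E5 : dt * nu * q5 = 0 by lra.
have E4 : dt * gam * q4 = 0 by lra.
have E1 : dt * q1 = 0 by lra.
have b0 : ub u = 0 by move/eqP: Eb; rewrite sqrf_eq0 => /eqP.
have {}E1 : q1 = 0 by apply/eqP; move/eqP: E1; rewrite mulf_eq0 gt_eqF.
have {}E4 : q4 = 0.
  by apply/eqP; move/eqP: E4; rewrite !mulf_eq0 (gt_eqF dt0) (gt_eqF gam0).
have {}E5 : q5 = 0.
  by apply/eqP; move/eqP: E5; rewrite !mulf_eq0 (gt_eqF dt0) (gt_eqF nu0).
have Np : nY (up u).
  apply: dY => //; have := ep _ Sp; rewrite b0 mul0r mulr0 mul0r addr0.
  by rewrite (sym_psd_eq0 hY hbY Sm Sp E1) mulr0 addr0.
have Nm : nY (um u).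
  apply: dY => //; rewrite (em _ Sm) b0 !mul0r addr0.
  exact: (sym_psd_eq0 hY haY Sp Sm E2).
split=> //.
- exact: dV.
- apply: dQ => // U SU; have := ev _ SU.
  by rewrite b0 !mul0r (sym_psd_eq0 hV haV Sv SU E5); lra.
- split; last exact: dX.
  apply: dX => //; have := eF _ SF.
  by rewrite b0 mul0r mulr0 mul0r (sym_psd_eq0 hX hmX SM SF E4) mulr0 !addr0.
Qed.

Theorem unknown_system_solvable F0 phi0 beta0 : sX F0 -> sY phi0 ->
  finite_span (unknown_set sV sQ sX sY (fun=> True) : E -> Prop)
    (unknown_set nV nQ nX nY (fun b => b = 0)) ->
  exists v s F M phi mu beta,
    [/\ [/\ sV v, sQ s, sX F /\ sX M & sY phi /\ sY mu],
        unknown_system F0 phi0 beta0 v s F M phi mu beta &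
    forall v' s' F' M' phi' mu' beta', 
      [/\ sV v', sQ s', sX F' /\ sX M' & sY phi' /\ sY mu'] ->
      unknown_system F0 phi0 beta0 v' s' F' M' phi' mu' beta' ->
      [/\ nV (v - v'), nQ (s - s'), nX (F - F') /\ nX (M - M'),
          nY (phi - phi') /\ nY (mu - mu') & beta - beta' = 0]].
Proof.
move=> SF0 Sp0 fin.
have [u Su Au] := finite_solve hS fin lA1 lA2 (lL beta0 SF0 Sp0) AN
  (fun t => LN beta0 SF0 Sp0) inj.
exists (uv u), (us u), (uF u), (uM u), (up u), (um u), (ub u); split.
- exact/SP.
- exact: (systemP beta0 SF0 Sp0 Su).2.
move=> v' s' F' M' phi' mu' beta' hs' sys'.
pose u' : E := (v', s', (F', M'), (phi', mu', beta')).
have Su' : S u' by apply/SP.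
have Au' := (systemP beta0 SF0 Sp0 Su').1 sys'.
have : N (u - u').
  apply: inj; first exact: linear_setB.
  by move=> t St; rewrite (lin_onB (lA1 St)) // Au // Au' // subrr.
by case.
Qed.

End abstract_scheme.

(** * Finite element functions and forms *)

Section finite_elements.
Variables (R : realType) (Om : set 'rV[R]_3) (m : nat) (Th : 'I_m -> simplex R).
Hypotheses (oOm : open Om) (bOm : bounded_set Om).
Hypothesis cover : \bigcup_a elem (Th a) = closure Om.
Implicit Types (p q : 'rV[R]_3 -> R) (v : 'rV[R]_3 -> 'rV[R]_3)
  (F : 'rV[R]_3 -> 'M[R]_3).

Lemma is_poly_ev l K p : is_poly l K p -> exists P : P3 R, forall x, K x -> p x = ev P x.
Proof.
move=> [c hc].
exists (\sum_(i < l.+1) \sum_(j < l.+1) \sum_(k < l.+1 | (i + j + k <= l)%N)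
  (c i j k)%:P%:P%:P * 'X%:P%:P ^+ i * 'X%:P ^+ j * 'X ^+ k) => x /hc ->.
rewrite /ev rmorph_sum; apply: eq_bigr => i _; rewrite rmorph_sum; apply: eq_bigr => j _.
rewrite rmorph_sum; apply: eq_bigr => k _; rewrite !rmorphM !rmorphXn.
by rewrite -!/(ev _ x) evC ev_X0 ev_X1 ev_X2.
Qed.

(** The degree is forgotten, so that the components of all unknowns are handled by the same
    lemmas. *)
Definition FEf p := exists l, FE l Om Th p.
Definition FEv v := forall i, FEf (fun x => v x 0 i).
Definition FEm F := forall i j, FEf (fun x => F x i j).

Lemma FEf_pw p : FEf p -> {within closure Om, continuous p} /\
  exists P : 'I_m -> P3 R, forall x, closure Om x -> exists a, p x = ev (P a) x.
Proof.
move=> [l [cp pp]]; split=> //.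
have /choice[P hP] a := is_poly_ev (pp a).
by exists P => x; rewrite -cover => -[a _ ax]; exists a; apply: hP.
Qed.

Lemma FEf_BM p : FEf p -> BM Om p.
Proof. by case/FEf_pw => cp _; exact: within_BM. Qed.

Lemma FEf_pd_BM k p : FEf p -> BM Om (pd k p).
Proof. by case/FEf_pw => cp [P hP]; exact: (pw_pd_BM oOm bOm cp hP). Qed.

Lemma FEf_derivable p : FEf p ->
  aeO Om (fun x => forall k, derivable p x (delta_mx 0 k)).
Proof. by case/FEf_pw => cp [P hP]; exact: (pw_derivable oOm cp hP). Qed.

Lemma FEf_pd_lin a p q : FEf p -> FEf q -> aeO Om (fun x => forall k,
  pd k (fun y => a * p y + q y) x = a * pd k p x + pd k q x).
Proof.
move=> /FEf_derivable hp /FEf_derivable hq; apply: aeOS2 hp hq => x _ hp hq k.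
exact: pd_lin.
Qed.

Lemma FE_linear_set l : linear_set (FE l Om Th : ('rV[R]_3 -> R) -> Prop).
Proof.
split.
  split=> [|a]; first exact: cst_continuous.
  exists (fun _ _ _ => 0) => x _; rewrite big1 // => i _; rewrite big1 // => j _.
  by rewrite big1 // => k _; rewrite !mul0r.
move=> c p q [cp pp] [cq pq]; split=> [x|a].
  by apply: contD (cq x); apply: contM (cp x); exact: cst_continuous.
have [c1 h1] := pp a; have [c2 h2] := pq a.
exists (fun i j k => c * c1 i j k + c2 i j k) => x Kx.
rewrite [LHS](_ : _ = c * p x + q x) // h1 // h2 //.
rewrite big_distrr -big_split /=; apply: eq_bigr => i _.
rewrite big_distrr -big_split /=; apply: eq_bigr => j _.
rewrite big_distrr -big_split /=; apply: eq_bigr => k _; ring.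
Qed.

Lemma eq_BM p q : (forall x, p x = q x) -> BM Om p -> BM Om q.
Proof. by move=> /funext ->. Qed.

Definition BMv v := forall i, BM Om (fun x => v x 0 i).
Definition BMm F := forall i j, BM Om (fun x => F x i j).

Lemma FEv_BM v : FEv v -> BMv v. Proof. by move=> h i; exact: FEf_BM. Qed.
Lemma FEm_BM F : FEm F -> BMm F. Proof. by move=> h i j; exact: FEf_BM. Qed.

Lemma BM_dot u v : BMv u -> BMv v -> BM Om (fun x => dot (u x) (v x)).
Proof. by move=> hu hv; apply: BM_sum => k; apply: BMM. Qed.

Lemma BM_frob F G : BMm F -> BMm G -> BM Om (fun x => frob (F x) (G x)).
Proof. by move=> hF hG; apply: BM_sum => i; apply: BM_sum => j; apply: BMM. Qed.

Lemma BMm_mul F G : BMm F -> BMm G -> BMm (fun x => F x *m G x).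
Proof.
move=> hF hG i j; apply: (@eq_BM (fun x => \sum_k F x i k * G x k j)).
  by move=> x; rewrite mxE.
by apply: BM_sum => k; apply: BMM.
Qed.

Lemma BMm_tr F : BMm F -> BMm (fun x => (F x)^T).
Proof. by move=> hF i j; apply: eq_BM (hF j i) => x; rewrite mxE. Qed.

Lemma BMv_grad p : FEf p -> BMv (grad p).
Proof. by move=> hp i; apply: eq_BM (FEf_pd_BM i hp) => x; rewrite mxE. Qed.

Lemma BMm_vgrad v : FEv v -> BMm (vgrad v).
Proof. by move=> hv i j; apply: eq_BM (FEf_pd_BM j (hv i)) => x; rewrite mxE. Qed.

Lemma BM_div v : FEv v -> BM Om (div v).
Proof. by move=> hv; apply: BM_sum => i; exact: FEf_pd_BM (hv i). Qed.

Lemma BMm_mpd k F : FEm F -> BMm (mpd k F).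
Proof. by move=> hF i j; apply: eq_BM (FEf_pd_BM k (hF i j)) => x; rewrite mxE. Qed.

Lemma BM_mgrad_dot F G : FEm F -> FEm G -> BM Om (mgrad_dot F G).
Proof. by move=> hF hG; apply: BM_sum => k; apply: BM_frob; exact: BMm_mpd. Qed.

Lemma BMm_convect v F : BMv v -> FEm F -> BMm (convect v F).
Proof.
move=> hv hF i j; apply: (@eq_BM (fun x => \sum_k v x 0 k * mpd k F x i j)).
  by move=> x; rewrite /convect summxE; apply: eq_bigr => k _; rewrite [RHS]mxE.
by apply: BM_sum => k; apply: BMM; [exact: hv|exact: BMm_mpd].
Qed.

Lemma BMv_odot F G : FEm F -> BMm G -> BMv (odot F G).
Proof.
move=> hF hG k; apply: (@eq_BM (fun x => frob (mpd k F x) (G x))).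
  by move=> x; rewrite mxE.
by apply: BM_frob => //; exact: BMm_mpd.
Qed.

Lemma grad_lin a p q : FEf p -> FEf q -> aeO Om (fun x =>
  grad (a *: (p : _ -> R) + q) x = a *: grad p x + grad q x).
Proof.
move=> hp hq; apply: aeOS (FEf_pd_lin a hp hq) => x _ h.
by apply/rowP => k; rewrite !mxE; exact: h.
Qed.

Let vcomp a u v i : (fun y => (a *: (u : _ -> 'rV[R]_3) + v) y 0 i) =
  (fun y => a * u y 0 i + v y 0 i).
Proof. by apply/funext => y; rewrite !mxE. Qed.

Let mcomp a F G i j : (fun y => (a *: (F : _ -> 'M[R]_3) + G) y i j) =
  (fun y => a * F y i j + G y i j).
Proof. by apply/funext => y; rewrite !mxE. Qed.

Lemma vgrad_lin a u v : FEv u -> FEv v -> aeO Om (fun x =>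
  vgrad (a *: (u : _ -> 'rV[R]_3) + v) x = a *: vgrad u x + vgrad v x).
Proof.
move=> hu hv; have := aeO_fin (fun i => FEf_pd_lin a (hu i) (hv i)).
apply: aeOS => x _ h; apply/matrixP => i j; rewrite !mxE vcomp; exact: h.
Qed.

Lemma div_lin a u v : FEv u -> FEv v -> aeO Om (fun x =>
  div (a *: (u : _ -> 'rV[R]_3) + v) x = a * div u x + div v x).
Proof.
move=> hu hv; have := aeO_fin (fun i => FEf_pd_lin a (hu i) (hv i)).
apply: aeOS => x _ h; rewrite /div big_distrr -big_split /=.
by apply: eq_bigr => i _; rewrite vcomp; exact: h.
Qed.

Lemma mpd_lin a F G : FEm F -> FEm G -> aeO Om (fun x => forall k,
  mpd k (a *: (F : _ -> 'M[R]_3) + G) x = a *: mpd k F x + mpd k G x).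
Proof.
move=> hF hG.
have := aeO_fin (fun ij : 'I_3 * 'I_3 => FEf_pd_lin a (hF ij.1 ij.2) (hG ij.1 ij.2)).
apply: aeOS => x _ h k; apply/matrixP => i j; rewrite !mxE mcomp; exact: (h (i, j)).
Qed.

Lemma pd_zero p x k : (forall y, Om y -> p y = 0) -> Om x -> pd k p x = 0.
Proof.
move=> p0 Ox; transitivity ('D_(delta_mx 0 k) (cst 0 : 'rV[R]_3 -> R) x).
  by apply: near_eq_derive; apply: filterS (open_nbhs_nbhs (conj oOm Ox)) => y /p0.
exact: derive_cst.
Qed.

End finite_elements.

(** * Algebra of the dot and Frobenius products *)

Section tensors.
Variable R : realType.
Implicit Types (u v w : 'rV[R]_3) (A B C : 'M[R]_3).

Lemma dotC u v : dot u v = dot v u.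
Proof. by apply: eq_bigr => k _; rewrite mulrC. Qed.

Lemma dotDZl a u v w : dot (a *: u + v) w = a * dot u w + dot v w.
Proof.
rewrite /dot big_distrr -big_split /=; apply: eq_bigr => k _; rewrite !mxE; ring.
Qed.

Lemma dotDZr a u v w : dot w (a *: u + v) = a * dot w u + dot w v.
Proof. by rewrite dotC dotDZl !(dotC w). Qed.

Lemma dot0r u : dot u 0 = 0.
Proof. by rewrite /dot big1 // => k _; rewrite mxE mulr0. Qed.

Lemma dot_ge0 u : 0 <= dot u u.
Proof. by apply: sumr_ge0 => k _; rewrite -expr2 sqr_ge0. Qed.

Lemma frobC A B : frob A B = frob B A.
Proof. by apply: eq_bigr => i _; apply: eq_bigr => j _; rewrite mulrC. Qed.

Lemma frobDZl a A B C : frob (a *: A + B) C = a * frob A C + frob B C.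
Proof.
rewrite /frob big_distrr -big_split /=; apply: eq_bigr => i _.
by rewrite big_distrr -big_split /=; apply: eq_bigr => j _; rewrite !mxE; ring.
Qed.

Lemma frobDZr a A B C : frob C (a *: A + B) = a * frob C A + frob C B.
Proof. by rewrite frobC frobDZl !(frobC C). Qed.

Lemma frob0r A : frob A 0 = 0.
Proof. by rewrite /frob big1 // => i _; rewrite big1 // => j _; rewrite mxE mulr0. Qed.

Lemma frob_ge0 A : 0 <= frob A A.
Proof. by apply: sumr_ge0 => i _; apply: sumr_ge0 => j _; rewrite -expr2 sqr_ge0. Qed.

Lemma frob_eq0 A : frob A A = 0 -> A = 0.
Proof.
have h0 i : 0 <= \sum_j A i j * A i j.
  by apply: sumr_ge0 => j _; rewrite -expr2 sqr_ge0.
move/eqP; rewrite psumr_eq0 // => /allP h; apply/matrixP => i j; rewrite mxE.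
have /implyP/(_ isT) := h i (mem_index_enum _); rewrite psumr_eq0 => [/allP|k _].
  by move/(_ j (mem_index_enum _)); rewrite -expr2 sqrf_eq0 => /eqP.
by rewrite -expr2 sqr_ge0.
Qed.

End tensors.

(** * The forms of the scheme on the discrete spaces *)

Section scheme_forms.
Variables (R : realType) (Om : set 'rV[R]_3) (m : nat) (Th : 'I_m -> simplex R).
Hypotheses (oOm : open Om) (bOm : bounded_set Om) (Om0 : Om !=set0) (cO : connected Om).
Hypothesis cover : \bigcup_a elem (Th a) = closure Om.
Implicit Types (p q : 'rV[R]_3 -> R) (v U : 'rV[R]_3 -> 'rV[R]_3)
  (F G T : 'rV[R]_3 -> 'M[R]_3).

Definition vvint v U := intO Om (fun x => frob (vgrad v x) (vgrad U x)).
Definition divint p v := intO Om (fun x => p x * div v x).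
Definition mint F T := intO Om (fun x => frob (F x) (T x)).
Definition mgint F T := intO Om (mgrad_dot F T).
Definition sint p q := intO Om (fun x => p x * q x).
Definition sgint (c : 'rV[R]_3 -> R) p q :=
  intO Om (fun x => c x * dot (grad p x) (grad q x)).
Definition gint p q := intO Om (fun x => dot (grad p x) (grad q x)).

Lemma Vh_FE v : Vh Om Th v -> FEv Om Th v.
Proof. by move=> h i; exists 2%N; case: (h i). Qed.
Lemma Sh_FE p : Sh Om Th p -> FEf Om Th p. Proof. by exists 1%N. Qed.
Lemma Rh_FE p : Rh Om Th p -> FEf Om Th p. Proof. by case=> ? _; exists 1%N. Qed.
Lemma Xh_FE F : Xh Om Th F -> FEm Om Th F. Proof. by move=> h i j; exists 1%N. Qed.

Lemma Sh_linear_set : linear_set (Sh Om Th : ('rV[R]_3 -> R) -> Prop).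
Proof. exact: FE_linear_set. Qed.

Lemma Rh_linear_set : linear_set (Rh Om Th : ('rV[R]_3 -> R) -> Prop).
Proof.
have [S0 SL] := Sh_linear_set.
split; first by split; [exact: S0|exact: intO0].
move=> a p q [Sp ip] [Sq iq]; split; first exact: SL.
rewrite [LHS](@intO_lin _ _ oOm a p q) ?ip ?iq ?mulr0 ?addr0 //.
  by apply: BM_Ig => //; apply: (FEf_BM oOm bOm cover); exact: Sh_FE.
by apply: BM_Ig => //; apply: (FEf_BM oOm bOm cover); exact: Sh_FE.
Qed.

Lemma Xh_linear_set : linear_set (Xh Om Th : ('rV[R]_3 -> 'M[R]_3) -> Prop).
Proof.
have [S0 SL] := @FE_linear_set R Om m Th 1.
split=> [i j|a F G hF hG i j].
  by rewrite (_ : (fun x => _) = 0) //; apply/funext => x; rewrite !mxE.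
have := SL a _ _ (hF i j) (hG i j); congr (FE _ _ _ _).
by apply/funext => x; rewrite [RHS]mxE [X in _ = X + _]mxE.
Qed.

Lemma Vh_linear_set : linear_set (Vh Om Th : ('rV[R]_3 -> 'rV[R]_3) -> Prop).
Proof.
have [S0 SL] := @FE_linear_set R Om m Th 2; have [H0 HL] := H10_linear_set oOm bOm.
split=> [i|a v U hv hU i].
  by rewrite (_ : (fun x => _) = 0) //; apply/funext => x; rewrite !mxE.
rewrite (_ : (fun x => _) = a *: (fun x => v x 0 i) + (fun x => U x 0 i)); last first.
  by apply/funext => x; rewrite !mxE.
have [v1 v2] := hv i; have [U1 U2] := hU i.
by split; [exact: SL|exact: HL].
Qed.

(** Almost everywhere linearity of the integrand is what derivatives of discrete functions offer,
    since these need not be differentiable on element faces. *)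
Lemma lin_on_intO (E : lmodType R) (S : E -> Prop) (I : E -> 'rV[R]_3 -> R) :
  (forall u, S u -> BM Om (I u)) ->
  (forall a u w, S u -> S w -> aeO Om (fun x => I (a *: u + w) x = a * I u x + I w x)) ->
  lin_on S (fun u => intO Om (I u)).
Proof.
move=> hB hL a u w Su Sw; rewrite (intO_ext (hL a u w Su Sw)).
by rewrite intO_lin //; apply: BM_Ig => //; exact: hB.
Qed.

Let BMf p : FEf Om Th p -> BM Om p. Proof. exact: FEf_BM. Qed.
Let BMv' v : FEv Om Th v -> BMv Om v. Proof. exact: FEv_BM. Qed.
Let BMm' F : FEm Om Th F -> BMm Om F. Proof. exact: FEm_BM. Qed.
Let BMg p : FEf Om Th p -> BMv Om (grad p). Proof. exact: BMv_grad. Qed.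
Let BMvg v : FEv Om Th v -> BMm Om (vgrad v). Proof. exact: BMm_vgrad. Qed.

Lemma vvint_psd : sym_psd (Vh Om Th) vvint.
Proof.
split=> [U SU|v U _ _|v Sv].
- apply: (@lin_on_intO _ _ (fun v x => frob (vgrad v x) (vgrad U x))).
    by move=> v Sv; apply: BM_frob; apply: BMvg; exact: Vh_FE.
  move=> a v w Sv Sw; have := vgrad_lin oOm cover a (Vh_FE Sv) (Vh_FE Sw).
  by apply: aeOS => x _ ->; exact: frobDZl.
- by apply: eq_intO => x _; exact: frobC.
- by apply: intO_ge0; apply: aeO_all => x _; exact: frob_ge0.
Qed.

Lemma mint_psd : sym_psd (Xh Om Th) mint.
Proof.
split=> [U SU|v U _ _|v Sv].
- apply: (@lin_on_intO _ _ (fun (F : 'rV[R]_3 -> 'M[R]_3) x => frob (F x) (U x))).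
    by move=> v Sv; apply: BM_frob; apply: BMm'; exact: Xh_FE.
  by move=> a v w Sv Sw; apply: aeO_all => x _; exact: frobDZl.
- by apply: eq_intO => x _; exact: frobC.
- by apply: intO_ge0; apply: aeO_all => x _; exact: frob_ge0.
Qed.

Lemma mgint_psd : sym_psd (Xh Om Th) mgint.
Proof.
split=> [U SU|v U _ _|v Sv].
- apply: (@lin_on_intO _ _ (fun (F : 'rV[R]_3 -> 'M[R]_3) => mgrad_dot F U)).
    by move=> v Sv; apply: (BM_mgrad_dot oOm bOm cover); exact: Xh_FE.
  move=> a v w Sv Sw; have := mpd_lin oOm cover a (Xh_FE Sv) (Xh_FE Sw).
  apply: aeOS => x _ h; rewrite /mgrad_dot big_distrr -big_split /=.
  by apply: eq_bigr => k _; rewrite h frobDZl.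
- by apply: eq_intO => x _; apply: eq_bigr => k _; exact: frobC.
- by apply: intO_ge0; apply: aeO_all => x _; apply: sumr_ge0 => k _; exact: frob_ge0.
Qed.

Lemma sint_psd : sym_psd (Sh Om Th) sint.
Proof.
split=> [U SU|v U _ _|v Sv].
- apply: (@lin_on_intO _ _ (fun (F : 'rV[R]_3 -> R) x => F x * U x)).
    by move=> v Sv; apply: BMM; apply: BMf; exact: Sh_FE.
  by move=> a v w Sv Sw; apply: aeO_all => x _; rewrite mulrDl mulrA.
- by apply: eq_intO => x _; rewrite mulrC.
- by apply: intO_ge0; apply: aeO_all => x _; rewrite -expr2 sqr_ge0.
Qed.

Lemma sgint_psd c : BM Om c -> (forall x, 0 <= c x) -> sym_psd (Sh Om Th) (sgint c).
Proof.
move=> hc c0; split=> [U SU|v U _ _|v Sv].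
- apply: (@lin_on_intO _ _ (fun p x => c x * dot (grad p x) (grad U x))).
    by move=> v Sv; apply: BMM => //; apply: BM_dot; apply: BMg; exact: Sh_FE.
  move=> a v w Sv Sw; have := grad_lin oOm cover a (Sh_FE Sv) (Sh_FE Sw).
  by apply: aeOS => x _ ->; rewrite dotDZl; ring.
- by apply: eq_intO => x _; rewrite dotC.
- by apply: intO_ge0; apply: aeO_all => x _; rewrite mulr_ge0 ?dot_ge0.
Qed.

Lemma gint_psd : sym_psd (Sh Om Th) gint.
Proof.
have := sgint_psd (BM_cst Om 1) (fun=> ler01); congr sym_psd.
apply/funext => p; apply/funext => q.
by rewrite /sgint; apply: eq_intO => x _; rewrite mul1r.
Qed.

Lemma divint_linl v : Vh Om Th v -> lin_on (Rh Om Th) (divint^~ v).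
Proof.
move=> Sv; apply: (@lin_on_intO _ _ (fun (p : 'rV[R]_3 -> R) x => p x * div v x)).
  move=> p Sp; apply: BMM; first by apply: BMf; exact: Rh_FE.
  by apply: (BM_div oOm bOm cover); exact: Vh_FE.
by move=> a p q Sp Sq; apply: aeO_all => x _; rewrite mulrDl mulrA.
Qed.

Lemma divint_linr p : Rh Om Th p -> lin_on (Vh Om Th) (divint p).
Proof.
move=> Sp; apply: (@lin_on_intO _ _ (fun v x => p x * div v x)).
  move=> v Sv; apply: BMM; first by apply: BMf; exact: Rh_FE.
  by apply: (BM_div oOm bOm cover); exact: Vh_FE.
move=> a v w Sv Sw; have := div_lin oOm cover a (Vh_FE Sv) (Vh_FE Sw).
by apply: aeOS => x _ ->; ring.
Qed.

Lemma dotint_lin (c : 'rV[R]_3 -> 'rV[R]_3) : BMv Om c ->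
  lin_on (Vh Om Th) (fun U => intO Om (fun x => dot (c x) (U x))).
Proof.
move=> hc; apply: (@lin_on_intO _ _ (fun (U : 'rV[R]_3 -> 'rV[R]_3) x => dot (c x) (U x))).
  by move=> v Sv; apply: BM_dot => //; apply: BMv'; exact: Vh_FE.
by move=> a v w Sv Sw; apply: aeO_all => x _; exact: dotDZr.
Qed.

Lemma vgradint_lin C : BMm Om C ->
  lin_on (Vh Om Th) (fun U => intO Om (fun x => frob (C x) (vgrad U x))).
Proof.
move=> hC; apply: (@lin_on_intO _ _ (fun U x => frob (C x) (vgrad U x))).
  by move=> v Sv; apply: BM_frob => //; apply: BMvg; exact: Vh_FE.
move=> a v w Sv Sw; have := vgrad_lin oOm cover a (Vh_FE Sv) (Vh_FE Sw).
by apply: aeOS => x _ ->; exact: frobDZr.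
Qed.

Lemma frobint_lin C : BMm Om C ->
  lin_on (Xh Om Th) (fun T => intO Om (fun x => frob (C x) (T x))).
Proof.
move=> hC; apply: (@lin_on_intO _ _ (fun (T : 'rV[R]_3 -> 'M[R]_3) x => frob (C x) (T x))).
  by move=> v Sv; apply: BM_frob => //; apply: BMm'; exact: Xh_FE.
by move=> a v w Sv Sw; apply: aeO_all => x _; exact: frobDZr.
Qed.

Lemma mulint_lin c : BM Om c ->
  lin_on (Sh Om Th) (fun q => intO Om (fun x => c x * q x)).
Proof.
move=> hc; apply: (@lin_on_intO _ _ (fun (q : 'rV[R]_3 -> R) x => c x * q x)).
  by move=> v Sv; apply: BMM => //; apply: BMf; exact: Sh_FE.
by move=> a v w Sv Sw; apply: aeO_all => x _; rewrite [LHS]mulrDr mulrCA.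
Qed.

Section null.
Variable W : zmodType.
(** Discrete functions with null difference are those identified by [state_eq]. *)
Definition null_on (u : 'rV[R]_3 -> W) := forall x, closure Om x -> u x = 0.
End null.

Let nullO (W : zmodType) (u : 'rV[R]_3 -> W) x : null_on u -> Om x -> u x = 0.
Proof. by move=> h Ox; apply: h; exact: subset_closure. Qed.

Lemma int_null p : (forall x, Om x -> p x = 0) -> intO Om p = 0.
Proof. by move=> h; rewrite (eq_intO h) intO0. Qed.

Lemma grad_null p x : null_on p -> Om x -> grad p x = 0.
Proof.
by move=> h Ox; apply/rowP => k; rewrite !mxE; apply: (pd_zero oOm) => // y /nullO ->.
Qed.

Lemma vgrad_null v x : null_on v -> Om x -> vgrad v x = 0.
Proof.
move=> h Ox; apply/matrixP => i k; rewrite !mxE; apply: (pd_zero oOm) => // y /nullO -> //.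
by rewrite mxE.
Qed.

Lemma div_null v x : null_on v -> Om x -> div v x = 0.
Proof.
move=> h Ox; apply: big1 => i _; apply: (pd_zero oOm) => // y /nullO -> //.
by rewrite mxE.
Qed.

Lemma mpd_null F x k : null_on F -> Om x -> mpd k F x = 0.
Proof.
move=> h Ox; apply/matrixP => i j; rewrite !mxE; apply: (pd_zero oOm) => // y /nullO -> //.
by rewrite mxE.
Qed.

Lemma mint_null F T : null_on T -> mint F T = 0.
Proof. by move=> h; apply: int_null => x Ox; rewrite [T x]nullO ?frob0r. Qed.

Lemma sint_null p q : null_on q -> sint p q = 0.
Proof. by move=> h; apply: int_null => x Ox; rewrite [q x]nullO ?mulr0. Qed.

Lemma vvint_null v U : null_on U -> vvint v U = 0.
Proof. by move=> h; apply: int_null => x Ox; rewrite [vgrad U x]vgrad_null ?frob0r. Qed.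

Lemma mgint_null F T : null_on T -> mgint F T = 0.
Proof.
by move=> h; apply: int_null => x Ox; apply: big1 => k _; rewrite [mpd k T x]mpd_null ?frob0r.
Qed.

Lemma sgint_null c p q : null_on q -> sgint c p q = 0.
Proof. by move=> h; apply: int_null => x Ox; rewrite [grad q x]grad_null ?dot0r ?mulr0. Qed.

Lemma gint_null p q : null_on q -> gint p q = 0.
Proof. by move=> h; apply: int_null => x Ox; rewrite [grad q x]grad_null ?dot0r. Qed.

Lemma divint_nulll p v : null_on p -> divint p v = 0.
Proof. by move=> h; apply: int_null => x Ox; rewrite nullO ?mul0r. Qed.

Lemma divint_nullr p v : null_on v -> divint p v = 0.
Proof. by move=> h; apply: int_null => x Ox; rewrite div_null ?mulr0. Qed.

Lemma FEf_null p : FEf Om Th p -> aeO Om (fun x => p x = 0) -> null_on p.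
Proof. by move=> /(FEf_pw cover)[cp _] p0; exact: (closure_ext oOm cp p0). Qed.

Let IgBM p : BM Om p -> Ig Om p. Proof. exact: BM_Ig. Qed.

Lemma sint_definite p : Sh Om Th p -> sint p p = 0 -> null_on p.
Proof.
move=> /Sh_FE Sp p0; apply: FEf_null => //.
have Bp := BMf Sp; have := intO_eq0 oOm (IgBM (BMM Bp Bp)).
move=> /(_ (aeO_all _) p0) h; apply: aeOS (h _) => x _.
  by move/eqP; rewrite -expr2 sqrf_eq0 => /eqP.
by rewrite -expr2 sqr_ge0.
Qed.

Lemma mint_definite F : Xh Om Th F -> mint F F = 0 -> null_on F.
Proof.
move=> SF F0; have BF := BMm' (Xh_FE SF).
have F0' := intO_eq0 oOm (IgBM (BM_frob BF BF)) (aeO_all (fun x _ => frob_ge0 (F x))) F0.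
move=> x cx; apply/matrixP => i j; rewrite mxE.
apply: (FEf_null (Xh_FE SF i j)) cx; apply: aeOS F0' => y _ /frob_eq0 ->.
by rewrite mxE.
Qed.

(** Each component has zero gradient almost everywhere, so it is constant by [pw_rigid], and
    [H10_cst] makes the constant zero. *)
Lemma vvint_definite v : Vh Om Th v -> vvint v v = 0 -> null_on v.
Proof.
move=> Sv v0; have Bv := BMvg (Vh_FE Sv).
have v0' := intO_eq0 oOm (IgBM (BM_frob Bv Bv)) (aeO_all (fun x _ => frob_ge0 (vgrad v x))) v0.
move=> x cx; apply/rowP => i; rewrite mxE.
have [cv [P hP]] := FEf_pw cover (Vh_FE Sv i).
have [c hc] : exists c, forall x, closure Om x -> v x 0 i = c.
  apply: (pw_rigid oOm cv hP Om0 cO); apply: aeOS v0' => y _ /frob_eq0 h k.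
  by move/matrixP: h => /(_ i k); rewrite !mxE.
rewrite hc //; apply: (H10_cst oOm bOm Om0 _ (proj2 (Sv i))) => y Oy.
by apply: hc; exact: subset_closure.
Qed.

Lemma divint_definite kappa p : 0 < kappa -> LBB Om kappa Th -> Rh Om Th p ->
  (forall v, Vh Om Th v -> divint p v = 0) -> null_on p.
Proof.
move=> k0 lbb Sp hp; apply: sint_definite; first by case: Sp.
have := lbb p Sp; rewrite /=; set A := (X in sup X) => h.
(* All quotients vanish, so [A] is [[set 0]], or empty if no velocity has nonzero norm; the supremum
   of the empty set is [0] by convention. *)
have A0 : sup A = 0.
  have [[r Ar]|nA] := pselect (A !=set0); last first.
    by rewrite (_ : A = set0) ?sup0 //; apply/seteqP; split=> // r Ar; apply: nA; exists r.
  rewrite (_ : A = [set 0]) ?sup1 //; apply/seteqP; split=> [s [v [Sv _ ->]]|s ->] /=.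
    by rewrite [X in X / _](hp v Sv) mul0r.
  by have [v [Sv nv rE]] := Ar; exists v; split=> //; rewrite [X in X / _](hp v Sv) mul0r.
have {h} p0 : Num.sqrt (intO Om (fun x => p x ^+ 2)) <= 0.
  by rewrite -(pmulr_rle0 _ k0); move: h; rewrite A0.
have {p0} p0 : intO Om (fun x => p x ^+ 2) <= 0.
  by move: p0; rewrite -[X in _ <= X]sqrtr0 ler_sqrt.
have [_ _ pos] := sint_psd.
apply/eqP; rewrite eq_le (pos p (proj1 Sp)) andbT; apply: le_trans p0.
by rewrite le_eqVlt; apply/orP; left; apply/eqP; apply: eq_intO => x _; rewrite expr2.
Qed.

End scheme_forms.

(** * The scheme *)

Section coefficients.
Variables (R : realType) (w : R -> 'M[R]_3 -> R).
Hypothesis cw : C1 (fun z : R * 'M[R]_3 => w z.1 z.2).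

(** Partial derivatives are rewritten as directional derivatives on the product space, whose joint
    continuity [C1] provides. *)
Lemma d_TE r T i j :
  d_T w r T i j = 'D_((0 : R), delta_mx i j) (fun z : R * 'M[R]_3 => w z.1 z.2) (r, T).
Proof.
rewrite mxE /derive.
apply: (f_equal (fun g : R -> R => lim (g @ 0^'))); apply/funext => h /=.
by rewrite scaler0 add0r.
Qed.

Lemma d_rE r T :
  d_r w r T = 'D_((1 : R), (0 : 'M[R]_3)) (fun z : R * 'M[R]_3 => w z.1 z.2) (r, T).
Proof.
rewrite /d_r derive1E /derive.
apply: (f_equal (fun g : R -> R => lim (g @ 0^'))); apply/funext => h /=.
by rewrite scaler0 add0r.
Qed.

Lemma d_r_derivable (r : R) T : derivable (fun s => w s T) r 1.
Proof.
have := diff_derivable (v := ((1 : R), (0 : 'M[R]_3))) (cw.1 (r, T)).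
rewrite /derivable; set f := (X in cvg (X @ _) -> _); set g := (X in _ -> cvg (X @ _)).
rewrite (_ : f = g) //; apply/funext => h; rewrite /f /g /=.
by rewrite scaler0 add0r.
Qed.

Lemma d_r_jfun (psi : R -> R) (r : R) T : derivable psi r 1 ->
  d_r (jfun psi w) r T = derive1 psi r + d_r w r T.
Proof.
move=> hpsi; rewrite /d_r !derive1E; apply: deriveD => //; exact: d_r_derivable.
Qed.

Lemma mx_cvg (U : Type) (FF : set_system U) (F : U -> 'M[R]_3) (B : 'M[R]_3) :
  Filter FF -> (forall i j, F x i j @[x --> FF] --> B i j) -> F @ FF --> B.
Proof.
move=> fFF h P [Q nQ QP]; rewrite /= /nbhs /=.
have : FF (fun x => forall ij : 'I_3 * 'I_3, Q ij.1 ij.2 (F x ij.1 ij.2)).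
  by apply: near_fin => -[i j]; apply: h; exact: nQ.
by apply: filterS => x hx; apply: QP => i j; exact: (hx (i, j)).
Qed.

Variable (A : set 'rV[R]_3).

Lemma within_mx (F : 'rV[R]_3 -> 'M[R]_3) :
  (forall i j, {within A, continuous (fun x => F x i j)}) -> {within A, continuous F}.
Proof. by move=> h x; apply: mx_cvg => i j; exact: h. Qed.

Lemma within_coef (W : R * 'M[R]_3 -> R) (f : 'rV[R]_3 -> R) (F : 'rV[R]_3 -> 'M[R]_3) :
  continuous W -> {within A, continuous f} -> {within A, continuous F} ->
  {within A, continuous (fun x => W (f x, F x))}.
Proof.
move=> cW cf cF x; apply: (@continuous2_cvg _ _ _ _ _ _ f F (fun a b => W (a, b))).
- rewrite (_ : (fun z => _) = W); first exact: cW.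
  by apply/funext => -[].
- exact: cf.
- exact: cF.
Qed.

End coefficients.

(** * Finite dimension of the space of unknowns *)

Section monomials.
Variables (R : realType) (K : set 'rV[R]_3).
Implicit Types p : 'rV[R]_3 -> R.

(** Exponents up to 2 in each variable cover total degree 2, the degree of the velocities. *)
Definition mono (q : 'I_3 * 'I_3 * 'I_3) (x : 'rV[R]_3) :=
  x 0 0 ^+ q.1.1 * x 0 1 ^+ q.1.2 * x 0 2 ^+ q.2.

Definition mono_span p := exists c, forall x, K x -> p x = \sum_q c q * mono q x.

Lemma mono_span_sum (I : finType) (P : pred I) (F : I -> 'rV[R]_3 -> R) :
  (forall i, P i -> mono_span (F i)) -> mono_span (fun x => \sum_(i | P i) F i x).
Proof.
move=> h; have /choice[c hc] i : exists c, P i -> forall x, K x ->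
    F i x = \sum_q c q * mono q x.
  by case: (boolP (P i)) => [/h[c hc]|_]; [exists c|exists (fun=> 0)].
exists (fun q => \sum_(i | P i) c i q) => x Kx.
rewrite (eq_bigr _ (fun i Pi => hc i Pi x Kx)) exchange_big /=.
by apply: eq_bigr => q _; rewrite big_distrl.
Qed.

Lemma mono_span_mono a i j k : (i < 3)%N -> (j < 3)%N -> (k < 3)%N ->
  mono_span (fun x => a * x 0 0 ^+ i * x 0 1 ^+ j * x 0 2 ^+ k).
Proof.
move=> i3 j3 k3; pose q0 := (Ordinal i3, Ordinal j3, Ordinal k3).
exists (fun q => if q == q0 then a else 0) => x _.
rewrite (bigD1 q0) //= eqxx big1 ?addr0 => [|q /negPf ->]; last by rewrite mul0r.
by rewrite /mono /= !mulrA.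
Qed.

Lemma is_poly_mono_span l p : (l <= 2)%N -> is_poly l K p -> mono_span p.
Proof.
move=> l2 [c hc]; have lt3 (i : 'I_l.+1) : (i < 3)%N by exact: leq_trans (ltn_ord i) _.
have [d hd] : mono_span (fun x => \sum_(i < l.+1) \sum_(j < l.+1)
    \sum_(k < l.+1 | (i + j + k <= l)%N) c i j k * x 0 0 ^+ i * x 0 1 ^+ j * x 0 2 ^+ k).
  apply: mono_span_sum => i _; apply: mono_span_sum => j _; apply: mono_span_sum => k _.
  exact: mono_span_mono.
by exists d => x Kx; rewrite hc // hd.
Qed.

End monomials.

Section unknowns.
Variables (R : realType) (Om : set 'rV[R]_3) (m : nat) (Th : 'I_m -> simplex R).
Hypotheses (oOm : open Om) (bOm : bounded_set Om) (Om0 : Om !=set0).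
Hypothesis cover : \bigcup_a elem (Th a) = closure Om.

Let V : lmodType R := 'rV[R]_3 -> 'rV[R]_3.
Let Q : lmodType R := 'rV[R]_3 -> R.
Let X : lmodType R := 'rV[R]_3 -> 'M[R]_3.
Let E : lmodType R := ((V * Q) * (X * X) * ((Q * Q) * R^o))%type.
Let K := ('I_3 + 'I_3 * 'I_3 + 'I_3 * 'I_3 + bool * bool)%type.

(** The unknowns are flattened into scalar functions, with the auxiliary variable regarded as a
    constant one, so that one coefficient vector per component and element represents them all. *)
Let cp (kap : K) (u : E) (x : 'rV[R]_3) : R :=
  match kap with
  | inl (inl (inl i)) => (u.1.1.1 : 'rV[R]_3 -> 'rV[R]_3) x 0 i
  | inl (inl (inr ij)) => (u.1.2.1 : 'rV[R]_3 -> 'M[R]_3) x ij.1 ij.2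
  | inl (inr ij) => (u.1.2.2 : 'rV[R]_3 -> 'M[R]_3) x ij.1 ij.2
  | inr (true, true) => (u.1.1.2 : 'rV[R]_3 -> R) x
  | inr (true, false) => (u.2.1.1 : 'rV[R]_3 -> R) x
  | inr (false, true) => (u.2.1.2 : 'rV[R]_3 -> R) x
  | inr (false, false) => u.2.2
  end.

Let cp_lin kap a u v x : cp kap (a *: u + v) x = a * cp kap u x + cp kap v x.
Proof.
case: kap => [[[i|ij]|ij]|[[] []]] //=; first by rewrite !mxE.
  by rewrite !mxE.
by rewrite !mxE.
Qed.

Lemma unknowns_finite_span :
  finite_span (unknown_set (Vh Om Th) (Rh Om Th) (Xh Om Th) (Sh Om Th) (fun=> True) : E -> Prop)
    (unknown_set (null_on Om (W := _)) (null_on Om (W := _)) (null_on Om (W := _))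
      (null_on Om (W := _)) (fun b => b = 0)).
Proof.
have lS : linear_set (unknown_set (Vh Om Th) (Rh Om Th) (Xh Om Th) (Sh Om Th)
    (fun=> True) : E -> Prop).
  have [v0 vl] := @Vh_linear_set R Om m Th oOm bOm.
  have [q0 ql] := @Rh_linear_set R Om m Th oOm bOm cover.
  have [x0 xl] := @Xh_linear_set R Om m Th; have [y0 yl] := @Sh_linear_set R Om m Th.
  split=> // a u v [u1 u2 [u3 u3'] [u4 u4'] _] [v1 v2 [v3 v3'] [v4 v4'] _].
  by split=> //=; [exact: vl|exact: ql|split; exact: xl|split; exact: yl].
pose C : vectType R := {ffun K * 'I_m * ('I_3 * 'I_3 * 'I_3) -> R^o}.
pose rep (u : E) (c : C) := forall kap a x, elem (Th a) x ->
  cp kap u x = \sum_q c (kap, a, q) * mono q x.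
apply: (@finite_span_rep _ _ _ _ lS C rep).
- move=> u [u1 [u2 _] [u3 u3'] [u4 u4'] _].
  have /choice[c hc] : forall ka : K * 'I_m, mono_span (elem (Th ka.2)) (cp ka.1 u).
    case=> -[[[i|[i j]]|[i j]]|[[] []]] a /=.
    + by apply: (@is_poly_mono_span _ _ 2) => //; case: (u1 i) => -[_].
    + by apply: (@is_poly_mono_span _ _ 1) => //; case: (u3 i j).
    + by apply: (@is_poly_mono_span _ _ 1) => //; case: (u3' i j).
    + by apply: (@is_poly_mono_span _ _ 1) => //; case: u2.
    + by apply: (@is_poly_mono_span _ _ 1) => //; case: u4.
    + by apply: (@is_poly_mono_span _ _ 1) => //; case: u4'.
    + have [d hd] := @mono_span_mono _ (elem (Th a)) u.2.2 0 0 0 isT isT isT.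
      by exists d => x ax; rewrite -hd // !expr0 !mulr1.
  exists [ffun t => c t.1 t.2] => kap a x ax.
  by rewrite (hc (kap, a) x ax); apply: eq_bigr => q _; rewrite ffunE.
- move=> a u v c d hu hv kap i x ix; rewrite cp_lin (hu kap i) // (hv kap i) //.
  rewrite big_distrr -big_split /=; apply: eq_bigr => q _.
  by rewrite !ffunE mulrDl mulrA.
move=> u hu; have z kap x : closure Om x -> cp kap u x = 0.
  rewrite -cover => -[a _ ax]; rewrite (hu kap a) // big1 // => q _.
  by rewrite ffunE mul0r.
split=> /=.
- by move=> x cx; apply/rowP => i; rewrite mxE; exact: (z (inl (inl (inl i)))).
- by move=> x cx; exact: (z (inr (true, true))).
- split=> x cx; apply/matrixP => i j; rewrite mxE.
    exact: (z (inl (inl (inr (i, j))))).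
  exact: (z (inl (inr (i, j)))).
- by split=> x cx; [exact: (z (inr (true, false)))|exact: (z (inr (false, true)))].
(* The auxiliary variable is read off at a point of [Om]. *)
have [x Ox] := Om0; exact: (z (inr (false, false)) x (subset_closure Ox)).
Qed.

End unknowns.

(** * One time step as an instance of the abstract system *)

Section scheme_step.
Variables (R : realType) (Om : set 'rV[R]_3) (m : nat) (Th : 'I_m -> simplex R).
Variables (nu gam lam k dt : R) (b psi : R -> R) (w : R -> 'M[R]_3 -> R) (o : state R).

Definition step_J := Num.sqrt (radicand Om k (jfun psi w) (phs o) (dfm o)).

Definition step_f (U : 'rV[R]_3 -> 'rV[R]_3) :=
  intO Om (fun x => chp o x * dot (grad (phs o) x) (U x))
  - intO Om (fun x => frob (str o x *m (dfm o x)^T) (vgrad U x))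
  + intO Om (fun x => dot (odot (dfm o) (str o) x) (U x)).

Definition step_g (T : 'rV[R]_3 -> 'M[R]_3) :=
  intO Om (fun x => frob (convect (vel o) (dfm o) x) (T x))
  - intO Om (fun x => frob (vgrad (vel o) x *m dfm o x) (T x)).

Definition step_w (T : 'rV[R]_3 -> 'M[R]_3) :=
  intO Om (fun x => frob (d_T w (phs o x) (dfm o x)) (T x)).

Definition step_h (p : 'rV[R]_3 -> R) :=
  intO Om (fun x => dot (vel o x) (grad (phs o) x) * p x).

Definition step_j (p : 'rV[R]_3 -> R) :=
  intO Om (fun x => d_r (jfun psi w) (phs o x) (dfm o x) * p x).

Definition step_system v s F M p mu beta :=
  unknown_system (Vh Om Th) (Rh Om Th) (Xh Om Th) (Sh Om Th) nu dt gam lam step_J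
    (vvint Om) (divint Om) (mint Om) (mgint Om) (sint Om) (gint Om)
    (sgint Om (fun x => b (phs o x))) step_f step_g step_w step_h step_j
    (dfm o) (phs o) (aux o) v s F M p mu beta.

(** The eight terms of the last equation regroup into the functionals that carry the factor beta/J
    in the other equations; this is the source of the cancellation in the energy balance. *)
Lemma schemeP u : scheme Om Th nu gam lam k dt b psi w o u <->
  step_system (vel u) (prs u) (dfm u) (str u) (phs u) (chp u) (aux u).
Proof.
have betaE : step_j (phs u - phs o) + step_w (dfm u - dfm o)
    + dt * step_g (str u) - dt * step_f (vel u) + dt * step_h (chp u) =
    intO Om (fun x => d_r (jfun psi w) (phs o x) (dfm o x) * (phs u x - phs o x))
    + intO Om (fun x => frob (d_T w (phs o x) (dfm o x)) (dfm u x - dfm o x))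
    + dt * intO Om (fun x => frob (convect (vel o) (dfm o) x) (str u x))
    - dt * intO Om (fun x => dot (odot (dfm o) (str o) x) (vel u x))
    - dt * intO Om (fun x => frob (vgrad (vel o) x *m dfm o x) (str u x))
    + dt * intO Om (fun x => frob (str o x *m (dfm o x)^T) (vgrad (vel u) x))
    + dt * intO Om (fun x => dot (vel o x) (grad (phs o) x) * chp u x)
    - dt * intO Om (fun x => chp o x * dot (grad (phs o) x) (vel u x)).
  rewrite /step_f /step_g /step_h.
  by rewrite -/(step_j (phs u - phs o)) -/(step_w (dfm u - dfm o)); ring.
split=> [[e1 e2 [e3 e4] [e5 e6] e7]|[e1 e2 e3 e4 e5 e6 e7]].
  by split=> //; rewrite betaE.
by rewrite betaE in e7; split.
Qed.

Hypotheses (oOm : open Om) (bOm : bounded_set Om).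
Hypothesis cover : \bigcup_a elem (Th a) = closure Om.
Hypotheses (nu0 : 0 < nu) (gam0 : 0 < gam) (lam0 : 0 < lam) (dt0 : 0 < dt).
Hypotheses (b0 : R) (b00 : 0 < b0) (bb0 : forall r, b0 <= b r) (cb : continuous b).
Hypotheses (J0 : 0 < step_J).
Hypotheses (So : Sh Om Th (phs o)) (Xo : Xh Om Th (dfm o)).

Let cphs : {within closure Om, continuous (phs o)}. Proof. by case: So. Qed.

Lemma step_b_BM : BM Om (fun x => b (phs o x)).
Proof. by apply: within_BM => // x; apply: continuous_comp; [exact: cphs|exact: cb]. Qed.

Lemma step_b_ge0 x : 0 <= b (phs o x).
Proof. exact: le_trans (ltW b00) (bb0 _). Qed.

Lemma step_energy u : in_spaces Om Th u -> scheme Om Th nu gam lam k dt b psi w o u ->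
  energy Om lam u +
  ((aux u - aux o) ^+ 2 + 2^-1 * gint Om (phs u - phs o) (phs u - phs o)
   + lam / 2 * mgint Om (dfm u - dfm o) (dfm u - dfm o)
   + dt * nu * vvint Om (vel u) (vel u) + dt * gam * mint Om (str u) (str u)
   + dt * sgint Om (fun x => b (phs o x)) (chp u) (chp u)) = energy Om lam o.
Proof.
move=> [Vu Ru [Xu Xu'] [Su Su']] /schemeP sys.
have := energy_decay J0 (@Xh_linear_set R Om m Th) (@Sh_linear_set R Om m Th)
  (mint_psd oOm bOm cover) (mgint_psd oOm bOm cover) (sint_psd oOm bOm cover)
  (gint_psd oOm bOm cover) Xo So Vu Ru Xu Xu' Su Su' sys.
by [].
Qed.

Hypotheses (cw : C1 (fun z : R * 'M[R]_3 => w z.1 z.2)).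
Hypotheses (dpsi : forall r : R, derivable psi r 1) (cpsi : continuous (derive1 psi)).

(** Composed with discrete functions, a continuous derivative of [w] is continuous on the compact
    closure, hence bounded. *)
Lemma step_w_BM : BMm Om (fun x => d_T w (phs o x) (dfm o x)).
Proof.
move=> i j; apply: within_BM => //.
have := within_coef (cw.2 (0, delta_mx i j)) cphs (within_mx (fun i j => (Xo i j).1)).
rewrite [X in _ -> {within _, continuous X}](_ : _ = fun x =>
  'D_((0 : R), delta_mx i j) (fun z : R * 'M[R]_3 => w z.1 z.2) (phs o x, dfm o x)) //.
by apply/funext => x; rewrite d_TE.
Qed.

Lemma step_j_BM : BM Om (fun x => d_r (jfun psi w) (phs o x) (dfm o x)).
Proof.
apply: within_BM => //.
have h := within_coef (cw.2 (1, 0)) cphs (within_mx (fun i j => (Xo i j).1)).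
have h' : {within closure Om, continuous (fun x => derive1 psi (phs o x))}.
  by move=> x; apply: continuous_comp; [exact: cphs|exact: cpsi].
rewrite (_ : (fun x => _) = fun x => derive1 psi (phs o x) + 
  'D_((1 : R), (0 : 'M[R]_3)) (fun z : R * 'M[R]_3 => w z.1 z.2) (phs o x, dfm o x)).
  by move=> x; apply: contD (h' x) (h x).
by apply/funext => x; rewrite d_r_jfun // d_rE.
Qed.
Hypotheses (Om0 : Om !=set0) (cO : connected Om).
Hypotheses (kappa : R) (kappa0 : 0 < kappa) (lbb : LBB Om kappa Th).
Hypotheses (Vo : Vh Om Th (vel o)) (So' : Sh Om Th (chp o)) (Xo' : Xh Om Th (str o)).

Let Bchp : BM Om (chp o). Proof. by apply: (FEf_BM oOm bOm cover); exact: Sh_FE. Qed.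
Let Bdfm : BMm Om (dfm o). Proof. by apply: (FEm_BM oOm bOm cover); exact: Xh_FE. Qed.
Let Bstr : BMm Om (str o). Proof. by apply: (FEm_BM oOm bOm cover); exact: Xh_FE. Qed.
Let Bvel : BMv Om (vel o). Proof. by apply: (FEv_BM oOm bOm cover); exact: Vh_FE. Qed.
Let Bgrad : BMv Om (grad (phs o)).
Proof. by apply: (BMv_grad oOm bOm cover); exact: Sh_FE. Qed.
Let Bodot : BMv Om (odot (dfm o) (str o)).
Proof. by apply: (BMv_odot oOm bOm cover) => //; exact: Xh_FE. Qed.
Let Bconv : BMm Om (convect (vel o) (dfm o)).
Proof. by apply: (BMm_convect oOm bOm cover) => //; exact: Xh_FE. Qed.
Let Bvg : BMm Om (vgrad (vel o)).
Proof. by apply: (BMm_vgrad oOm bOm cover); exact: Vh_FE. Qed.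

Lemma step_f_lin : lin_on (Vh Om Th) step_f.
Proof.
apply: lin_on_add; first apply: lin_on_add; last exact: dotint_lin.
  have h := dotint_lin oOm bOm cover (c := fun x => chp o x *: grad (phs o) x).
  have e : (fun U : 'rV[R]_3 -> 'rV[R]_3 => intO Om (fun x => chp o x * dot (grad (phs o) x) (U x)))
      = fun U => intO Om (fun x => dot (chp o x *: grad (phs o) x) (U x)).
    apply/funext => U; apply: eq_intO => x _; rewrite -[chp o x *: _]addr0 dotDZl.
    by rewrite [dot 0 _]dotC dot0r addr0.
  rewrite e; apply: h => i; apply: (@eq_BM _ _ (fun x => chp o x * grad (phs o) x 0 i)).
    by move=> x; rewrite [RHS]mxE.
  exact: BMM.
apply: lin_on_opp; apply: (vgradint_lin oOm bOm cover).
by apply: BMm_mul => //; exact: BMm_tr.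
Qed.

Lemma step_g_lin : lin_on (Xh Om Th) step_g.
Proof.
apply: lin_on_add; first exact: frobint_lin.
by apply: lin_on_opp; apply: (frobint_lin oOm bOm cover); exact: BMm_mul.
Qed.

Lemma step_w_lin : lin_on (Xh Om Th) step_w.
Proof. by apply: (frobint_lin oOm bOm cover); exact: step_w_BM. Qed.

Lemma step_h_lin : lin_on (Sh Om Th) step_h.
Proof. by apply: (mulint_lin oOm bOm cover); exact: BM_dot. Qed.

Lemma step_j_lin : lin_on (Sh Om Th) step_j.
Proof. by apply: (mulint_lin oOm bOm cover); exact: step_j_BM. Qed.

Let nullO (W : zmodType) (u : 'rV[R]_3 -> W) x : null_on Om u -> Om x -> u x = 0.
Proof. by move=> h Ox; apply: h; exact: subset_closure. Qed.

Lemma step_f_null U : null_on Om U -> step_f U = 0.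
Proof.
move=> h; rewrite /step_f !int_null ?subr0 ?addr0 // => x Ox.
- by rewrite [U x]nullO ?dot0r.
- by rewrite (vgrad_null oOm h Ox) frob0r.
- by rewrite [U x]nullO ?dot0r ?mulr0.
Qed.

Lemma step_g_null T : null_on Om T -> step_g T = 0.
Proof.
by move=> h; rewrite /step_g !int_null ?subr0 // => x Ox; rewrite [T x]nullO ?frob0r.
Qed.

Lemma step_w_null T : null_on Om T -> step_w T = 0.
Proof. by move=> h; apply: int_null => x Ox; rewrite [T x]nullO ?frob0r. Qed.

Lemma step_h_null p : null_on Om p -> step_h p = 0.
Proof. by move=> h; apply: int_null => x Ox; rewrite [p x]nullO ?mulr0. Qed.

Lemma step_j_null p : null_on Om p -> step_j p = 0.
Proof. by move=> h; apply: int_null => x Ox; rewrite [p x]nullO ?mulr0. Qed.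

Lemma step_solvable : exists u, solves_step Om Th nu gam lam k dt b psi w o u /\
  forall u', solves_step Om Th nu gam lam k dt b psi w o u' -> state_eq Om u u'.
Proof.
have nX T : Xh Om Th T -> null_on Om T -> [/\ step_g T = 0, step_w T = 0,
    forall F, Xh Om Th F -> mint Om F T = 0 & forall F, Xh Om Th F -> mgint Om F T = 0].
  by move=> _ nT; split=> [||F _|F _];
    [exact: step_g_null|exact: step_w_null|exact: mint_null|exact: mgint_null].
have nY q : Sh Om Th q -> null_on Om q -> [/\ step_h q = 0, step_j q = 0,
    forall p, Sh Om Th p -> sint Om p q = 0 &
    forall p, Sh Om Th p -> gint Om p q = 0 /\ sgint Om (fun x => b (phs o x)) p q = 0].
  by move=> _ nq; split=> [||p _|p _];
    [exact: step_h_null|exact: step_j_null|exact: sint_null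
    |split; [exact: gint_null|exact: sgint_null]].
have [v [s [F [M [p [mu [beta [[Vv Qs [XF XM] [Yp Ym]] sys uniq]]]]]]]] :=
  @unknown_system_solvable R _ _ _ _ (Vh Om Th) (null_on Om (W := _))
  (Rh Om Th) (null_on Om (W := _)) (Xh Om Th) (null_on Om (W := _))
  (Sh Om Th) (null_on Om (W := _)) nu dt gam lam step_J
  (vvint Om) (divint Om) (mint Om) (mgint Om) (sint Om) (gint Om)
  (sgint Om (fun x => b (phs o x))) step_f step_g step_w step_h step_j
  nu0 dt0 gam0 lam0 J0 (@Vh_linear_set R Om m Th oOm bOm)
  (@Rh_linear_set R Om m Th oOm bOm cover) (@Xh_linear_set R Om m Th)
  (@Sh_linear_set R Om m Th) (vvint_psd oOm bOm cover) (mint_psd oOm bOm cover)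
  (mgint_psd oOm bOm cover) (sint_psd oOm bOm cover) (gint_psd oOm bOm cover)
  (sgint_psd oOm bOm cover step_b_BM step_b_ge0)
  (@divint_linl R Om m Th oOm bOm cover) (@divint_linr R Om m Th oOm bOm cover)
  step_f_lin step_g_lin step_w_lin step_h_lin step_j_lin
  (fun U _ => @step_f_null U) (fun v U _ _ => @vvint_null R Om oOm v U)
  (fun s U _ _ => @divint_nullr R Om oOm s U)
  (fun s U _ _ => @divint_nulll R Om s U)
  nX nY (vvint_definite oOm bOm Om0 cO cover) (mint_definite oOm bOm cover)
  (sint_definite oOm bOm cover)
  (fun q => @divint_definite R Om m Th oOm bOm cover kappa q kappa0 lbb)
  (dfm o) (phs o) (aux o) Xo So (unknowns_finite_span oOm bOm Om0 cover).
exists (State v s F M p mu beta); split; first by split; [split|apply/schemeP].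
move=> u' [[V' Q' [XF' XM'] [Yp' Ym']] /schemeP sys'].
have [n1 n2 [n3 n4] [n5 n6] n7] :=
  uniq _ _ _ _ _ _ _ (And4 V' Q' (conj XF' XM') (conj Yp' Ym')) sys'.
split=> [x cx|]; last exact/subr0_eq.
by split; [|..|split|split]; apply: subr0_eq;
  [exact: n1|exact: n2|exact: n3|exact: n4|exact: n5|exact: n6].
Qed.

End scheme_step.

(** Used to pull [tau^-1] out of the squared increments. *)
Lemma sym_psdZ (R : realType) (E : lmodType R) (S : E -> Prop) B a u :
  linear_set S -> sym_psd S B -> S u -> B (a *: u) (a *: u) = a ^+ 2 * B u u.
Proof.
move=> hS pB Su; have Sau := linear_setZ a hS Su; have S0 := proj1 hS.
have [lB _ _] := pB; have lBr v (Sv : S v) := sym_psd_linr pB Sv hS.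
have hl v : S v -> B (a *: u) v = a * B u v.
  move=> Sv; have := lB v Sv a _ _ Su S0; rewrite addr0 => ->.
  by rewrite (lin_on0 S0 (lB v Sv)) addr0.
have hr : B u (a *: u) = a * B u u.
  have := lBr u Su a _ _ Su S0; rewrite addr0 => ->.
  by rewrite (lin_on0 S0 (lBr u Su)) addr0.
by rewrite hl // hr expr2 mulrA.
Qed.

Lemma telescope_dissipation (R : numDomainType) (N : nat) (e d : nat -> R) :
  (forall n, (n < N)%N -> e n.+1 + d n = e n) ->
  forall n, (n <= N)%N -> e n + \sum_(i < n) d i = e 0%N.
Proof.
move=> ed; elim=> [|n IH] nN; first by rewrite big_ord0 addr0.
by rewrite big_ord_recr /= [_ + d n]addrC addrA ed // IH // ltnW.
Qed.

(** * Summation of the energy balance over the time levels *)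

Section stability.
Variables (R : realType) (Om : set 'rV[R]_3) (m : nat) (Th : 'I_m -> simplex R).
Variables (nu gam lam k dt : R) (b psi : R -> R) (w : R -> 'M[R]_3 -> R).
Hypotheses (oOm : open Om) (bOm : bounded_set Om).
Hypothesis cover : \bigcup_a elem (Th a) = closure Om.
Hypotheses (nu0 : 0 < nu) (gam0 : 0 < gam) (lam0 : 0 < lam) (dt0 : 0 < dt).
Variables (b0 : R) (b00 : 0 < b0) (bb0 : forall r, b0 <= b r) (cb : continuous b).
Hypothesis (J0 : forall phi F, {within closure Om, continuous phi} ->
  {within closure Om, continuous F} -> 0 < radicand Om k (jfun psi w) phi F).
Variables (N : nat) (u : nat -> state R).
Hypotheses (S0 : Sh Om Th (phs (u 0%N))) (X0 : Xh Om Th (dfm (u 0%N))).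
Hypothesis steps : forall n, (n < N)%N ->
  solves_step Om Th nu gam lam k dt b psi w (u n) (u n.+1).

Let vol := intO Om (fun=> 1).

Lemma vol_ge0 : 0 <= intO Om (fun=> 1 : R).
Proof. by apply: intO_ge0; exact: aeO_all. Qed.

Let inS n : (n <= N)%N -> Sh Om Th (phs (u n)) /\ Xh Om Th (dfm (u n)).
Proof. by case: n => // n /steps [[_ _ [? _] [? _]] _]. Qed.

Lemma energy_ge0 v : Sh Om Th (phs v) -> Xh Om Th (dfm v) -> 0 <= energy Om lam v.
Proof.
move=> Sv Xv; have [_ _ p1] := gint_psd oOm bOm cover; have [_ _ p2] := mgint_psd oOm bOm cover.
rewrite /energy !addr_ge0 ?sqr_ge0 //; first by rewrite mulr_ge0 // p1.
by rewrite mulr_ge0 ?p2 // divr_ge0 // ltW.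
Qed.

Let q1 n := (aux (u n.+1) - aux (u n)) ^+ 2.
Let q2 n := 2^-1 * gint Om (phs (u n.+1) - phs (u n)) (phs (u n.+1) - phs (u n)).
Let q3 n := lam / 2 * mgint Om (dfm (u n.+1) - dfm (u n)) (dfm (u n.+1) - dfm (u n)).
Let q4 n := dt * nu * vvint Om (vel (u n.+1)) (vel (u n.+1)).
Let q5 n := dt * gam * mint Om (str (u n.+1)) (str (u n.+1)).
Let q6 n := dt * sgint Om (fun x => b (phs (u n) x)) (chp (u n.+1)) (chp (u n.+1)).

Let balance n : (n < N)%N ->
  energy Om lam (u n.+1) + (q1 n + q2 n + q3 n + q4 n + q5 n + q6 n) = energy Om lam (u n).
Proof.
move=> nN; have [Sn Xn] := inS (ltnW nN); have [h1 h2] := steps nN.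
have cS : {within closure Om, continuous (phs (u n))} by case: Sn.
have cX : {within closure Om, continuous (dfm (u n))}.
  by apply: within_mx => i j; case: (Xn i j).
have J := J0 cS cX; rewrite -sqrtr_gt0 in J.
exact: (step_energy oOm bOm cover J).
Qed.

Let parts n : (n < N)%N ->
  [/\ 0 <= q1 n, 0 <= q2 n, 0 <= q3 n & [/\ 0 <= q4 n, 0 <= q5 n & 0 <= q6 n]].
Proof.
move=> nN; have [Sn Xn] := inS (ltnW nN); have [Sn' Xn'] := inS nN.
have [[Vv _ [_ Xs] [_ Sc]] _] := steps nN.
have [_ _ p2] := gint_psd oOm bOm cover; have [_ _ p3] := mgint_psd oOm bOm cover.
have [_ _ p4] := vvint_psd oOm bOm cover; have [_ _ p5] := mint_psd oOm bOm cover.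
have bge r : 0 <= b r by exact: le_trans (ltW b00) (bb0 r).
have [_ _ p6] := sgint_psd oOm bOm cover (step_b_BM oOm bOm cb Sn) (fun x => bge _).
have dS := linear_setB (@Sh_linear_set _ Om _ Th) Sn' Sn.
have dX := linear_setB (@Xh_linear_set _ Om _ Th) Xn' Xn.
split; last split.
- exact: sqr_ge0.
- by rewrite mulr_ge0 // p2.
- by apply: mulr_ge0; [rewrite divr_ge0 ?ltW|exact: p3].
- by apply: mulr_ge0; [rewrite mulr_ge0 ?ltW|exact: p4].
- by apply: mulr_ge0; [rewrite mulr_ge0 ?ltW|exact: p5].
- by apply: mulr_ge0; [rewrite ltW|exact: p6].
Qed.

Lemma energy_decreasing n : (n < N)%N -> energy Om lam (u n.+1) <= energy Om lam (u n).
Proof.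
by move=> nN; rewrite -(balance nN) lerDl; have [? ? ? [? ? ?]] := parts nN; rewrite !addr_ge0.
Qed.

Let d n := q1 n + q2 n + q3 n + q4 n + q5 n + q6 n.

Let d_ge0 n : (n < N)%N -> 0 <= d n.
Proof. by case/parts => ? ? ? [? ? ?]; rewrite /d !addr_ge0. Qed.

Let energy_le0 n : (n <= N)%N -> energy Om lam (u n) <= energy Om lam (u 0%N).
Proof.
move=> nN; rewrite -(telescope_dissipation balance nN) lerDl sumr_ge0 // => i _.
exact: d_ge0 (leq_trans (ltn_ord i) nN).
Qed.

Let dissipated : \sum_(n < N) d n <= energy Om lam (u 0%N).
Proof.
rewrite -(telescope_dissipation balance (leqnn N)) lerDr.
by have [? ?] := inS (leqnn N); exact: energy_ge0.
Qed.

(** The first [1] pays for the maximum of the energies. The other summand bounds all the weights of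
    the dissipated terms: [1] for velocity, stress and chemical potential, [(dt / tau) ^+ 2] for the
    gradient increments, and [vol] times this for the auxiliary variable, whose increment is a
    constant integrated over [Om]. *)
Lemma stability_bound tau : stability_lhs Om nu gam lam dt tau b N u <=
  (1 + (1 + vol) * (1 + (dt / tau) ^+ 2)) * energy Om lam (u 0%N).
Proof.
rewrite mulrDl mul1r /stability_lhs.
have E0 : 0 <= energy Om lam (u 0%N) by exact: energy_ge0.
move: E0 dissipated energy_le0; move: (energy Om lam (u 0%N)) => e0 e00 dis ele.
rewrite -!addrA lerD //.
  by apply: bigmax_le => // n _; exact: ele.
have v0 : 0 <= vol := vol_ge0.
have c1 : 1 <= (1 + vol) * (1 + (dt / tau) ^+ 2).
  by have := sqr_ge0 (dt / tau); nra.
have c2 : (dt / tau) ^+ 2 <= (1 + vol) * (1 + (dt / tau) ^+ 2).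
  by have := sqr_ge0 (dt / tau); nra.
have c3 : vol * (dt / tau) ^+ 2 <= (1 + vol) * (1 + (dt / tau) ^+ 2).
  by have := sqr_ge0 (dt / tau); nra.
have c0 := le_trans ler01 c1.
move: c1 c2 c3 c0; set cst := _ * (1 + _) => c1 c2 c3 c0.
(* The initial energy is replaced by the total dissipation, and the sums are compared level by
   level. *)
apply: le_trans (ler_wpM2l c0 dis).
rewrite !mulr_sumr -!big_split /=; apply: ler_sum => n _; rewrite /d.
have [Sn Xn] := inS (ltnW (ltn_ord n)); have [Sn' Xn'] := inS (ltn_ord n).
have dS := linear_setB (@Sh_linear_set _ Om _ Th) Sn' Sn.
have dX := linear_setB (@Xh_linear_set _ Om _ Th) Xn' Xn.
have -> : grad_sq Om (fun x => (phs (u n.+1) x - phs (u n) x) / tau) =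
    tau^-1 ^+ 2 * gint Om (phs (u n.+1) - phs (u n)) (phs (u n.+1) - phs (u n)).
  rewrite -(sym_psdZ tau^-1 (@Sh_linear_set _ Om _ Th) (gint_psd oOm bOm cover) dS).
  by congr grad_sq; apply/funext => x; rewrite mulrC.
have -> : mgrad_sq Om (fun x => tau^-1 *: (dfm (u n.+1) x - dfm (u n) x)) =
    tau^-1 ^+ 2 * mgint Om (dfm (u n.+1) - dfm (u n)) (dfm (u n.+1) - dfm (u n)).
  exact: (sym_psdZ tau^-1 (@Xh_linear_set _ Om _ Th) (mgint_psd oOm bOm cover) dX).
have -> : intO Om (fun=> ((aux (u n.+1) - aux (u n)) / tau) ^+ 2) =
    tau^-1 ^+ 2 * q1 n * vol.
  rewrite -intOZ //; last by apply: BM_Ig => //; exact: BM_cst.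
  by apply: eq_intO => x _; rewrite mulr1 exprMn mulrC.
have [p1 p2 p3 [p4 p5 p6]] := parts (ltn_ord n).
have -> : dt ^+ 2 / 2 * (tau^-1 ^+ 2 *
      gint Om (phs (u n.+1) - phs (u n)) (phs (u n.+1) - phs (u n)))
    = (dt / tau) ^+ 2 * q2 n by rewrite /q2 exprMn; ring.
have -> : lam * dt ^+ 2 / 2 * (tau^-1 ^+ 2 *
      mgint Om (dfm (u n.+1) - dfm (u n)) (dfm (u n.+1) - dfm (u n)))
    = (dt / tau) ^+ 2 * q3 n by rewrite /q3 exprMn; ring.
have -> : dt ^+ 2 * (tau^-1 ^+ 2 * q1 n * vol) = vol * (dt / tau) ^+ 2 * q1 n.
  by rewrite exprMn; ring.
rewrite -/(q4 n) -/(q5 n) -/(q6 n).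
have := ler_wpM2r p1 c3; have := ler_wpM2r p2 c2; have := ler_wpM2r p3 c2.
have := ler_wpM2r p4 c1; have := ler_wpM2r p5 c1; have := ler_wpM2r p6 c1.
rewrite /q4 /q5 /q6 /vvint /mint /sgint !mulrDr !mul1r; lra.
Qed.

End stability.

Lemma max1_gt0 (R : realType) (r : R) : 0 < Num.max r 1.
Proof. by rewrite lt_max ltr01 orbT. Qed.

(** The constants are to be positive for all arguments, including those for which the bound itself
    is not; it is raised to at least [1]. *)
Definition max1 (R : realType) (r : R) : {posnum R} :=
  PosNum (max1_gt0 r).

Lemma le_max1 (R : realType) (r : R) (c : {posnum R}) : r <= (max1 r)%:num + c%:num.
Proof. by apply: (@le_trans _ _ (Num.max r 1)); rewrite ?le_max ?lexx // lerDl. Qed.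

Theorem lemma5p2 (R : realType) (Om : set 'rV[R]_3) (T nu gam lam k : R)
    (b psi : R -> R) (w : R -> 'M[R]_3 -> R)
    (b0 b1 p d1 d2 d3 d4 c1 c2 l q sigma kappa : R)
    (hOm : C2_domain Om)
    (hT : 0 < T) (hnu : 0 < nu) (hgam : 0 < gam) (hlam : 0 < lam) (hk : 0 < k)
    (hb : b_ok b0 b1 b) (hw : w_ok p d1 d2 d3 d4 w)
    (hpsi : psi_ok p c1 c2 l q psi) (hkj : k_ok Om c2 d1 k (jfun psi w))
    (hsigma : 0 < sigma) (hkappa : 0 < kappa) :
  exists (C0 : ('rV[R]_3 -> R) -> ('rV[R]_3 -> 'M[R]_3) -> R -> {posnum R})
         (C : {posnum R})
         (D0 : R -> ('rV[R]_3 -> R) -> ('rV[R]_3 -> 'M[R]_3) -> R -> {posnum R})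
         (D : R -> {posnum R}),
  forall (m : nat) (Th : 'I_m -> simplex R) (N : nat),
    triangulation Om sigma Th -> LBB Om kappa Th -> (0 < N)%N ->
    let dt := T / N%:R in
    (forall o : state R,
       Vh Om Th (vel o) -> Sh Om Th (phs o) -> Sh Om Th (chp o) ->
       Xh Om Th (dfm o) -> Xh Om Th (str o) ->
       exists u, solves_step Om Th nu gam lam k dt b psi w o u /\
         forall u', solves_step Om Th nu gam lam k dt b psi w o u' ->
           state_eq Om u u') /\
    (forall (phi0 : 'rV[R]_3 -> R) (F0 : 'rV[R]_3 -> 'M[R]_3),
       H1 Om phi0 -> (forall i j, H1 Om (fun x => F0 x i j)) ->
       forall u : nat -> state R,
       discrete_solution Om Th nu gam lam k dt b psi w phi0 F0 N u ->
       [/\ stability_lhs Om nu gam lam dt dt b N u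
             <= (C0 (phs (u 0%N)) (dfm (u 0%N)) (aux (u 0%N)))%:num + C%:num,
           stability_lhs Om nu gam lam dt (dt ^+ 2) b N u
             <= (D0 dt (phs (u 0%N)) (dfm (u 0%N)) (aux (u 0%N)))%:num
                + (D dt)%:num &
           forall n, (n < N)%N -> energy Om lam (u n.+1) <= energy Om lam (u n)]).
Proof.
have [Om0 oOm cO bOm _] := hOm; have [b00 _ cb bb] := hb.
have bb0 r : b0 <= b r by case/andP: (bb r).
have [_ cw _ _ _] := hw; have [_ [dpsi cpsi] _ _ _] := hpsi; have [_ rad0] := hkj.
pose vol := intO Om (fun=> 1 : R).
(* The energy involves only these three fields; the others are filled with zeros. *)
pose E0 phi F beta := energy Om lam (State 0 0 F 0 phi 0 beta).
(* The witnesses are the factor of [stability_bound] times the initial energy. For [tau = dt] the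
   ratio is [1], so the constant is fixed before the mesh and [N]; for [tau = dt ^+ 2] the ratio
   [dt / dt ^+ 2] remains, whence the argument [dt] of [D0]. The additive constants are [1]. *)
exists (fun phi F beta => max1 ((1 + (1 + vol) * (1 + 1)) * E0 phi F beta)), (max1 0),
  (fun dt phi F beta => max1 ((1 + (1 + vol) * (1 + (dt / dt ^+ 2) ^+ 2)) * E0 phi F beta)),
  (fun=> max1 0).
move=> m Th N [_ cover _ _] lbb N0 dt.
have dt0 : 0 < dt by rewrite divr_gt0 // ltr0n.
split=> [z Vo So So' Xo Xo'|phi0 F0 _ _ u [[[S0 _] [X0 _] _ _] steps]].
  have J0 : 0 < step_J Om k psi w z.
    by rewrite sqrtr_gt0; apply: rad0; [case: So|apply: within_mx => i j; case: (Xo i j)].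
  exact: (step_solvable oOm bOm cover hnu hgam hlam dt0 b00 bb0 cb J0 So Xo cw dpsi cpsi
    Om0 cO hkappa lbb Vo So' Xo').
have bound := stability_bound oOm bOm cover hnu hgam hlam dt0 b00 bb0 cb rad0 S0 X0 steps.
split=> [||n nN].
- apply: le_trans (le_max1 _ _); have := bound dt.
  by rewrite divff ?gt_eqF // expr1n.
- by apply: le_trans (le_max1 _ _); exact: bound.
exact: (energy_decreasing oOm bOm cover hnu hgam hlam dt0 b00 bb0 cb rad0 S0 X0 steps nN).
Qed.
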